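(* Let $n\ge 1$ be an integer, let $R>0$, let $S_R^{2n-1}=\{z'\in\mathbb C^n:|z'|=R\}$, and let $S_{n+1}=S_R^{2n-1}\times\mathbb C\subset\mathbb C^{n+1}$. Write points of $\mathbb C^{n+1}$ as $z=(z',z_{n+1})$ with $z'\in\mathbb C^n$ and $z_{n+1}\in\mathbb C$. Let $f$ be a function on $\mathbb C^{n+1}$ such that $z\mapsto e^{\frac14|z'|^2}f(z)$ belongs to $L^p(\mathbb C^{n+1})$ for some $1\le p\le\infty$. Suppose that $f\times\mu_r(z)=0$ for all $r>0$ and all $z\in S_{n+1}$. Then $f=0$ almost everywhere on $\mathbb C^{n+1}$.
   Context: For $r>0$, $\mu_r$ denotes the normalized surface measure on the sphere $\{w\in\mathbb C^{n+1}:|w|=r\}$. The twisted spherical mean of a function $f$ on $\mathbb C^{n+1}$ is $$f\times\mu_r(z)=\int_{|w|=r}f(z-w)\,e^{\frac{i}{2}\operatorname{Im}(z\cdot\bar w)}\,d\mu_r(w),\qquad z\in\mathbb C^{n+1},$$ where $z\cdot\bar w=\sum_{j=1}^{n+1} z_j\bar w_j$. *)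

(* Defs.v *)
From HB Require Import structures.
From mathcomp Require Import all_boot all_order all_algebra.
From mathcomp Require Import all_classical all_reals all_analysis measurable_realfun.
From mathcomp Require Import complex.

Set Implicit Arguments.
Unset Strict Implicit.
Unset Printing Implicit Defensive.

Import Order.TTheory GRing.Theory Num.Theory.
Import numFieldNormedType.Exports.

Local Open Scope classical_set_scope.
Local Open Scope ring_scope.
Local Open Scope complex_scope.

(* The Borel sigma-algebras of C and C^m are transported from R * R and from
   m.-tuple C, which carry their product sigma-algebras. *)

Definition RxR_of_complex (R : realType) (c : R[i]) :
    measurableTypeR R * measurableTypeR R :=
  (complex.Re c, complex.Im c).

Definition complex_of_RxR (R : realType)
    (x : measurableTypeR R * measurableTypeR R) : R[i] := x.1 +i* x.2.

HB.instance Definition _ (R : realType) := isPointed.Build R[i] 0.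
HB.instance Definition _ (R : realType) := Measurable.copy R[i]
  (g_sigma_algebra_preimageType (@RxR_of_complex R)).

Definition tuple_of_row (R : realType) m (z : 'rV[R[i]]_m) : m.-tuple R[i] :=
  [tuple z 0 j | j < m].

HB.instance Definition _ (R : realType) m := isPointed.Build 'rV[R[i]]_m 0.
HB.instance Definition _ (R : realType) m := Measurable.copy 'rV[R[i]]_m
  (g_sigma_algebra_preimageType (@tuple_of_row R m)).

Section measurability.
Context (R : realType).

Lemma measurable_toC d (T : measurableType d) (f : T -> R[i]) :
  measurable_fun setT (@complex.Re R \o f) -> measurable_fun setT (@complex.Im R \o f) ->
  measurable_fun setT f.
Proof.
move=> mRe mIm _ _ [B mB <-]; rewrite !setTI.
have mf : measurable_fun setT (@RxR_of_complex R \o f).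
  by apply/measurable_fun_pairP; split.
by rewrite -[X in measurable X]setTI; exact: mf.
Qed.

Lemma measurable_RxR_of_complex : measurable_fun setT (@RxR_of_complex R).
Proof. by move=> _ B mB; exists B. Qed.

Lemma measurable_Re : measurable_fun setT (@complex.Re R).
Proof. by case/measurable_fun_pairP: measurable_RxR_of_complex. Qed.

Lemma measurable_Im : measurable_fun setT (@complex.Im R).
Proof. by case/measurable_fun_pairP: measurable_RxR_of_complex. Qed.

Lemma measurable_complex_of_RxR : measurable_fun setT (@complex_of_RxR R).
Proof. by apply: measurable_toC; [exact: measurable_fst|exact: measurable_snd]. Qed.

HB.instance Definition _ :=
  isMeasurableFun.Build _ _ _ _ (@complex_of_RxR R) measurable_complex_of_RxR.

Lemma measurable_to_row d (T : measurableType d) m (f : T -> 'rV[R[i]]_m) :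
  (forall j, measurable_fun setT (fun x => f x 0 j)) -> measurable_fun setT f.
Proof.
move=> mf _ _ [B mB <-]; rewrite !setTI.
have mtf : measurable_fun setT (@tuple_of_row R m \o f).
  apply/measurable_fun_tnthP => j; rewrite (_ : _ \o _ = fun x => f x 0 j)//.
  by apply/funext => x /=; rewrite tnth_mktuple.
by rewrite -[X in measurable X]setTI; exact: mtf.
Qed.

Lemma measurable_entry m (j : 'I_m) :
  measurable_fun setT (fun z : 'rV[R[i]]_m => z 0 j).
Proof.
have mt : measurable_fun setT (@tuple_of_row R m) by move=> _ B mB; exists B.
rewrite [X in measurable_fun _ X](_ : _ = (@tnth _ _ ^~ j) \o @tuple_of_row R m).
  by move/measurable_fun_tnthP : mt; exact.
by apply/funext => z /=; rewrite tnth_mktuple.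
Qed.

Lemma measurable_sqrt : measurable_fun [set: R] (fun x : R => Num.sqrt x).
Proof.
have H := @continuous_measurable_fun R (fun x : R => Num.sqrt x).
by apply H; exact: sqrt_continuous.
Qed.

Lemma measurable_invr : measurable_fun setT (@GRing.inv R).
Proof.
rewrite -(setUv [set 0]); apply/measurable_funU; [exact: measurable_set1| |].
  exact: measurableC (measurable_set1 _).
split; first exact: measurable_fun_set1.
apply: open_continuous_measurable_fun; first exact/closed_openC/closed_eq.
by move=> x; rewrite inE/= => /eqP x0; exact: inv_continuous.
Qed.

Definition row_cons m (x : R[i] * 'rV[R[i]]_m) : 'rV[R[i]]_m.+1 :=
  row_mx (x.1)%:M x.2.

Lemma row_consE0 m (x : R[i] * 'rV[R[i]]_m) : row_cons x 0 ord0 = x.1.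
Proof.
by rewrite mxE; case: splitP => //= k _; rewrite ord1 mxE eqxx mulr1n.
Qed.

Lemma row_consES m (x : R[i] * 'rV[R[i]]_m) j :
  row_cons x 0 (lift ord0 j) = x.2 0 j.
Proof.
rewrite mxE; case: splitP => [k|k]/=; first by rewrite ord1.
by rewrite /bump/= => -[/val_inj ->].
Qed.

Lemma measurable_row_cons m : measurable_fun setT (@row_cons m).
Proof.
apply: measurable_to_row => j; have [j' ->|->] := unliftP ord0 j.
  rewrite [X in measurable_fun _ X](_ : _ = (fun z : 'rV_m => z 0 j') \o snd).
    exact: measurableT_comp (measurable_entry j') measurable_snd.
  by apply/funext => x /=; rewrite row_consES.
rewrite [X in measurable_fun _ X](_ : _ = fst); first exact: measurable_fst.
by apply/funext => x; rewrite row_consE0.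
Qed.

HB.instance Definition _ m :=
  isMeasurableFun.Build _ _ _ _ (@row_cons m) (@measurable_row_cons m).

End measurability.

(* The library's instance of sigma-finiteness for \x is shadowed by the one for
   products of subprobabilities, hence this explicit proof. *)
Lemma sigma_finite_product d d' (T : measurableType d) (U : measurableType d')
    (R : realType) (mu : {sigma_finite_measure set T -> \bar R})
    (nu : {sigma_finite_measure set U -> \bar R}) :
  sigma_finite setT (mu \x nu)%E.
Proof.
have /sigma_finiteP[F [TF ndF Foo]] := sigma_finiteT mu.
have /sigma_finiteP[G [TG ndG Goo]] := sigma_finiteT nu.
exists (fun k => F k `*` G k).
  rewrite -setXTT TF TG predeqE => -[x y]; split.
    move=> [/= [j _ Fjx] [k _ Gky]]; exists (maxn j k) => //; split.
    - by move: x Fjx; exact/subsetPset/ndF/leq_maxl.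
    - by move: y Gky; exact/subsetPset/ndG/leq_maxr.
  by move=> [k _ []/= ? ?]; split; exists k.
move=> k; have [? ?] := Foo k; have [? ?] := Goo k.
split; first exact: measurableX.
by rewrite product_measure1E// lte_mul_pinfty// ge0_fin_numE.
Qed.

Lemma sigma_finite_pushforward d d' (T : measurableType d) (U : measurableType d')
    (R : realType) (mu : set T -> \bar R) (f : T -> U) (g : U -> T) :
  measurable_fun setT g -> cancel f g ->
  sigma_finite setT mu -> sigma_finite setT (pushforward mu f).
Proof.
move=> mg fK [F UF Foo].
exists (fun k => g @^-1` F k); first by rewrite -preimage_bigcup -UF preimage_setT.
move=> k; have [mF muF] := Foo k; split.
  by rewrite -[X in measurable X]setTI; exact: mg.
by rewrite /pushforward -comp_preimage (_ : g \o f = id)//; exact/funext.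
Qed.

Section lebesgue_complex.
Context (R : realType).

Definition lebesgue_complex : set R[i] -> \bar R :=
  pushforward (lebesgue_measure \x lebesgue_measure)%E (@complex_of_RxR R).

Let lebesgue_complex0 : lebesgue_complex set0 = 0%E.
Proof. exact: measure0. Qed.

Let lebesgue_complex_ge0 A : (0 <= lebesgue_complex A)%E.
Proof. exact: measure_ge0. Qed.

Let lebesgue_complex_sigma_additive : semi_sigma_additive lebesgue_complex.
Proof. exact: measure_semi_sigma_additive. Qed.

HB.instance Definition _ := isMeasure.Build _ _ _ lebesgue_complex
  lebesgue_complex0 lebesgue_complex_ge0 lebesgue_complex_sigma_additive.

Let lebesgue_complex_sigma_finite : sigma_finite setT lebesgue_complex.
Proof.
apply: (sigma_finite_pushforward (@measurable_RxR_of_complex R)); first by case.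
exact: sigma_finite_product.
Qed.

HB.instance Definition _ := Measure_isSigmaFinite.Build _ _ _ lebesgue_complex
  lebesgue_complex_sigma_finite.

End lebesgue_complex.

Section lebesgue_row_cons.
Context (R : realType) (m : nat).
Variable mu : {sigma_finite_measure set 'rV[R[i]]_m -> \bar R}.

Definition lebesgue_row_cons : set 'rV[R[i]]_m.+1 -> \bar R :=
  pushforward (@lebesgue_complex R \x mu)%E (@row_cons R m).

Let lebesgue_row_cons0 : lebesgue_row_cons set0 = 0%E.
Proof. exact: measure0. Qed.

Let lebesgue_row_cons_ge0 A : (0 <= lebesgue_row_cons A)%E.
Proof. exact: measure_ge0. Qed.

Let lebesgue_row_cons_sigma_additive : semi_sigma_additive lebesgue_row_cons.
Proof. exact: measure_semi_sigma_additive. Qed.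

HB.instance Definition _ := isMeasure.Build _ _ _ lebesgue_row_cons
  lebesgue_row_cons0 lebesgue_row_cons_ge0 lebesgue_row_cons_sigma_additive.

Let row_uncons (z : 'rV[R[i]]_m.+1) : R[i] * 'rV[R[i]]_m :=
  (z 0 ord0, \row_j z 0 (lift ord0 j)).

Let lebesgue_row_cons_sigma_finite : sigma_finite setT lebesgue_row_cons.
Proof.
have mg : measurable_fun setT row_uncons.
  apply/measurable_fun_pairP; split; first exact: measurable_entry.
  apply: measurable_to_row => j.
  rewrite [X in measurable_fun _ X](_ : _ = fun z : 'rV[R[i]]_m.+1 => z 0 (lift ord0 j)).
    exact: measurable_entry.
  by apply/funext => z /=; rewrite mxE.
apply: (sigma_finite_pushforward mg); last exact: sigma_finite_product.
case=> c z; congr pair; first by rewrite row_consE0.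
by apply/rowP => j; rewrite mxE row_consES.
Qed.

HB.instance Definition _ := Measure_isSigmaFinite.Build _ _ _ lebesgue_row_cons
  lebesgue_row_cons_sigma_finite.

End lebesgue_row_cons.

(* Lebesgue measure on C^m = R^(2m), as an iterated product. *)
Fixpoint lebesgueC (R : realType) (m : nat) :
    {sigma_finite_measure set 'rV[R[i]]_m -> \bar R} :=
  if m is k.+1 then lebesgue_row_cons (lebesgueC R k)
  else \d_(0 : 'rV[R[i]]_0).

Section sphere.
Context (R : realType) (m : nat).
Implicit Types (z w : 'rV[R[i]]_m) (r : R).

Definition cnorm z : R := Num.sqrt (\sum_j Normc.normc (z 0 j) ^+ 2).

Definition csphere r : set 'rV[R[i]]_m := [set w | cnorm w = r].

Definition cball1 : set 'rV[R[i]]_m := [set w | cnorm w <= 1].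

Definition sphere_proj r w : 'rV[R[i]]_m := (r / cnorm w)%:C *: w.

Lemma measurable_normc : measurable_fun setT (@Normc.normc R).
Proof.
rewrite (_ : @Normc.normc R =
    fun c => Num.sqrt (complex.Re c ^+ 2 + complex.Im c ^+ 2)); last first.
  by apply/funext => -[].
apply: (measurableT_comp (@measurable_sqrt R)).
apply: measurable_funD; apply: measurable_funX.
- exact: measurable_Re.
- exact: measurable_Im.
Qed.

Lemma measurable_cnorm : measurable_fun setT cnorm.
Proof.
apply: (measurableT_comp (@measurable_sqrt R)).
apply: measurable_sum => j; apply: measurable_funX.
by apply: measurableT_comp; [exact: measurable_normc|exact: measurable_entry].
Qed.

Lemma measurable_cball1 : measurable cball1.
Proof.
rewrite -[cball1]setTI; apply: measurable_fun_le => //.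
exact: measurable_cnorm.
Qed.

Lemma measurable_sphere_proj r : measurable_fun setT (sphere_proj r).
Proof.
have mV : measurable_fun setT (fun w => r / cnorm w).
  apply: measurable_funM => //.
  by apply: measurableT_comp; [exact: measurable_invr|exact: measurable_cnorm].
apply: measurable_to_row => j; apply: measurable_toC.
- rewrite (_ : _ \o _ = fun w => r / cnorm w * complex.Re (w 0 j)).
    apply: measurable_funM => //.
    by apply: measurableT_comp; [exact: measurable_Re|exact: measurable_entry].
  by apply/funext => w /=; rewrite mxE; case: (w 0 j) => a b /=; rewrite mul0r subr0.
- rewrite (_ : _ \o _ = fun w => r / cnorm w * complex.Im (w 0 j)).
    apply: measurable_funM => //.
    by apply: measurableT_comp; [exact: measurable_Im|exact: measurable_entry].
  by apply/funext => w /=; rewrite mxE; case: (w 0 j) => a b /=; rewrite mul0r addr0.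
Qed.

HB.instance Definition _ r :=
  isMeasurableFun.Build _ _ _ _ (sphere_proj r) (measurable_sphere_proj r).

(* The default \d_0 is not used when 0 < m: the unit ball has finite positive
   measure. *)
Definition uniform_ball1 : probability 'rV[R[i]]_m R :=
  mnormalize (mrestr (lebesgueC R m) measurable_cball1) \d_(0 : 'rV[R[i]]_m).

(* By integration in polar coordinates, the normalized surface measure is
   mu_r(A) = |{w : |w| <= 1 and r w/|w| \in A}| / |{w : |w| <= 1}|. *)
Definition sphere_measure r : probability 'rV[R[i]]_m R :=
  distribution uniform_ball1 (sphere_proj r).

End sphere.

Section twisted_spherical_mean.
Context (R : realType).

(* As for \int on reals, a component whose integral is undefined or infinite is
   given the value 0. *)
Definition integralC d (T : measurableType d) (mu : {measure set T -> \bar R})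
    (D : set T) (g : T -> R[i]) : R[i] :=
  (\int[mu]_(x in D) complex.Re (g x)) +i* (\int[mu]_(x in D) complex.Im (g x)).

Definition expi (t : R) : R[i] := cos t +i* sin t.

Definition cdot m (z w : 'rV[R[i]]_m) : R[i] := \sum_j z 0 j * (w 0 j)^*.

Definition twisted_spherical_mean m (f : 'rV[R[i]]_m -> R[i]) (r : R)
    (z : 'rV[R[i]]_m) : R[i] :=
  integralC (sphere_measure m r) (csphere r)
    (fun w => f (z - w) * expi (complex.Im (cdot z w) / 2)).

(* g need only be measurable for the completion of mu: for the measure lebesgueC,
   Lebesgue measurable rather than Borel. *)
Definition mem_Lp d (T : measurableType d) (mu : {measure set T -> \bar R})
    (p : \bar R) (g : T -> R[i]) : Prop :=
  exists h : T -> R[i], [/\ measurable_fun setT h, {ae mu, forall x, g x = h x}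
    & ('N[mu]_p[(fun x => (Normc.normc (h x))%:E)] < +oo)%E].

End twisted_spherical_mean.

(* Main.v *)
Require Import Defs.
From HB Require Import structures.
From mathcomp Require Import all_boot all_order all_algebra.
From mathcomp Require Import all_classical all_reals all_analysis.
From mathcomp Require Import complex measurable_realfun ess_sup_inf.
From mathcomp Require Import ring lra.


(** Write [u = (u', v)] for the points of [C^n x C] and [f u = exp (- |u'|^2 / 4) g u].
    Membership of [g] in some [L^p] is used in the form [|g| <= M + k] with [k]
    integrable ([mem_Lp_L1_Linfty]).

    Averaging the twisted spherical means at [z] over the radius against
    [exp (- t r^2)] gives, by polar coordinates, an absolutely convergent integral of
    [g] against the exponential of
    [- b |u'|^2 + c1 q + c2 q^* - t |v|^2 + s1 v^* + s2 v], where [q] is the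
    Hermitian product of [z'] and [u'], [b = c2 = t + 1/4] and [c1 = t - 1/4]
    ([gaussian_mean_eq0]). Such integrals are analytic in the parameters
    [(b, c1, c2, t, s1, s2)]; as the exponent is linear in them, the identity
    theorem is only needed along complex lines, where the integral is a power series
    ([phase_identity], [kernel_line_identity]). The zeros known for [t > 0] and
    [|z'| = rho] spread in this way: first [s1] and [s2] become independent, then the
    coefficient of [|v|^2] is frozen to [1/8] while [b] varies, and then [b] becomes
    complex. At that point the known zeros are on the quadric [c1 c2 = b (b - 1/2)],
    along the lines of one of its rulings, obtained from each other by rotating [z'].
    The other ruling reaches the points [(b, c1, c2) = (e, - kap, kap)] with
    [0 < e < 1/2] and [kap ^ 2 = e (1/2 - e)] ([kernel_vanishing_on_sphere]), where
    the exponential [exp (- e |u'|^2 - 2 i kap Im q)] is bounded. In other words, with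
    [h = g exp (- |v|^2 / 8 + s1 v^* + s2 v)], the function
      [V (e, x) = int h exp (- e |u'|^2 - 2 i <x, u'>)]
    of [e > 0] and [x] in [R^(2n)] vanishes for [|x|^2 = rho^2 e (1/2 - e)].

    This [V] solves the heat equation with time [e], and is bounded by a multiple of
    [e ^ (- n)]. The ball [|x|^2 <= rho^2 e (1/2 - e)] shrinks to a point when [e]
    tends to [0] as fast as [sqrt e], so no initial values are available, and the
    bound [e ^ (- n)] is the one of the heat kernel, which does not vanish on the
    boundary of the domain. The maximum principle still shows that [V] vanishes in the
    domain up to time [1/4]: the supersolution
      [e ^ (- n) ((K - ln e / 2) exp (- |x|^2 / e) - 1)]
    dominates [e ^ (- n)] by a logarithmic factor there ([heat_uniqueness]). Along rays
    [V (1/4, .)] is again a power series, so it vanishes everywhere.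

    Hence all the Fourier coefficients of the integrable function
    [g exp (- |u'|^2 / 4 - |v|^2 / 8)] are zero, so that this function is zero almost
    everywhere ([fourier_uniqueness]), and so are [g] and [f]. *)

Set Implicit Arguments.
Unset Strict Implicit.
Unset Printing Implicit Defensive.

Import Order.TTheory GRing.Theory Num.Theory.
Import numFieldNormedType.Exports.

Local Open Scope classical_set_scope.
Local Open Scope ring_scope.
Local Open Scope complex_scope.

Local Notation Re := complex.Re.
Local Notation Im := complex.Im.
Local Notation normc := Normc.normc.

(** * Complex numbers and the exponential *)

Section complex_basics.
Context {R : realType}.
Implicit Types (z w c : R[i]) (x y : R).

Lemma Re_add z w : Re (z + w) = Re z + Re w. Proof. by case: z; case: w. Qed.
Lemma Im_add z w : Im (z + w) = Im z + Im w. Proof. by case: z; case: w. Qed.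
Lemma Re_opp z : Re (- z) = - Re z. Proof. by case: z. Qed.
Lemma Im_opp z : Im (- z) = - Im z. Proof. by case: z. Qed.
Lemma Re_sub z w : Re (z - w) = Re z - Re w. Proof. by rewrite Re_add Re_opp. Qed.
Lemma Im_sub z w : Im (z - w) = Im z - Im w. Proof. by rewrite Im_add Im_opp. Qed.
Lemma Re_mul z w : Re (z * w) = Re z * Re w - Im z * Im w.
Proof. by case: z; case: w. Qed.
Lemma Im_mul z w : Im (z * w) = Re z * Im w + Im z * Re w.
Proof. by case: z; case: w. Qed.
Lemma Re_scale x z : Re (x%:C * z) = x * Re z.
Proof. by rewrite Re_mul /= mul0r subr0. Qed.
Lemma Im_scale x z : Im (x%:C * z) = x * Im z.
Proof. by rewrite Im_mul /= mul0r addr0. Qed.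
Lemma Re_sum (I : Type) (s : seq I) (P : pred I) (F : I -> R[i]) :
  Re (\sum_(i <- s | P i) F i) = \sum_(i <- s | P i) Re (F i).
Proof. by elim/big_rec2 : _ => //= i x y _ <-; rewrite Re_add. Qed.
Lemma Im_sum (I : Type) (s : seq I) (P : pred I) (F : I -> R[i]) :
  Im (\sum_(i <- s | P i) F i) = \sum_(i <- s | P i) Im (F i).
Proof. by elim/big_rec2 : _ => //= i x y _ <-; rewrite Im_add. Qed.
Lemma Re_conjc z : Re z^* = Re z. Proof. by case: z. Qed.
Lemma Im_conjc z : Im z^* = - Im z. Proof. by case: z. Qed.

Lemma complexP z w : Re z = Re w -> Im z = Im w -> z = w.
Proof. by case: z; case: w => /= a b c d -> ->. Qed.

Lemma normcE z : normc z = Num.sqrt (Re z ^+ 2 + Im z ^+ 2).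
Proof. by case: z. Qed.

Lemma normc_norm z : `|z| = (normc z)%:C. Proof. by []. Qed.

Lemma normc_ge0 z : 0 <= normc z. Proof. by rewrite normcE sqrtr_ge0. Qed.

Lemma normcD z w : normc (z + w) <= normc z + normc w.
Proof. by rewrite -lecR rmorphD/= -!normc_norm ler_normD. Qed.

Lemma normcN z : normc (- z) = normc z.
Proof. by apply: complexI; rewrite -!normc_norm normrN. Qed.

Lemma normcX z n : normc (z ^+ n) = normc z ^+ n.
Proof. by apply: complexI; rewrite rmorphXn/= -!normc_norm normrX. Qed.

Lemma normcR x : normc x%:C = `|x|.
Proof. by rewrite /= expr0n addr0 sqrtr_sqr. Qed.

Lemma normc_conjc z : normc z^* = normc z.
Proof. by rewrite !normcE Re_conjc Im_conjc sqrrN. Qed.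

Lemma normc_sqr z : normc z ^+ 2 = Re z ^+ 2 + Im z ^+ 2.
Proof. by rewrite normcE sqr_sqrtr// addr_ge0// sqr_ge0. Qed.

Lemma normc_Re z : `|Re z| <= normc z.
Proof.
by rewrite normcE -sqrtr_sqr ler_sqrt ?lerDl ?sqr_ge0// addr_ge0// sqr_ge0.
Qed.

Lemma normc_Im z : `|Im z| <= normc z.
Proof.
by rewrite normcE -sqrtr_sqr ler_sqrt ?lerDr ?sqr_ge0// addr_ge0// sqr_ge0.
Qed.

Lemma normc_le z : normc z <= `|Re z| + `|Im z|.
Proof.
have -> : z = (Re z)%:C + (0 +i* Im z).
  by apply: complexP; rewrite ?Re_add ?Im_add/= ?addr0 ?add0r.
rewrite (le_trans (normcD _ _))// normcR (normcE (0 +i* _)) Re_add Im_add/=.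
by rewrite expr0n add0r sqrtr_sqr add0r addr0.
Qed.

Lemma normc_eq0 z : normc z = 0 -> z = 0. Proof. exact: Normc.eq0_normc. Qed.

Lemma mulcJ z : z * z^* = (normc z ^+ 2)%:C.
Proof.
apply: complexP; rewrite ?Re_mul ?Im_mul Re_conjc Im_conjc normc_sqr/=; ring.
Qed.

(** A complex number is determined by its rotated real parts, which turns
    complex estimates into real ones. *)
Lemma normc_le_Re z x :
  (forall c, normc c <= 1 -> Re (c * z) <= x) -> normc z <= x.
Proof.
move=> H; have [z0|z0] := eqVneq (normc z) 0.
  rewrite z0; have := H 0; rewrite mul0r Normc.normc0; apply; exact: ler01.
have := H ((normc z)^-1%:C * z^*); rewrite Normc.normcM normcR normc_conjc.
rewrite ger0_norm ?invr_ge0 ?normc_ge0// mulVf// => /(_ (lexx _)).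
by rewrite -mulrA Re_scale [_^* * _]mulrC mulcJ/= expr2 mulrA mulVf// mul1r.
Qed.

Definition cexp z : R[i] :=
  (expR (Re z) * cos (Im z)) +i* (expR (Re z) * sin (Im z)).

Lemma Re_cexp z : Re (cexp z) = expR (Re z) * cos (Im z).
Proof. by []. Qed.

Lemma Im_cexp z : Im (cexp z) = expR (Re z) * sin (Im z).
Proof. by []. Qed.

Lemma normc_expi x : normc (expi x) = 1.
Proof. by rewrite normcE/= cos2Dsin2 sqrtr1. Qed.

Lemma cexpE z : cexp z = (expR (Re z))%:C * expi (Im z).
Proof. by apply: complexP; rewrite ?Re_scale ?Im_scale. Qed.

Lemma normc_cexp z : normc (cexp z) = expR (Re z).
Proof.
by rewrite cexpE Normc.normcM normc_expi mulr1 normcR ger0_norm// expR_ge0.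
Qed.

Lemma cexpD z w : cexp (z + w) = cexp z * cexp w.
Proof.
apply: complexP; rewrite ?Re_mul ?Im_mul !Re_cexp !Im_cexp Re_add Im_add expRD.
  by rewrite cosD; ring.
by rewrite sinD; ring.
Qed.

Lemma cexp0 : cexp 0 = 1.
Proof.
by apply: complexP; rewrite ?Re_cexp ?Im_cexp/= expR0 ?cos0 ?sin0 ?mulr1 ?mulr0.
Qed.

Lemma cexp_neq0 z : cexp z != 0.
Proof.
apply: contraTN (expR_gt0 (Re z)) => /eqP z0.
by rewrite -normc_cexp z0 Normc.normc0 ltxx.
Qed.

Lemma cexpR x : cexp x%:C = (expR x)%:C.
Proof.
by apply: complexP; rewrite ?Re_cexp ?Im_cexp/= ?cos0 ?sin0 ?mulr1 ?mulr0.
Qed.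

Lemma cexpNi x : cexp (0 +i* x) = expi x.
Proof. by rewrite cexpE/= expR0 mul1r. Qed.

End complex_basics.

Lemma is_derive_scale (R : realType) (k : R) (f : R -> R) (x df : R) :
  is_derive x 1 f df -> is_derive x 1 (fun t => k * f t) (k * df).
Proof. by move=> h; exact: (@is_deriveZ _ _ _ f k). Qed.

Lemma is_derive_mul (R : realType) (f g : R -> R) (x df dg : R) :
  is_derive x 1 f df -> is_derive x 1 g dg ->
  is_derive x 1 (fun t => f t * g t) (f x * dg + g x * df).
Proof. by move=> df' dg'; exact: (@is_deriveM _ _ f g). Qed.

Section exp_remainder.
Context {R : realType}.
Implicit Types (w c : R[i]) (t y th : R) (N : nat).

(** Remainders along the segment from [0] to [w] and to [y]: each is the integral
    of the previous one, so that the comparison of exponentials passes to remainders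
    of any order. *)
Let cexp_rem w N c t : R :=
  Re (c * cexp (t%:C * w)) - \sum_(k < N) Re (c * w ^+ k) / k`!%:R * t ^+ k.

Let exp_rem y N t : R := expR (y * t) - \sum_(k < N) y ^+ k / k`!%:R * t ^+ k.

Let fact1 k : (k.+1)%:R / (k.+1)`!%:R = (k`!%:R)^-1 :> R.
Proof.
by rewrite factS natrM invfM mulrA divff ?mul1r// pnatr_eq0.
Qed.

Let is_derive_psum (a b : nat -> R) N t :
  (forall k, b k = k.+1%:R * a k.+1) ->
  is_derive t 1 (fun t => \sum_(k < N.+1) a k * t ^+ k)
    (\sum_(k < N) b k * t ^+ k).
Proof.
move=> ab; rewrite (_ : (fun _ => _) =
    \sum_(k < N.+1) (fun t : R => a k * t ^+ k)); last first.
  by apply/funext => s; rewrite fct_sumE.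
have -> : \sum_(k < N) b k * t ^+ k =
    \sum_(k < N.+1) (a k * (k%:R * t ^+ k.-1)).
  rewrite big_ord_recl /= mul0r mulr0 add0r; apply: eq_bigr => k _.
  by rewrite /bump/= add1n ab mulrA [a _ * _]mulrC.
apply: is_derive_sum => k.
apply: is_derive_scale; have := @is_deriveX _ _ (@id R) k t 1 1 _.
rewrite exprfctE /GRing.scale/= mulr1; apply; exact: is_derive_id.
Qed.

Let is_derive_cexp_rem w N c t :
  is_derive t 1 (cexp_rem w N.+1 c) (cexp_rem w N (c * w) t).
Proof.
rewrite /cexp_rem; apply: is_deriveB; last first.
  apply: (@is_derive_psum (fun k => Re (c * w ^+ k) / k`!%:R) (fun k => Re (c * w * w ^+ k) / k`!%:R)) => k.
  by rewrite exprS mulrA -fact1; ring.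
rewrite (_ : (fun _ => _) = (fun t => expR (t * Re w) *
  (Re c * cos (t * Im w) - Im c * sin (t * Im w)))); last first.
  by apply/funext => s; rewrite Re_mul Re_cexp Im_cexp Re_scale Im_scale; ring.
have dl (a : R) : is_derive t 1 (fun t : R => t * a) a.
  have h := is_derive_mul (is_derive_id t 1) (is_derive_cst a t 1).
  by apply: (is_derive_eq h); rewrite mulr0 add0r mulr1.
have de : is_derive t 1 (fun t : R => expR (t * Re w)) (expR (t * Re w) * Re w).
  by apply: (@is_derive1_comp _ expR); exact: dl.
have dc : is_derive t 1 (fun t : R => cos (t * Im w)) (- sin (t * Im w) * Im w).
  by apply: (@is_derive1_comp _ cos); exact: dl.
have ds : is_derive t 1 (fun t : R => sin (t * Im w)) (cos (t * Im w) * Im w).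
  by apply: (@is_derive1_comp _ sin); exact: dl.
have dc' : is_derive t 1 (fun t : R => Re c * cos (t * Im w))
  (Re c * (- sin (t * Im w) * Im w)) by exact: is_derive_scale.
have ds' : is_derive t 1 (fun t : R => Im c * sin (t * Im w))
  (Im c * (cos (t * Im w) * Im w)) by exact: is_derive_scale.
have h := is_derive_mul de (is_deriveB dc' ds').
apply: (is_derive_eq h); rewrite !fctE.
by rewrite !Re_mul !Im_mul Re_cexp Im_cexp Re_scale Im_scale; ring.
Qed.

Let is_derive_exp_rem y N t :
  is_derive t 1 (exp_rem y N.+1) (y * exp_rem y N t).
Proof.
rewrite /exp_rem mulrBr mulr_sumr; apply: is_deriveB; last first.
  under eq_bigr do rewrite mulrA.
  apply: (@is_derive_psum (fun k => y ^+ k / k`!%:R)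
    (fun k => y * (y ^+ k / k`!%:R))) => k.
  by rewrite exprS -fact1; ring.
have h := is_derive_scale y (is_derive_id t 1).
have h' := @is_derive1_comp _ expR _ t _ _ (is_derive_expR _) h.
by apply: (is_derive_eq h'); rewrite mulr1 mulrC.
Qed.

Let le_increment (f g df dg : R -> R) t : 0 <= t ->
  (forall s : R, is_derive s 1 f (df s)) ->
  (forall s : R, is_derive s 1 g (dg s)) ->
  (forall s, 0 <= s -> df s <= dg s) -> f 0 = g 0 -> f t <= g t.
Proof.
move=> t0 f' g' fg fg0.
have h' (s : R) : is_derive s 1 (g - f) (dg s - df s) by exact: is_deriveB.
have h0 : (g - f) 0 = 0 by rewrite !fctE fg0 subrr.
have hc : {within `[0, t], continuous (g - f)}.
  apply: continuous_subspaceT => x.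
  by apply/differentiable_continuous/derivable1_diffP; case: (h' x).
have [x] := @MVT_segment _ (g - f) _ 0 t t0 (fun x _ => h' x) hc.
rewrite in_itv/= => /andP[x0 _]; rewrite h0 subr0 !fctE subr0 => e.
by rewrite -subr_ge0 e mulr_ge0// subr_ge0 fg.
Qed.

Let cexp_rem_le w y th N c t : 0 <= th <= 1 -> normc w = th * y -> 0 <= y ->
  0 <= t -> cexp_rem w N c t <= normc c * th ^+ N * exp_rem y N t.
Proof.
move=> /andP[th0 th1] wy y0; elim: N c t => [|N IH] c t t0.
  rewrite /cexp_rem /exp_rem !big_ord0 !subr0 expr0 mulr1.
  rewrite (le_trans (ler_norm _))// (le_trans (normc_Re _))//.
  rewrite Normc.normcM normc_cexp ler_wpM2l ?normc_ge0// ler_expR Re_scale mulrC.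
  rewrite ler_wpM2r// (le_trans (ler_norm _))// (le_trans (normc_Re _))// wy.
  by rewrite ler_piMl.
apply: (@le_increment _ (fun t => normc c * th ^+ N.+1 * exp_rem y N.+1 t)
  (cexp_rem w N (c * w)) (fun t => normc c * th ^+ N.+1 * (y * exp_rem y N t)) t t0
  (is_derive_cexp_rem w N c)).
- by move=> s; exact: is_derive_scale.
- move=> s s0; rewrite (le_trans (IH _ _ s0))// Normc.normcM wy exprS.
  by rewrite le_eqVlt; apply/orP; left; apply/eqP; ring.
- rewrite /cexp_rem /exp_rem !big_ord_recl/= !expr0 !mulr0 expR0 big1; last first.
    by move=> i _; rewrite expr0n/= mulr0.
  rewrite [X in _ = _ * (_ - (_ + X))]big1; last first.
    by move=> i _; rewrite expr0n/= mulr0.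
  by rewrite mul0r cexp0 fact0 divr1 !mulr1 !addr0 subrr divr1 subrr mulr0.
Qed.

(** The remainder of the exponential series at [w] is dominated termwise, hence
    shrinks geometrically when the modulus of [w] shrinks by the factor [th]. *)
Lemma cexp_remainder w y th N : 0 <= th <= 1 -> normc w = th * y -> 0 <= y ->
  normc (cexp w - \sum_(k < N) w ^+ k * (k`!%:R)^-1%:C) <= th ^+ N * expR y.
Proof.
move=> thb wy y0; apply: normc_le_Re => c c1.
have := @cexp_rem_le w y th N c 1 thb wy y0 ler01.
rewrite /cexp_rem mul1r (_ : _ - _ = Re (c * (cexp w -
    \sum_(k < N) w ^+ k * (k`!%:R)^-1%:C))); last first.
  rewrite mulrBr Re_sub mulr_sumr Re_sum; congr (_ - _); apply: eq_bigr => k _.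
  by rewrite expr1n mulr1 mulrA [RHS]Re_mul/= mulr0 subr0.
move=> /le_trans; apply; have /andP[th0 th1] := thb.
rewrite -mulrA.
have e1 : exp_rem y N 1 <= expR y.
  rewrite /exp_rem mulr1 gerBl sumr_ge0// => k _.
  by rewrite expr1n mulr1 mulr_ge0 ?exprn_ge0// invr_ge0 ler0n.
rewrite (le_trans (ler_wpM2l (normc_ge0 _) (ler_wpM2l (exprn_ge0 _ th0) e1)))//.
by rewrite ler_piMl// mulr_ge0 ?exprn_ge0 ?expR_ge0.
Qed.

End exp_remainder.

Arguments Normc.normc : simpl never.

(** * Complex integrals and power series *)

Section complex_measurability.
Context {d} {T : measurableType d} {R : realType}.
Implicit Types (f g : T -> R[i]) (h : T -> R).

Lemma measurable_fun_Re f :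
  measurable_fun setT f -> measurable_fun setT (fun x => Re (f x)).
Proof. by move=> mf; exact: (measurableT_comp (@measurable_Re R)). Qed.

Lemma measurable_fun_Im f :
  measurable_fun setT f -> measurable_fun setT (fun x => Im (f x)).
Proof. by move=> mf; exact: (measurableT_comp (@measurable_Im R)). Qed.

Lemma measurable_fun_normc f :
  measurable_fun setT f -> measurable_fun setT (fun x => normc (f x)).
Proof. by move=> mf; exact: (measurableT_comp (@measurable_normc R)). Qed.

Lemma measurable_funC_cst (c : R[i]) : measurable_fun setT (fun _ : T => c).
Proof. exact: measurable_cst. Qed.

Lemma measurable_funC_real h :
  measurable_fun setT h -> measurable_fun setT (fun x => (h x)%:C).
Proof. by move=> mh; apply: measurable_toC => //; exact: measurable_cst. Qed.

Lemma measurable_funC_add f g : measurable_fun setT f ->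
  measurable_fun setT g -> measurable_fun setT (fun x => f x + g x).
Proof.
move=> mf mg; apply: measurable_toC.
- rewrite (_ : _ \o _ = fun x => Re (f x) + Re (g x)).
    by apply: measurable_funD; exact: measurable_fun_Re.
  by apply/funext => x /=; rewrite Re_add.
- rewrite (_ : _ \o _ = fun x => Im (f x) + Im (g x)).
    by apply: measurable_funD; exact: measurable_fun_Im.
  by apply/funext => x /=; rewrite Im_add.
Qed.

Lemma measurable_funC_mul f g : measurable_fun setT f ->
  measurable_fun setT g -> measurable_fun setT (fun x => f x * g x).
Proof.
move=> mf mg; apply: measurable_toC.
- rewrite (_ : _ \o _ = fun x => Re (f x) * Re (g x) - Im (f x) * Im (g x)).
    by apply: measurable_funB; apply: measurable_funM;
      do ?exact: measurable_fun_Re; exact: measurable_fun_Im.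
  by apply/funext => x /=; rewrite Re_mul.
- rewrite (_ : _ \o _ = fun x => Re (f x) * Im (g x) + Im (f x) * Re (g x)).
    by apply: measurable_funD; apply: measurable_funM;
      do ?exact: measurable_fun_Re; exact: measurable_fun_Im.
  by apply/funext => x /=; rewrite Im_mul.
Qed.

Lemma measurable_funC_opp f :
  measurable_fun setT f -> measurable_fun setT (fun x => - f x).
Proof.
move=> mf; under eq_fun do rewrite -mulN1r.
by apply: measurable_funC_mul => //; exact: measurable_cst.
Qed.

Lemma measurable_funC_exp f n :
  measurable_fun setT f -> measurable_fun setT (fun x => f x ^+ n).
Proof.
move=> mf; elim: n => [|n IH]; first exact: measurable_cst.
by under eq_fun do rewrite exprS; exact: measurable_funC_mul.
Qed.

Lemma measurable_funC_conj f :
  measurable_fun setT f -> measurable_fun setT (fun x => (f x)^*).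
Proof.
move=> mf; apply: measurable_toC.
- rewrite (_ : _ \o _ = fun x => Re (f x)); first exact: measurable_fun_Re.
  by apply/funext => x /=; rewrite Re_conjc.
- rewrite (_ : _ \o _ = fun x => - Im (f x)).
    by apply: measurableT_comp => //; exact: measurable_fun_Im.
  by apply/funext => x /=; rewrite Im_conjc.
Qed.

Lemma measurable_funC_cexp f :
  measurable_fun setT f -> measurable_fun setT (fun x => cexp (f x)).
Proof.
move=> mf; have mRe := measurable_fun_Re mf; have mIm := measurable_fun_Im mf.
have me : measurable_fun setT (fun x => expR (Re (f x))).
  exact: (measurableT_comp (@measurable_expR R)).
apply: measurable_toC.
- rewrite (_ : _ \o _ = fun x => expR (Re (f x)) * cos (Im (f x))).
    apply: measurable_funM => //.
    exact: (measurableT_comp (continuous_measurable_fun (@continuous_cos R))).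
  by apply/funext => x.
- rewrite (_ : _ \o _ = fun x => expR (Re (f x)) * sin (Im (f x))).
    apply: measurable_funM => //.
    exact: (measurableT_comp (continuous_measurable_fun (@continuous_sin R))).
  by apply/funext => x.
Qed.

Lemma measurable_funC_sum (I : Type) (s : seq I) (F : I -> T -> R[i]) :
  (forall i, measurable_fun setT (F i)) ->
  measurable_fun setT (fun x => \sum_(i <- s) F i x).
Proof.
move=> mF; elim: s => [|i s IH].
  by under eq_fun do rewrite big_nil; exact: measurable_cst.
by under eq_fun do rewrite big_cons; exact: measurable_funC_add.
Qed.

End complex_measurability.

Section complex_integral.
Context {d} {T : measurableType d} {R : realType}.
Variable mu : {measure set T -> \bar R}.
Implicit Types (f g : T -> R[i]) (h : T -> R).

Definition integrableC f := measurable_fun setT f /\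
  mu.-integrable setT (fun x => (normc (f x))%:E).

Lemma integrable_le_real h1 h2 : measurable_fun setT h1 ->
  (forall x, `|h1 x| <= h2 x) ->
  mu.-integrable setT (EFin \o h2) -> mu.-integrable setT (EFin \o h1).
Proof.
move=> m1 h12; apply: le_integrable => //; first exact/measurable_EFinP.
by move=> x _ /=; rewrite lee_fin (le_trans (h12 x))// ler_norm.
Qed.

Lemma integrable_scale_real k h : mu.-integrable setT (EFin \o h) ->
  mu.-integrable setT (EFin \o (fun x => k * h x)).
Proof. by move=> ih; exact: (integrableZl measurableT k ih). Qed.

Lemma integrableC_le f h : measurable_fun setT f ->
  (forall x, normc (f x) <= h x) ->
  mu.-integrable setT (EFin \o h) -> integrableC f.
Proof.
move=> mf fh ih; split => //; apply: (integrable_le_real (h2 := h)) => //.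
  exact: measurable_fun_normc.
by move=> x; rewrite ger0_norm// normc_ge0.
Qed.

Lemma integrableC_Re f : integrableC f ->
  mu.-integrable setT (EFin \o (fun x => Re (f x))).
Proof.
move=> [mf]; apply: integrable_le_real; first exact: measurable_fun_Re.
by move=> x; exact: normc_Re.
Qed.

Lemma integrableC_Im f : integrableC f ->
  mu.-integrable setT (EFin \o (fun x => Im (f x))).
Proof.
move=> [mf]; apply: integrable_le_real; first exact: measurable_fun_Im.
by move=> x; exact: normc_Im.
Qed.

Lemma integrableCD f g : integrableC f -> integrableC g ->
  integrableC (fun x => f x + g x).
Proof.
move=> [mf nf] [mg ng].
apply: (integrableC_le (h := fun x => normc (f x) + normc (g x))).
- exact: measurable_funC_add.
- by move=> x; exact: normcD.
- exact: (integrableD measurableT nf ng).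
Qed.

Lemma integrableCZ c f : integrableC f -> integrableC (fun x => c * f x).
Proof.
move=> [mf nf]; apply: (integrableC_le (h := fun x => normc c * normc (f x))).
- by apply: measurable_funC_mul => //; exact: measurable_cst.
- by move=> x; rewrite Normc.normcM.
- exact: integrable_scale_real.
Qed.

Lemma integrableC_sum (I : Type) (s : seq I) (F : I -> T -> R[i]) :
  (forall i, integrableC (F i)) -> integrableC (fun x => \sum_(i <- s) F i x).
Proof.
move=> iF; elim: s => [|i s IH].
  under eq_fun do rewrite big_nil.
  apply: (integrableC_le (h := cst 0)); first exact: measurable_funC_cst.
    by move=> x; rewrite Normc.normc0.
  exact: integrable0.
by under eq_fun do rewrite big_cons; exact: integrableCD.
Qed.

Lemma Re_integralC f : Re (integralC mu setT f) = \int[mu]_x Re (f x).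
Proof. by []. Qed.

Lemma Im_integralC f : Im (integralC mu setT f) = \int[mu]_x Im (f x).
Proof. by []. Qed.

Lemma eq_integralC f g : f =1 g -> integralC mu setT f = integralC mu setT g.
Proof. by move=> /funext ->. Qed.

Lemma integralCD f g : integrableC f -> integrableC g ->
  integralC mu setT (fun x => f x + g x) =
  integralC mu setT f + integralC mu setT g.
Proof.
move=> fi gi; apply: complexP; rewrite ?Re_add ?Im_add !(Re_integralC, Im_integralC).
- rewrite -RintegralD//; [|exact: integrableC_Re..].
  by apply: eq_Rintegral => x _; rewrite Re_add.
- rewrite -RintegralD//; [|exact: integrableC_Im..].
  by apply: eq_Rintegral => x _; rewrite Im_add.
Qed.

Lemma integralCZ c f : integrableC f ->
  integralC mu setT (fun x => c * f x) = c * integralC mu setT f.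
Proof.
move=> fi; have Rf := integrableC_Re fi; have If := integrableC_Im fi.
apply: complexP; rewrite ?Re_mul ?Im_mul !(Re_integralC, Im_integralC).
- rewrite -!RintegralZl// -RintegralB//; [|exact: integrable_scale_real..].
  by apply: eq_Rintegral => x _; rewrite Re_mul.
- rewrite -!RintegralZl// -RintegralD//; [|exact: integrable_scale_real..].
  by apply: eq_Rintegral => x _; rewrite Im_mul.
Qed.

Lemma integralC0 : integralC mu setT (fun _ => 0) = 0.
Proof.
by apply: complexP; rewrite ?Re_integralC ?Im_integralC /Rintegral integral0.
Qed.

Lemma integralC_sum (I : Type) (s : seq I) (F : I -> T -> R[i]) :
  (forall i, integrableC (F i)) ->
  integralC mu setT (fun x => \sum_(i <- s) F i x) =
  \sum_(i <- s) integralC mu setT (F i).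
Proof.
move=> iF; elim: s => [|i s IH].
  by under eq_fun do rewrite big_nil; rewrite integralC0 big_nil.
under eq_fun do rewrite big_cons.
by rewrite integralCD ?IH ?big_cons//; exact: integrableC_sum.
Qed.

Lemma normc_integralC f h : measurable_fun setT f ->
  (forall x, normc (f x) <= h x) -> mu.-integrable setT (EFin \o h) ->
  normc (integralC mu setT f) <= \int[mu]_x h x.
Proof.
move=> mf fh ih; have fi := integrableC_le mf fh ih.
apply: normc_le_Re => c c1; rewrite -integralCZ// Re_integralC.
apply: le_Rintegral => //; first exact/integrableC_Re/integrableCZ.
move=> x _; rewrite (le_trans (ler_norm _))// (le_trans (normc_Re _))//.
by rewrite Normc.normcM (le_trans _ (fh x))// ler_piMl// normc_ge0.
Qed.

End complex_integral.

Section linear_phase.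
Context {d} {T : measurableType d} {R : realType}.
Variable mu : {measure set T -> \bar R}.
Variables (h X : T -> R[i]) (r : R).
Hypothesis mh : measurable_fun setT h.
Hypothesis mX : measurable_fun setT X.
Hypothesis r0 : 0 < r.
Hypothesis ih :
  mu.-integrable setT (EFin \o (fun u => normc (h u) * expR (r * normc (X u)))).

Let moment k := integralC mu setT (fun u => h u * X u ^+ k).
Let bound := \int[mu]_u (normc (h u) * expR (r * normc (X u))).

Lemma integrableC_phase (x : R[i]) : normc x <= r ->
  integrableC mu (fun u => h u * cexp (x * X u)).
Proof.
move=> xr; apply: integrableC_le ih.
  apply: measurable_funC_mul => //; apply: measurable_funC_cexp.
  by apply: measurable_funC_mul => //; exact: measurable_cst.
move=> u; rewrite Normc.normcM normc_cexp ler_wpM2l ?normc_ge0// ler_expR.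
rewrite (le_trans (ler_norm _))// (le_trans (normc_Re _))// Normc.normcM.
by rewrite ler_wpM2r// normc_ge0.
Qed.

Lemma integrableC_moment k : integrableC mu (fun u => h u * X u ^+ k).
Proof.
apply: (integrableC_le (h := fun u =>
    (k`!%:R / r ^+ k) * (normc (h u) * expR (r * normc (X u))))).
- by apply: measurable_funC_mul => //; exact: measurable_funC_exp.
- move=> u; rewrite Normc.normcM normcX mulrCA ler_wpM2l ?normc_ge0//.
  rewrite mulrAC ler_pdivlMr ?exprn_gt0// mulrC -exprMn.
  rewrite [_%:R * _]mulrC -ler_pdivrMr ?ltr0n ?fact_gt0//.
  have y0 : 0 <= r * normc (X u) by rewrite mulr_ge0 ?normc_ge0// ltW.
  case: k => [|k]; first by rewrite expr0 fact0 divr1 -expR0 ler_expR.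
  by rewrite (le_trans _ (expR_ge1Dxn k y0))// lerDr ler01.
- exact: integrable_scale_real.
Qed.

(** Integration of the exponential series, with its remainder. *)
Lemma phase_expansion (x : R[i]) N : normc x <= r ->
  normc (integralC mu setT (fun u => h u * cexp (x * X u)) -
    \sum_(k < N) x ^+ k * (k`!%:R)^-1%:C * moment k) <=
  (normc x / r) ^+ N * bound.
Proof.
move=> xr.
have -> : \sum_(k < N) x ^+ k * (k`!%:R)^-1%:C * moment k =
    integralC mu setT (fun u =>
      \sum_(k < N) x ^+ k * (k`!%:R)^-1%:C * (h u * X u ^+ k)).
  rewrite integralC_sum.
    by apply: eq_bigr => k _; rewrite integralCZ//; exact: integrableC_moment.
  by move=> k; apply/integrableCZ/integrableC_moment.
rewrite -mulN1r -integralCZ; last first.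
  by apply: integrableC_sum => k; apply/integrableCZ/integrableC_moment.
rewrite -integralCD; last 2 first.
- exact: integrableC_phase.
- by apply/integrableCZ/integrableC_sum => k; apply/integrableCZ/integrableC_moment.
rewrite -RintegralZl//; apply: normc_integralC.
- apply: measurable_funC_add; first by have [] := integrableC_phase xr.
  apply: measurable_funC_mul; first exact: measurable_cst.
  apply: measurable_funC_sum => k; apply: measurable_funC_mul.
    exact: measurable_cst.
  by have [] := integrableC_moment k.
- move=> u; have := @cexp_remainder R (x * X u) (r * normc (X u)) (normc x / r) N.
  rewrite divr_ge0 ?normc_ge0 ?(ltW r0)//= ler_pdivrMr// mul1r xr => /(_ isT).
  rewrite Normc.normcM mulrA divfK ?gt_eqF// mulr_ge0 ?normc_ge0 ?(ltW r0)//.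
  move=> /(_ erefl isT) H.
  rewrite mulN1r (_ : _ - _ = h u * (cexp (x * X u) -
      \sum_(k < N) (x * X u) ^+ k * (k`!%:R)^-1%:C)).
    by rewrite Normc.normcM mulrCA ler_wpM2l// normc_ge0.
  rewrite mulrBr mulr_sumr; congr (_ - _); apply: eq_bigr => k _.
  by rewrite exprMn; ring.
- exact: integrable_scale_real.
Qed.

Let normc_small_eq0 (z : R[i]) (C : R) :
  (forall e, 0 < e -> exists2 y, 0 < y < e & normc z <= C * y) -> z = 0.
Proof.
move=> H; apply: normc_eq0; apply/eqP; rewrite eq_le normc_ge0 andbT.
apply/ler_addgt0Pr => e e0; rewrite add0r.
have [y /andP[y0 ye] /le_trans] := H (e / (`|C| + 1)) (divr_gt0 e0 (ltr_wpDl (normr_ge0 _) ltr01)).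
apply; rewrite (le_trans (ler_wpM2r (ltW y0) (ler_norm C)))//.
rewrite (le_trans (ler_wpM2l (normr_ge0 C) (ltW ye)))// mulrA ler_pdivrMr ?ltr_wpDl//.
by rewrite mulrC ler_wpM2l ?(ltW e0)// lerDl.
Qed.

(** If the zeros accumulate at the origin, the first non-vanishing moment would
    dominate the integral near the origin. *)
Lemma moments_eq0 :
  (forall e : R, 0 < e -> exists2 x : R[i], 0 < normc x < e &
    integralC mu setT (fun u => h u * cexp (x * X u)) = 0) ->
  forall k, integralC mu setT (fun u => h u * X u ^+ k) = 0.
Proof.
move=> H k; rewrite -/(moment k); elim/ltn_ind: k => N IH.
apply: (@normc_small_eq0 _ (N`!%:R / r ^+ N.+1 * bound)) => e e0.
(* A zero [x] of modulus at most [y] bounds the moment of order [N] by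
   [O(|x|)]: the lower moments vanish, and the remainder has order [N + 1]. *)
have er0 : 0 < Num.min e r by rewrite lt_min e0 r0.
have [x] := H _ er0; rewrite lt_min => /andP[x0 /andP[xe xr]] Hx.
exists (normc x); first by rewrite x0 xe.
have := phase_expansion N.+1 (ltW xr); rewrite Hx sub0r normcN.
rewrite big_ord_recr/= big1 ?add0r; last by move=> i _; rewrite IH ?mulr0.
rewrite !Normc.normcM normcX normcR ger0_norm ?invr_ge0 ?ler0n//.
rewrite expr_div_n exprSr -!mulrA ler_pM2l ?exprn_gt0// => Hm.
have N0 : 0 < N`!%:R :> R by rewrite ltr0n fact_gt0.
rewrite -(@ler_pM2l _ (N`!%:R^-1)) ?invr_gt0// (le_trans Hm)//.
by rewrite mulKf ?gt_eqF// le_eqVlt; apply/orP; left; apply/eqP; ring.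
Qed.

Lemma phase_eq0_moments :
  (forall k, integralC mu setT (fun u => h u * X u ^+ k) = 0) ->
  forall x : R[i], normc x < r ->
  integralC mu setT (fun u => h u * cexp (x * X u)) = 0.
Proof.
move=> H x xr; apply: normc_eq0; apply/eqP; rewrite eq_le normc_ge0 andbT.
have q1 : `|normc x / r| < 1.
  by rewrite ger0_norm ?divr_ge0 ?normc_ge0 ?(ltW r0)// ltr_pdivrMr// mul1r.
have cv : (normc x / r) ^+ N * bound @[N --> \oo] --> (0 : R).
  by rewrite -[X in _ --> X](mul0r bound); apply: cvgMl; exact: cvg_expr.
apply: (ler_cvg_to (cvg_cst (normc (integralC mu setT
  (fun u => h u * cexp (x * X u))))) cv); apply: nearW => N /=.
have := phase_expansion N (ltW xr).
by rewrite big1 ?subr0// => k _; rewrite /moment H mulr0.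
Qed.

(** The integral is a power series in [x], so it has isolated zeros unless it
    vanishes identically. *)
Lemma phase_identity :
  (forall e : R, 0 < e -> exists2 x : R[i], 0 < normc x < e &
    integralC mu setT (fun u => h u * cexp (x * X u)) = 0) ->
  forall x : R[i], normc x < r ->
  integralC mu setT (fun u => h u * cexp (x * X u)) = 0.
Proof. by move=> /moments_eq0; exact: phase_eq0_moments. Qed.

End linear_phase.

(** * Dilations of Lebesgue measure *)

Section affine_row.
Context {R : realType}.

Definition affine_row m (z : 'rV[R[i]]_m) (c : R) (w : 'rV[R[i]]_m) :
  'rV[R[i]]_m := (z + c%:C *: w)%R.

Lemma affine_rowE m (z : 'rV[R[i]]_m) c w j :
  affine_row z c w 0 j = z 0 j + c%:C * w 0 j.
Proof. by rewrite !mxE. Qed.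

Lemma measurable_affine_row m z c : measurable_fun setT (@affine_row m z c).
Proof.
apply: measurable_to_row => j.
under eq_fun do rewrite !mxE.
apply: measurable_funC_add; first exact: measurable_cst.
by apply: measurable_funC_mul; [exact: measurable_cst|exact: measurable_entry].
Qed.

Lemma affine_row_cons m (z : 'rV[R[i]]_m.+1) (c : R) (x : R[i])
    (w : 'rV[R[i]]_m) :
  affine_row z c (row_cons (x, w)) = row_cons ((z 0 ord0 + c%:C * x)%R,
    affine_row (\row_j z 0 (lift ord0 j))%R c w).
Proof.
apply/rowP => j; have [j' ->|->] := unliftP ord0 j.
  by rewrite affine_rowE !row_consES affine_rowE mxE.
by rewrite affine_rowE !row_consE0.
Qed.

End affine_row.

Section change_of_variables.
Context {R : realType}.
Local Open Scope ereal_scope.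

(** The change of variables [phi] has constant Jacobian [k]. *)
Definition scales_measure d (T : measurableType d) (mu : set T -> \bar R)
    (phi : T -> T) (k : R) : Prop :=
  measurable_fun setT phi /\
  forall F : T -> \bar R, measurable_fun setT F -> (forall x, 0 <= F x) ->
    \int[mu]_x F x = k%:E * \int[mu]_x F (phi x).

Definition affine_real (a c : R) (x : measurableTypeR R) : measurableTypeR R :=
  (a + c * x)%R.

Lemma measurable_affine_real a c : measurable_fun setT (affine_real a c).
Proof.
by apply: measurable_funD; [exact: measurable_cst|
  apply: measurable_funM; [exact: measurable_cst|exact: measurable_id]].
Qed.

HB.instance Definition _ a c :=
  isMeasurableFun.Build _ _ _ _ (affine_real a c) (measurable_affine_real a c).

Lemma lebesgue_measure_affine (a c : R) : (c != 0)%R ->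
  scales_measure (@lebesgue_measure R) (affine_real a c) `|c|%R.
Proof.
move=> c0; split; first exact: measurable_affine_real.
move=> F mF F0.
have ck : (0 <= `|c|)%R by [].
have mphi := measurable_affine_real a c.
have @pf : {measure set (measurableTypeR R) -> \bar R}.
  by refine (pushforward (@lebesgue_measure R) (affine_real a c)).
pose m := mscale (NngNum ck) pf.
transitivity (\int[m]_x F x).
  apply: eq_measure_integral => A mA _; apply: lebesgue_measure_unique => //.
  move=> _ [[x y] _ <-]; rewrite /m/= /mscale/= /pushforward.
  have [cp|cn|c00] := ltgtP 0%R c; last by rewrite c00 eqxx in c0.
  - have -> : affine_real a c @^-1` `]x, y]%classic =
        `]((x - a) / c)%R, ((y - a) / c)%R]%classic.
      apply/seteqP; split => u /=; rewrite !in_itv/= /affine_real;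
      by rewrite ltr_pdivrMr// ler_pdivlMr// mulrC ltrBlDl lerBrDl.
    rewrite !lebesgue_measure_itv/= !lte_fin ltr_pM2r ?invr_gt0// ltrD2r.
    case: ifPn => _; last by rewrite mule0.
    rewrite -!EFinB -EFinM gtr0_norm//; congr (_%:E).
    by field; rewrite gt_eqF.
  - have -> : affine_real a c @^-1` `]x, y]%classic =
        `[((y - a) / c)%R, ((x - a) / c)%R[%classic.
      apply/seteqP; split => u /=; rewrite !in_itv/= /affine_real;
      by rewrite ltr_ndivlMr// ler_ndivrMr// mulrC ltrBlDl lerBrDl andbC.
    rewrite !lebesgue_measure_itv/= !lte_fin ltr_nM2r ?invr_lt0// ltrD2r.
    case: ifPn => _; last by rewrite mule0.
    rewrite -!EFinB -EFinM ltr0_norm//; congr (_%:E).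
    by field; rewrite lt_eqF.
rewrite ge0_integral_mscale//; congr (_ * _).
by rewrite ge0_integral_pushforward//; exact: measurable_affine_real.
Qed.

Lemma scales_measure_product d1 d2 (T1 : measurableType d1)
    (T2 : measurableType d2) (m1 : {sigma_finite_measure set T1 -> \bar R})
    (m2 : {sigma_finite_measure set T2 -> \bar R}) phi1 phi2 (k1 k2 : R) :
  (0 <= k2)%R ->
  scales_measure m1 phi1 k1 -> scales_measure m2 phi2 k2 ->
  scales_measure (m1 \x m2) (fun x => (phi1 x.1, phi2 x.2)) (k1 * k2)%R.
Proof.
move=> k20 [mp1 H1] [mp2 H2].
have mp : measurable_fun setT (fun x : T1 * T2 => (phi1 x.1, phi2 x.2)).
  apply/measurable_fun_pairP; split.
    exact: (measurableT_comp mp1 measurable_fst).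
  exact: (measurableT_comp mp2 measurable_snd).
split=> // F mF F0.
have mFp : measurable_fun setT (fun x => F (phi1 x.1, phi2 x.2)).
  exact: measurableT_comp mp.
rewrite fubini_tonelli1// [in RHS]fubini_tonelli1//.
have mG : measurable_fun setT (fubini_F m2 F).
  exact: measurable_fun_fubini_tonelli_F.
have mG' : measurable_fun setT (fubini_F m2 (fun x => F (x.1, phi2 x.2))).
  apply: measurable_fun_fubini_tonelli_F => //.
  apply: measurableT_comp => //; apply/measurable_fun_pairP; split => //.
    exact: measurable_fst.
  exact: (measurableT_comp mp2 measurable_snd).
rewrite H1//; last by move=> x; exact: integral_ge0.
rewrite EFinM -muleA; congr (_ * _).
rewrite -ge0_integralZl//; last 2 first.
  exact: measurable_fun_fubini_tonelli_F.
  by move=> x _; exact: integral_ge0.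
apply: eq_integral => x _; rewrite /fubini_F/= H2//.
exact: measurableT_comp.
Qed.

Lemma scales_measure_pushforward d1 d2 (T1 : measurableType d1)
    (T2 : measurableType d2) (m1 : {measure set T1 -> \bar R})
    (psi : T1 -> T2) phi1 phi2 (k : R) :
  measurable_fun setT psi -> measurable_fun setT phi2 ->
  (forall x, phi2 (psi x) = psi (phi1 x)) ->
  scales_measure m1 phi1 k -> scales_measure (pushforward m1 psi) phi2 k.
Proof.
move=> mpsi mphi2 comm [mp1 H1]; split => // F mF F0.
rewrite ge0_integral_pushforward//.
rewrite [in RHS](@ge0_integral_pushforward _ _ _ _ _ psi mpsi m1 setT (F \o phi2))//; last 2 first.
- exact: (measurableT_comp mF mphi2).
- by move=> y _; exact: F0.
have mFpsi := measurableT_comp mF mpsi.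
rewrite !preimage_setT (H1 (F \o psi))//; last by move=> x; exact: F0.
by congr (_ * _); apply: eq_integral => x _ /=; rewrite comm.
Qed.

Lemma lebesgue_complex_affine (a : R[i]) (c : R) : (c != 0)%R ->
  scales_measure (@lebesgue_complex R) (fun w => (a + c%:C * w)%R)
    (`|c| * `|c|)%R.
Proof.
move=> c0.
have H := scales_measure_product (normr_ge0 c)
  (lebesgue_measure_affine (Re a) c0) (lebesgue_measure_affine (Im a) c0).
apply: (scales_measure_pushforward _ _ _ H).
- exact: measurable_complex_of_RxR.
- apply: measurable_funC_add; first exact: measurable_cst.
  by apply: measurable_funC_mul; [exact: measurable_cst|exact: measurable_id].
- by move=> [x y]; apply: complexP; rewrite ?Re_add ?Im_add ?Re_scale ?Im_scale.
Qed.

Lemma lebesgueC_affine m (z : 'rV[R[i]]_m) (c : R) : (c != 0)%R ->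
  scales_measure (lebesgueC R m) (affine_row z c) (`|c| ^+ (2 * m))%R.
Proof.
move=> c0; elim: m z => [|m IH] z.
  split; first exact: measurable_affine_row.
  move=> F mF F0; rewrite muln0 expr0 mul1e; apply: eq_integral => w _.
  by congr F; apply/rowP => -[].
have H := scales_measure_product (exprn_ge0 (2 * m) (normr_ge0 c))
  (lebesgue_complex_affine (z 0%R ord0) c0)
  (IH (\row_j z 0%R (lift ord0 j))%R).
rewrite mulnS exprD expr2.
apply: (scales_measure_pushforward _ _ _ H).
- exact: measurable_row_cons.
- exact: measurable_affine_row.
- by move=> [x w]; exact: affine_row_cons.
Qed.

End change_of_variables.

(** * Gaussian integrals *)

Section gaussian_integrals.
Context {R : realType}.
Local Open Scope ereal_scope.

Lemma integral_expR_scale d (T : measurableType d)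
    (mu : {measure set T -> \bar R}) (k : R) (f : T -> R) : (0 <= k)%R ->
  measurable_fun setT (fun x => (expR (f x))%:E) ->
  \int[mu]_x (k%:E * (expR (f x))%:E) = k%:E * \int[mu]_x (expR (f x))%:E.
Proof.
by move=> k0 mf; rewrite ge0_integralZl_EFin.
Qed.

Lemma measurable_gauss (c : R) :
  measurable_fun setT (fun x : measurableTypeR R => (expR (- (c * x ^+ 2)))%:E).
Proof.
apply/measurable_EFinP; apply: measurableT_comp => //.
apply: measurableT_comp => //; apply: measurable_funM => //.
Qed.

Lemma gauss_real (c : R) : (0 < c)%R ->
  \int[@lebesgue_measure R]_x (expR (- (c * x ^+ 2)))%:E =
  (Num.sqrt (pi / c))%:E.
Proof.
move=> c0; have s0 : (0 < Num.sqrt c)%R by rewrite sqrtr_gt0.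
have [_ /(_ (fun x => (gauss_fun x)%:E))] :=
  lebesgue_measure_affine 0%R (lt0r_neq0 s0).
have mg : measurable_fun [set: measurableTypeR R] (fun x => (gauss_fun x)%:E).
  by apply/measurable_EFinP; exact: measurable_gauss_fun.
move=> /(_ mg (fun x => gauss_fun_ge0 x)).
rewrite integralT_gauss gtr0_norm//.
under eq_integral do rewrite /affine_real add0r /gauss_fun exprMn sqr_sqrtr ?ltW//.
move=> e.
have -> : (Num.sqrt (pi / c))%:E = (Num.sqrt c)^-1%:E * (Num.sqrt pi)%:E.
  by rewrite -EFinM sqrtrM ?pi_ge0// sqrtrV ?ltW// mulrC.
by rewrite e muleA -EFinM mulVf ?mul1e// gt_eqF.
Qed.

Lemma measurable_gauss_complex (c : R) :
  measurable_fun setT (fun x : R[i] => (expR (- (c * normc x ^+ 2)))%:E).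
Proof.
apply/measurable_EFinP; apply: measurableT_comp => //.
apply: measurableT_comp => //; apply: measurable_funM => //.
by apply: measurable_funX; exact: measurable_normc.
Qed.

Lemma gauss_complex (c : R) : (0 < c)%R ->
  \int[@lebesgue_complex R]_x (expR (- (c * normc x ^+ 2)))%:E = (pi / c)%:E.
Proof.
move=> c0; have mg := measurable_gauss_complex c.
have mgc := measurableT_comp mg (@measurable_complex_of_RxR R).
rewrite (ge0_integral_pushforward (@measurable_complex_of_RxR R))//=.
rewrite preimage_setT fubini_tonelli1//=.
rewrite /fubini_F/=.
have E x y : (expR (- (c * normc (complex_of_RxR (x, y)) ^+ 2)))%:E =
    (expR (- (c * x ^+ 2)))%:E * (expR (- (c * y ^+ 2)))%:E.
  by rewrite -EFinM -expRD normc_sqr/= mulrDr opprD.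
under eq_integral => x _.
  under eq_integral do rewrite E.
  rewrite integral_expR_scale ?expR_ge0//; last exact: measurable_gauss.
  rewrite gauss_real// muleC.
  over.
rewrite integral_expR_scale ?sqrtr_ge0//; last exact: measurable_gauss.
by rewrite gauss_real// -EFinM -expr2 sqr_sqrtr// divr_ge0 ?pi_ge0// ltW.
Qed.

Lemma measurable_gauss_row m (c : 'I_m -> R) :
  measurable_fun setT (fun u : 'rV[R[i]]_m =>
    (expR (- \sum_j c j * normc (u 0%R j) ^+ 2))%:E).
Proof.
apply/measurable_EFinP; apply: measurableT_comp => //.
apply: measurableT_comp => //; apply: measurable_sum => j.
apply: measurable_funM => //; apply: measurable_funX.
exact: measurableT_comp (@measurable_normc R) (measurable_entry j).
Qed.

Lemma gauss_row m (c : 'I_m -> R) : (forall j, 0 < c j)%R ->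
  \int[lebesgueC R m]_u (expR (- \sum_j c j * normc (u 0%R j) ^+ 2))%:E =
  (\prod_j (pi / c j))%:E.
Proof.
elim: m c => [|m IH] c c0.
  rewrite big_ord0 (eq_integral (cst 1%E)); last first.
    by move=> u _; rewrite big_ord0 oppr0 expR0.
  rewrite integral_cst//= mul1e diracE.
  by rewrite in_setT.
have mg := measurable_gauss_row c.
have mgc := measurableT_comp mg (@measurable_row_cons R m).
rewrite (ge0_integral_pushforward (@measurable_row_cons R m))//=.
rewrite preimage_setT fubini_tonelli1//=.
rewrite /fubini_F/=.
have E x y : (expR (- \sum_j c j * normc (row_cons (x, y) 0%R j) ^+ 2))%:E =
    (expR (- (c ord0 * normc x ^+ 2)))%:E *
    (expR (- \sum_j c (lift ord0 j) * normc (y 0%R j) ^+ 2))%:E.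
  rewrite -EFinM -expRD -opprD big_ord_recl row_consE0.
  by under eq_bigr do rewrite row_consES.
under eq_integral => x _.
  under eq_integral do rewrite E.
  rewrite integral_expR_scale ?expR_ge0//; last exact: measurable_gauss_row.
  rewrite IH// muleC.
  over.
rewrite integral_expR_scale; last 2 first.
- by apply: prodr_ge0 => j _; rewrite divr_ge0 ?pi_ge0// ltW.
- exact: measurable_gauss_complex.
by rewrite gauss_complex// -EFinM big_ord_recl mulrC.
Qed.

End gaussian_integrals.

(** * Polar coordinates *)

Section polar_coordinates.
Context {R : realType}.

Lemma integral_power_tail (p : nat) (s : R) : (0 < p)%N -> 0 < s ->
  (\int[@lebesgue_measure R]_(x in `[s, +oo[) (p%:R / x ^+ p.+1)%:E =
   ((s ^+ p)^-1)%:E)%E.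
Proof.
move=> p0 s0.
have dF (x : R) : s <= x -> is_derive x 1 (fun x : R => - (x ^+ p)^-1)
    (p%:R / x ^+ p.+1).
  move=> sx; have x0 : x != 0 by rewrite gt_eqF// (lt_le_trans s0).
  have h := @is_deriveX _ _ (@id R) p x 1 1 (is_derive_id x 1).
  have hx : (@id R ^+ p) x != 0 by rewrite exprfctE expf_neq0.
  have h1 := @is_deriveV _ (@id R ^+ p) x _ 1 hx h.
  have h2 := is_deriveN h1.
  rewrite (_ : (fun x : R => _) = - (fun y => ((@id R ^+ p) y)^-1)); last first.
    by apply/funext => y; rewrite !fctE.
  apply: (is_derive_eq h2).
  rewrite !exprfctE /GRing.scale/= mulr1 mulNr opprK.
  case: p p0 x0 {h h1 h2 hx} => // p _ x0 /=.
  rewrite !exprS; field.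
  by rewrite x0 expf_neq0.
rewrite (@ge0_continuous_FTC2y _ _ (fun x => - (x ^+ p)^-1) s 0).
- by rewrite -EFinB sub0r opprK.
- by move=> x sx; rewrite divr_ge0// exprn_ge0// (le_trans (ltW s0)).
- apply: continuous_in_subspaceT => x; rewrite inE/= in_itv/= andbT => sx.
  apply: cvgMr; apply: cvgV; last exact: exprn_continuous.
  by rewrite expf_neq0// gt_eqF// (lt_le_trans s0).
- apply/cvgrPdist_le => e e0; near=> x.
  have x1 : 1 <= x by near: x; apply: nbhs_pinfty_ge; rewrite num_real.
  have xe : e^-1 <= x by near: x; apply: nbhs_pinfty_ge; rewrite num_real.
  have xp : x <= x ^+ p by rewrite ler_eXnr.
  rewrite sub0r opprK ger0_norm ?invr_ge0 ?exprn_ge0 ?(le_trans ler01)//.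
  by rewrite -[leRHS]invrK lef_pV2 ?(le_trans xe)// posrE ?invr_gt0//
    exprn_gt0// (lt_le_trans ltr01).
- by move=> x sx; case: (dF x (ltW sx)).
- apply: cvg_at_right_filter.
  have [+ _] := dF s (lexx _).
  by move/derivable1_diffP/differentiable_continuous.
- move=> x; rewrite in_itv/= andbT => sx; rewrite derive1E.
  by have [_ ->] := dF x (ltW sx).
Unshelve. all: by end_near. Qed.

End polar_coordinates.

Section cnorm_theory.
Context {R : realType}.
Variable m : nat.
Implicit Types (z w : 'rV[R[i]]_m).

Lemma cnorm_ge0 w : 0 <= cnorm w. Proof. exact: sqrtr_ge0. Qed.

Lemma cnorm_sqr w : cnorm w ^+ 2 = \sum_j normc (w 0 j) ^+ 2.
Proof. by rewrite sqr_sqrtr// sumr_ge0// => j _; rewrite sqr_ge0. Qed.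

Lemma cnorm0 : cnorm (0 : 'rV[R[i]]_m) = 0.
Proof.
rewrite /cnorm big1 ?sqrtr0// => j _.
by rewrite mxE Normc.normc0 expr0n.
Qed.

Lemma normc_entry w j : normc (w 0 j) <= cnorm w.
Proof.
rewrite -(@ler_pXn2r _ 2)// ?nnegrE ?normc_ge0 ?cnorm_ge0// cnorm_sqr.
by rewrite (bigD1 j)//= lerDl sumr_ge0// => i _; rewrite sqr_ge0.
Qed.

Lemma cnorm_eq0 w : cnorm w = 0 -> w = 0.
Proof.
move=> w0; apply/rowP => j; rewrite mxE; apply: normc_eq0.
by apply/eqP; rewrite eq_le normc_ge0 -[X in _ <= X]w0 normc_entry.
Qed.

Lemma cnormZ (c : R[i]) w : cnorm (c *: w) = normc c * cnorm w.
Proof.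
rewrite /cnorm -[X in X * _]ger0_norm ?normc_ge0// -sqrtr_sqr -sqrtrM ?sqr_ge0//.
congr (Num.sqrt _); rewrite mulr_sumr; apply: eq_bigr => j _.
by rewrite mxE Normc.normcM exprMn.
Qed.

Lemma cnormZr (c : R) w : cnorm (c%:C *: w) = `|c| * cnorm w.
Proof. by rewrite cnormZ normcR. Qed.

(** The indicator of the unit ball is at most [e] times a Gaussian. *)
Lemma lebesgueC_cball1_lty : (lebesgueC R m (@cball1 R m) < +oo)%E.
Proof.
have mB := @measurable_cball1 R m.
have mg := @measurable_gauss_row R m (fun=> 1).
apply: (@le_lt_trans _ _ (\int[lebesgueC R m]_u ((expR 1)%:E *
    (expR (- \sum_j 1 * normc (u 0 j) ^+ 2))%:E))%E).
  rewrite -[X in (lebesgueC R m X <= _)%E]setIT -integral_indic//.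
  apply: ge0_le_integral => //.
  - exact/measurable_EFinP/measurable_indic.
  - exact: measurable_funeM.
  - move=> w _; rewrite -EFinM lee_fin indicE.
    case: (boolP (w \in _)) => [|_]; last by rewrite mulr_ge0 ?expR_ge0.
    rewrite inE /cball1/= => w1; rewrite -expRD -[leLHS]expR0 ler_expR subr_ge0.
    under eq_bigr do rewrite mul1r.
    by rewrite -cnorm_sqr -(expr1n _ 2) ler_pXn2r ?nnegrE ?cnorm_ge0.
by rewrite integral_expR_scale ?expR_ge0// gauss_row// -EFinM ltry.
Qed.

Lemma measurable_row0 : measurable [set (0 : 'rV[R[i]]_m)].
Proof.
rewrite (_ : [set 0] = (@cnorm R m) @^-1` [set 0]); last first.
  by apply/seteqP; split => w /= => [->|/cnorm_eq0//]; rewrite cnorm0.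
by rewrite -[X in measurable X]setTI; exact: (@measurable_cnorm R m).
Qed.

Hypothesis m0 : (0 < m)%N.

(** Dilation by [2] fixes the origin and multiplies the measure by [2 ^ (2 m)]. *)
Lemma lebesgueC_row0 : lebesgueC R m [set 0] = 0%E.
Proof.
have m1 := measurable_row0.
have f0 : lebesgueC R m [set (0 : 'rV[R[i]]_m)] \is a fin_num.
  rewrite ge0_fin_numE// (le_lt_trans _ lebesgueC_cball1_lty)// le_measure ?inE//.
    exact: measurable_cball1.
  by move=> w /= ->; rewrite /cball1/= cnorm0.
have [_ H] := @lebesgueC_affine R m 0 2 (lt0r_neq0 (ltr0n R 2)).
pose chi := \1_[set (0 : 'rV[R[i]]_m)] : 'rV[R[i]]_m -> R.
have mi : measurable_fun setT (EFin \o chi).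
  exact/measurable_EFinP/measurable_indic.
have i0 x : (0 <= (EFin \o chi) x)%E by rewrite lee_fin.
have i1 : (\int[lebesgueC R m]_w (chi w)%:E)%E = lebesgueC R m [set 0].
  by rewrite integral_indic// setIT.
have := H _ mi i0; rewrite /comp i1.
under eq_integral => w _.
  rewrite (_ : chi (affine_row 0 2 w) = chi w); last first.
    rewrite /chi /affine_row add0r !indicE; congr (_%:R); congr (nat_of_bool _).
    apply/idP/idP; rewrite !inE/=.
      by move/eqP; rewrite scaler_eq0 => /orP[/eqP[/eqP]|/eqP//]; rewrite pnatr_eq0.
    by move=> ->; rewrite scaler0.
  over.
pose x := fine (lebesgueC R m [set 0]).
have xE : lebesgueC R m [set 0] = x%:E by rewrite fineK.
rewrite /= i1 xE -EFinM => -[e]; congr EFin.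
have k1 : 1 < `|2 : R| ^+ (2 * m) by rewrite exprn_egt1// ?muln_eq0 -?lt0n ?m0// ger0_norm// ltr1n.
have /eqP : (`|2| ^+ (2 * m) - 1) * x = 0 by rewrite mulrBl mul1r -e subrr.
by rewrite mulf_eq0 subr_eq0 gt_eqF// => /eqP.
Qed.

End cnorm_theory.

Section polar_integration.
Context {R : realType}.
Variable m : nat.
Hypothesis m0 : (0 < m)%N.
Local Notation V := 'rV[R[i]]_m.
Local Notation leb := (@lebesgue_measure R).
Local Notation lebC := (lebesgueC R m).
Let p := (2 * m)%N.

Let p0 : (0 < p)%N. Proof. by rewrite muln_gt0. Qed.

Definition radial_jacobian (r : R) : R :=
  (2 * m)%:R * r ^+ (2 * m).-1 * \1_`]0, +oo[ r.

Local Notation J := radial_jacobian.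

Lemma radial_jacobian_ge0 r : 0 <= J r.
Proof.
rewrite /J indicE; case: (boolP (r \in _)) => [|_]; last by rewrite mulr0.
by rewrite inE/= in_itv/= andbT => r0; rewrite mulr1 mulr_ge0// exprn_ge0// ltW.
Qed.

Lemma measurable_radial_jacobian : measurable_fun [set: measurableTypeR R] J.
Proof.
apply: measurable_funM; last exact: measurable_indic.
by apply: measurable_funM => //; exact: measurable_funX.
Qed.

Lemma measurable_sphere_proj2 :
  measurable_fun setT (fun x : measurableTypeR R * V => sphere_proj x.1 x.2).
Proof.
apply: measurable_to_row => j; under eq_fun do rewrite mxE.
apply: measurable_funC_mul.
  apply: measurable_funC_real; apply: measurable_funM; first exact: measurable_fst.
  apply: measurableT_comp; first exact: measurable_invr.
  exact: measurableT_comp (@measurable_cnorm R m) measurable_snd.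
exact: measurableT_comp (measurable_entry j) measurable_snd.
Qed.

Let mscal :
  measurable_fun setT (fun x : measurableTypeR R * V => x.1%:C *: x.2).
Proof.
apply: measurable_to_row => j; under eq_fun do rewrite mxE.
apply: measurable_funC_mul.
  by apply: measurable_funC_real; exact: measurable_fst.
exact: measurableT_comp (measurable_entry j) measurable_snd.
Qed.

Let mcn : measurable_fun setT (fun x : measurableTypeR R * V => cnorm x.2).
Proof. exact: measurableT_comp (@measurable_cnorm R m) measurable_snd. Qed.

Let mB := @measurable_cball1 R m.

Let mle : measurable [set x : measurableTypeR R * V | cnorm x.2 <= x.1].
Proof.
by rewrite -[X in measurable X]setTI; apply: measurable_fun_le.
Qed.

Let mJ1 : measurable_fun setT (fun x : measurableTypeR R * V => J x.1).
Proof. exact: measurableT_comp measurable_radial_jacobian measurable_fst. Qed.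

Let mB2 : measurable_fun setT
  (fun x : measurableTypeR R * V => \1_(@cball1 R m) x.2 : R).
Proof.
have mi : measurable_fun setT (\1_(@cball1 R m) : V -> R).
  exact: measurable_indic.
exact: (measurableT_comp mi measurable_snd).
Qed.

Variable F : V -> \bar R.
Hypothesis mF : measurable_fun setT F.
Hypothesis F0 : forall x, (0 <= F x)%E.

(* For [w] in the unit ball and [x = r w], the substitution [r -> |w| r] goes from
   [G1] to [G2], the substitution [w -> w / r] from [G2] to [G3], and the integral
   of [G3] over [r] is elementary. *)
Let G1 (x : measurableTypeR R * V) : \bar R :=
  ((J x.1 * \1_(@cball1 R m) x.2)%:E * F (sphere_proj x.1 x.2))%E.
Let G2 (x : measurableTypeR R * V) : \bar R :=
  ((J x.1 * \1_(@cball1 R m) x.2 * cnorm x.2 ^+ p)%:E * F (x.1%:C *: x.2))%E.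
Let G3 (x : measurableTypeR R * V) : \bar R :=
  ((p%:R / x.1 ^+ p.+1 * \1_[set x | cnorm x.2 <= x.1] x * \1_`]0, +oo[ x.1 *
    cnorm x.2 ^+ p)%:E * F x.2)%E.

Let mG1 : measurable_fun setT G1.
Proof.
apply: emeasurable_funM.
  by apply/measurable_EFinP; exact: measurable_funM.
exact: measurableT_comp mF measurable_sphere_proj2.
Qed.

Let mG2 : measurable_fun setT G2.
Proof.
apply: emeasurable_funM.
  apply/measurable_EFinP; apply: measurable_funM; first exact: measurable_funM.
  exact: measurable_funX.
exact: measurableT_comp mF mscal.
Qed.

Let mG3 : measurable_fun setT G3.
Proof.
apply: emeasurable_funM; last exact: measurableT_comp mF measurable_snd.
apply/measurable_EFinP; apply: measurable_funM; last exact: measurable_funX.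
apply: measurable_funM; last first.
  have mi : measurable_fun setT (\1_`]0, +oo[ : measurableTypeR R -> R).
    exact: measurable_indic.
  exact: (measurableT_comp mi measurable_fst).
apply: measurable_funM; last exact: measurable_indic.
apply: measurable_funM => //.
apply: measurableT_comp; first exact: measurable_invr.
by apply: measurable_funX; exact: measurable_fst.
Qed.

Let J1_ge0 r w : 0 <= J r * \1_(@cball1 R m) w.
Proof. by rewrite mulr_ge0 ?radial_jacobian_ge0. Qed.

Let G1_ge0 x : (0 <= G1 x)%E.
Proof. by rewrite mule_ge0// lee_fin. Qed.

Let G2_ge0 x : (0 <= G2 x)%E.
Proof.
by rewrite mule_ge0// lee_fin mulr_ge0// exprn_ge0// cnorm_ge0.
Qed.

Let G3_ge0 x : (0 <= G3 x)%E.
Proof.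
rewrite mule_ge0// lee_fin mulr_ge0// ?exprn_ge0 ?cnorm_ge0//.
rewrite mulrAC mulr_ge0// indicE; case: (boolP (x.1 \in _)) => [|_]; last by rewrite mulr0.
rewrite inE/= in_itv/= andbT => r0.
by rewrite mulr1 divr_ge0// exprn_ge0// ltW.
Qed.

Let msec1 (G : measurableTypeR R * V -> \bar R) : measurable_fun setT G ->
  forall w, measurable_fun setT (fun r : measurableTypeR R => G (r, w)).
Proof. by move=> mG w; exact: measurableT_comp mG (measurable_pair2 w). Qed.

Let msec2 (G : measurableTypeR R * V -> \bar R) : measurable_fun setT G ->
  forall r, measurable_fun setT (fun w => G (r, w)).
Proof. by move=> mG r; exact: measurableT_comp mG (measurable_pair1 r). Qed.

Let step1 w : w != 0 ->
  (\int[leb]_r G1 (r, w) = \int[leb]_r G2 (r, w))%E.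
Proof.
move=> w0.
have s0 : 0 < cnorm w.
  by rewrite lt_def cnorm_ge0 andbT; apply: contra w0 => /eqP/cnorm_eq0 ->.
have [_ H] := lebesgue_measure_affine 0 (lt0r_neq0 s0).
rewrite (H (fun r => G1 (r, w)))//; last exact: msec1.
rewrite -ge0_integralZl//; last first.
  apply: (measurableT_comp (msec1 mG1 w)).
  exact: measurable_affine_real.
apply: eq_integral => r _; rewrite /G1 /G2/= muleA -EFinM.
have -> : sphere_proj (affine_real 0 (cnorm w) r) w = r%:C *: w.
  by rewrite /sphere_proj /affine_real add0r mulrAC divff ?mul1r// gt_eqF.
congr (_%:E * _)%E.
rewrite gtr0_norm// /J /affine_real add0r -/p.
rewrite (_ : \1_`]0, +oo[ (cnorm w * r) = \1_`]0, +oo[ r :> R); last first.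
  rewrite !indicE; congr (nat_of_bool _)%:R.
  by apply/idP/idP; rewrite !inE/= !in_itv/= !andbT pmulr_rgt0.
have sp : cnorm w ^+ p = cnorm w * cnorm w ^+ p.-1 by rewrite -exprS prednK.
rewrite exprMn sp; ring.
Qed.

Let step2 r : (\int[lebC]_w G2 (r, w) = \int[lebC]_x G3 (r, x))%E.
Proof.
have [r0|r0] := leP r 0.
  have z : \1_`]0, +oo[ r = 0 :> R.
    rewrite indicE; case: (boolP (r \in _)) => //.
    by rewrite inE/= in_itv/= andbT ltNge r0.
  by apply: eq_integral => w _; rewrite /G2 /G3 /J/= z mulr0 !mul0r mulr0 !mul0r !mul0e.
have z : \1_`]0, +oo[ r = 1 :> R.
  by rewrite indicE mem_set//= in_itv/= r0.
have [_ H] := @lebesgueC_affine R m 0 r (lt0r_neq0 r0).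
rewrite [RHS](H (fun w => G3 (r, w)))//; last exact: msec2.
rewrite -ge0_integralZl//; last first.
  by apply: (measurableT_comp (msec2 mG3 r)); exact: measurable_affine_row.
apply: eq_integral => w _; rewrite /G2 /G3/= muleA -EFinM.
have -> : affine_row 0 r w = r%:C *: w by rewrite /affine_row add0r.
congr (_%:E * _)%E.
rewrite /J z gtr0_norm// -/p cnormZr gtr0_norm//.
rewrite (_ : \1_[set x : measurableTypeR R * V | cnorm x.2 <= x.1] (r, r%:C *: w) =
    \1_(@cball1 R m) w :> R); last first.
  rewrite !indicE; congr (nat_of_bool _)%:R.
  apply/idP/idP; rewrite !inE/= /cball1/= cnormZr gtr0_norm//;
  by rewrite -[X in _ * _ <= X]mulr1 ler_pM2l.
have rn : r ^+ p.-1 != 0 by rewrite expf_neq0// gt_eqF.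
have rp : r ^+ p = r * r ^+ p.-1 by rewrite -exprS prednK.
rewrite exprMn exprS rp; field.
by rewrite rn gt_eqF.
Qed.

Let step3 x : x != 0 -> (\int[leb]_r G3 (r, x) = F x)%E.
Proof.
move=> x0.
have s0 : 0 < cnorm x.
  by rewrite lt_def cnorm_ge0 andbT; apply: contra x0 => /eqP/cnorm_eq0 ->.
pose D := `[cnorm x, +oo[%classic : set (measurableTypeR R).
pose k (r : measurableTypeR R) := (p%:R / r ^+ p.+1)%:E.
have mk : measurable_fun setT (k \_ D).
  apply/(measurable_restrictT _ _).1; first exact: measurable_itv.
  apply: measurable_funTS.
  apply/measurable_EFinP; apply: measurable_funM => //.
  apply: measurableT_comp; first exact: measurable_invr.
  exact: measurable_funX.
have k0 r : (0 <= (k \_ D) r)%E.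
  rewrite patchE; case: ifPn => //; rewrite inE /D/= in_itv/= andbT => xr.
  by rewrite lee_fin divr_ge0// exprn_ge0// (le_trans (ltW s0)).
transitivity (\int[leb]_r (((cnorm x ^+ p)%:E * F x) * (k \_ D) r))%E.
  apply: eq_integral => r _; rewrite /G3/= patchE !indicE.
  have -> : (r, x) \in [set x : measurableTypeR R * V | cnorm x.2 <= x.1] =
      (r \in D).
    by apply/idP/idP; rewrite !inE /D/= in_itv/= andbT.
  case: ifPn => [|_]; last by rewrite mulr0 !mul0r mul0e mule0.
  rewrite inE /D/= in_itv/= andbT => xr.
  rewrite mem_set/= ?in_itv/= ?andbT ?(lt_le_trans s0)// !mulr1.
  by rewrite /k mulrC EFinM -!muleA; congr (_ * _)%E; rewrite muleC.
rewrite ge0_integralZl//; last first.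
  by rewrite mule_ge0// lee_fin exprn_ge0// ltW.
rewrite -integral_mkcond integral_power_tail// muleAC -EFinM.
by rewrite divff ?mul1e// expf_neq0// gt_eqF.
Qed.

(** Integration in polar coordinates, written with the projection of the unit
    ball on spheres: both sides unfold to the same integral over pairs (point,
    radius), up to dilations of the point. *)
Lemma polar_integral : (\int[lebC]_x F x = \int[leb]_r \int[lebC]_w
  ((J r * \1_(@cball1 R m) w)%:E * F (sphere_proj r w)))%E.
Proof.
have ae0 (f g : V -> \bar R) : measurable_fun setT f -> measurable_fun setT g ->
    (forall x, 0 <= f x)%E -> (forall x, 0 <= g x)%E ->
    (forall x, x != 0 -> f x = g x) -> (\int[lebC]_x f x = \int[lebC]_x g x)%E.
  move=> mf mg f0 g0 fg; apply: ge0_ae_eq_integral => //.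
  exists [set 0]; split; [exact: measurable_row0|exact: lebesgueC_row0|].
  move=> x /= fgx; apply: contrapT => /eqP x0; apply: fgx => _.
  exact: fg.
transitivity (\int[lebC]_x \int[leb]_r G3 (r, x))%E.
  apply: ae0 => //; first exact: measurable_fun_fubini_tonelli_G.
    by move=> x; exact: integral_ge0.
  by move=> x x0; rewrite step3.
transitivity (\int[leb]_r \int[lebC]_x G3 (r, x))%E.
  exact/esym/fubini_tonelli.
transitivity (\int[leb]_r \int[lebC]_x G2 (r, x))%E.
  by apply: eq_integral => r _; rewrite step2.
transitivity (\int[lebC]_x \int[leb]_r G2 (r, x))%E.
  exact: fubini_tonelli.
transitivity (\int[lebC]_x \int[leb]_r G1 (r, x))%E; last first.
  exact/esym/fubini_tonelli.
apply: ae0 => //.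
- exact: measurable_fun_fubini_tonelli_G.
- exact: measurable_fun_fubini_tonelli_G.
- by move=> x; exact: integral_ge0.
- by move=> x; exact: integral_ge0.
- by move=> x x0; rewrite step1.
Qed.

End polar_integration.

(** * Spherical means against radial Gaussians *)

Section null_modification.
Context {d} {T : measurableType d} {R : realType}.
Variable mu : {measure set T -> \bar R}.
Local Open Scope ereal_scope.

Import HBNNSimple.

Let ge0_null_modification_le (f g : T -> \bar R) (N : set T) :
  measurable N -> mu N = 0 -> (forall x, 0 <= f x) -> (forall x, 0 <= g x) ->
  (forall x, ~ N x -> f x = g x) -> \int[mu]_x f x <= \int[mu]_x g x.
Proof.
move=> mN N0 f0 g0 fg; rewrite !ge0_integralTE//.
apply: ge_ereal_sup => _ [h /= hf <-].
have mNc : measurable (~` N) by exact: measurableC.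
have -> : sintegral mu h = sintegral mu (proj_nnsfun h mNc).
  rewrite -!integralT_nnsfun; apply: ge0_ae_eq_integral => //.
  - exact/measurable_EFinP.
  - exact/measurable_EFinP.
  - by move=> x _; rewrite lee_fin.
  - by move=> x _; rewrite lee_fin.
  - exists N; split => // x /= H; apply: contrapT => Nx; apply: H => _.
    by rewrite /= mindicE mem_set// mulr1.
apply: ereal_sup_ubound; exists (proj_nnsfun h mNc) => //= x.
rewrite mindicE; case: (boolP (x \in _)) => [|_]; last by rewrite mulr0.
by rewrite inE mulr1 => Nx; rewrite -fg.
Qed.

(** For nonnegative functions the integral is a supremum over simple functions,
    which can be cut off outside the null set; neither function has to be
    measurable. *)
Lemma integral_null_modification (f g : T -> \bar R) (N : set T) (D : set T) :
  measurable N -> mu N = 0 -> (forall x, D x -> ~ N x -> f x = g x) ->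
  \int[mu]_(x in D) f x = \int[mu]_(x in D) g x.
Proof.
move=> mN N0 fg; rewrite integral_mkcond [RHS]integral_mkcond.
have fgD x : ~ N x -> (f \_ D) x = (g \_ D) x.
  move=> Nx; rewrite !patchE; case: ifPn => //; rewrite inE => Dx.
  exact: fg.
rewrite integralE [RHS]integralE; congr (_ - _); apply/eqP;
  rewrite eq_le; apply/andP; split;
  apply: (ge0_null_modification_le mN N0) => // x Nx;
  by rewrite ?funepos.unlock ?funeneg.unlock/= fgD.
Qed.

End null_modification.

Section sphere_means.
Context {R : realType}.
Variable m : nat.
Hypothesis m0 : (0 < m)%N.
Local Notation V := 'rV[R[i]]_m.
Local Notation leb := (@lebesgue_measure R).
Local Notation lebC := (lebesgueC R m).
Local Notation B := (@cball1 R m).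
Local Notation J := (@radial_jacobian R m).
Local Open Scope ereal_scope.

Let mB := @measurable_cball1 R m.

Lemma sphere_proj_in (r : R) (w : V) : (0 < r)%R -> w != 0%R ->
  cnorm (sphere_proj r w) = r.
Proof.
move=> r0 w0; rewrite /sphere_proj cnormZr.
have s0 : (0 < cnorm w)%R.
  by rewrite lt_def cnorm_ge0 andbT; apply: contra w0 => /eqP/cnorm_eq0 ->.
by rewrite ger0_norm ?divfK ?gt_eqF// divr_ge0// ltW.
Qed.

Hypothesis B0 : lebC B != 0.

Let c : R := (fine (lebC B))^-1.

Let c0 : (0 < c)%R.
Proof.
rewrite invr_gt0 fine_gt0// lebesgueC_cball1_lty andbT.
by rewrite lt_def B0 measure_ge0.
Qed.

Let uniformE (A : set V) : uniform_ball1 R m A = lebC (A `&` B) * c%:E.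
Proof.
have BT : lebC (setT `&` B) = lebC B by rewrite setTI.
rewrite /uniform_ball1/= /mnormalize/= /mrestr/= !BT (negbTE B0)/=.
by have := @lebesgueC_cball1_lty R m; rewrite ltey => /negbTE ->.
Qed.

Let integral_uniform (f : V -> \bar R) : measurable_fun setT f ->
  (forall x, 0 <= f x) ->
  \int[uniform_ball1 R m]_x f x = c%:E * \int[lebC]_w ((\1_B w)%:E * f w).
Proof.
move=> mf f0.
pose NB := ~` B; have mNB : measurable NB by exact: measurableC.
rewrite (@ge0_negligible_integral _ _ _ _ setT NB)//; last first.
  by transitivity (lebC (NB `&` B) * c%:E); [exact: uniformE|
    rewrite /NB setICl measure0 mul0e].
rewrite setTD setCK.
pose m1 := mscale (NngNum (ltW c0)) lebC.
rewrite (eq_measure_integral m1); last first.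
  move=> A mA AB; rewrite [LHS]uniformE /m1/= /mscale/= muleC.
  by congr (_ * lebC _); apply/setIidPl.
rewrite ge0_integral_mscale//; last exact: measurable_funTS.
congr (_ * _); rewrite integral_mkcond; apply: eq_integral => x _.
by rewrite patchE indicE; case: (x \in B); rewrite ?mul1e ?mul0e.
Qed.

Let mproj (r : R) := @measurable_sphere_proj R m r.

(** The normalized surface measure is the image of the uniform measure on the unit
    ball, as in the polar formula. *)
Lemma sphere_measureE (r : R) (f : V -> \bar R) : measurable_fun setT f ->
  (forall x, 0 <= f x) -> (0 < r)%R ->
  \int[sphere_measure m r]_(x in csphere r) f x =
  c%:E * \int[lebC]_w ((\1_B w)%:E * f (sphere_proj r w)).
Proof.
move=> mf f0 r0.
have mS : measurable (csphere r : set V).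
  rewrite (_ : csphere r = (@cnorm R m) @^-1` [set r])//.
  by rewrite -[X in measurable X]setTI; exact: (@measurable_cnorm R m).
have SN : sphere_measure m r (~` csphere r) = 0.
  transitivity (lebC ((sphere_proj r @^-1` (~` csphere r)) `&` B) * c%:E).
    exact: uniformE.
  rewrite (_ : lebC _ = 0) ?mul0e//.
  apply: (@subset_measure0 _ _ _ lebC _ [set 0%R]) => //.
  - apply: measurableI => //; rewrite -[X in measurable X]setTI.
    by apply: mproj => //; exact: measurableC.
  - exact: measurable_row0.
  - move=> w [/= H _]; apply: contrapT => /eqP w0; apply: H.
    by rewrite /csphere/= sphere_proj_in.
  - exact: lebesgueC_row0.
have := @ge0_negligible_integral _ _ _ (sphere_measure m r) setT
  (~` csphere r) f (measurableC mS) measurableT mf (fun x _ => f0 x) SN.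
rewrite setTD setCK => <-.
rewrite (ge0_integral_pushforward (mproj r))// preimage_setT.
exact: (integral_uniform (measurableT_comp mf (mproj r)) (fun x => f0 _)).
Qed.

End sphere_means.

Section radial_integrals.
Context {R : realType}.
Variable m : nat.
Hypothesis m0 : (0 < m)%N.
Local Notation V := 'rV[R[i]]_m.
Local Notation leb := (@lebesgue_measure R).
Local Notation lebC := (lebesgueC R m).
Local Notation B := (@cball1 R m).
Local Notation J := (@radial_jacobian R m).
Local Open Scope ereal_scope.

Let mB : measurable_fun setT (\1_B : V -> R).
Proof. exact/measurable_indic/measurable_cball1. Qed.

(** Otherwise the polar formula would give [0] for a Gaussian integral. *)
Lemma lebesgueC_cball1_neq0 : lebC B != 0.
Proof.
apply/negP => /eqP B0.
have mS := @measurable_cball1 R m.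
have mg := @measurable_gauss_row R m (fun=> 1%R).
have := @gauss_row R m (fun=> 1%R) (fun=> ltr01).
rewrite (polar_integral m0)//.
under eq_integral => r _.
  rewrite (_ : (\int[lebC]_w _) = 0); last first.
    rewrite (@ge0_negligible_integral _ _ _ _ setT B)//; last 2 first.
    - apply: emeasurable_funM.
        by apply/measurable_EFinP; exact: measurable_funM.
      exact: measurableT_comp mg (@measurable_sphere_proj R m r).
    - move=> w _; rewrite mule_ge0// lee_fin mulr_ge0 ?radial_jacobian_ge0//.
    rewrite integral0_eq// => w [_ /= nB].
    by rewrite indicE memNset// mulr0 mul0e.
  over.
rewrite integral0 => /esym [].
by apply/eqP; rewrite gt_eqF// prodr_gt0// => j _; rewrite divr_gt0// pi_gt0.
Qed.

Let c : R := (fine (lebC B))^-1.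

Let c0 : (0 < c)%R.
Proof.
rewrite invr_gt0 fine_gt0// lebesgueC_cball1_lty andbT.
by rewrite lt_def lebesgueC_cball1_neq0 measure_ge0.
Qed.

Variable t : R.
Let phi (w : V) : R := expR (- (t * cnorm w ^+ 2)).

Let mphi : measurable_fun setT phi.
Proof.
apply: measurableT_comp => //; apply: measurableT_comp => //.
by apply: measurable_funM => //; apply: measurable_funX; exact: measurable_cnorm.
Qed.

Let A (k : V -> R) (r : R) : \bar R := \int[lebC]_w
  ((J r * \1_B w)%:E * (phi (sphere_proj r w) * k (sphere_proj r w))%:E).

Let mG (k : V -> R) : measurable_fun setT k ->
  measurable_fun setT (fun x : measurableTypeR R * V =>
    (J x.1 * \1_B x.2)%:E *
    (phi (sphere_proj x.1 x.2) * k (sphere_proj x.1 x.2))%:E).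
Proof.
move=> mk; apply: emeasurable_funM; apply/measurable_EFinP.
  apply: measurable_funM.
    exact: (measurableT_comp (@measurable_radial_jacobian R m) measurable_fst).
  exact: (measurableT_comp mB measurable_snd).
apply: measurable_funM.
  exact: (measurableT_comp mphi (@measurable_sphere_proj2 R m)).
exact: (measurableT_comp mk (@measurable_sphere_proj2 R m)).
Qed.

Let G0 (k : V -> R) : (forall x, 0 <= k x)%R -> forall x : measurableTypeR R * V,
  0 <= (J x.1 * \1_B x.2)%:E *
    (phi (sphere_proj x.1 x.2) * k (sphere_proj x.1 x.2))%:E.
Proof.
move=> k0 x; rewrite mule_ge0// lee_fin mulr_ge0 ?radial_jacobian_ge0//.
exact: expR_ge0.
Qed.

Let mA (k : V -> R) : measurable_fun setT k -> (forall x, 0 <= k x)%R ->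
  measurable_fun [set: measurableTypeR R] (A k).
Proof.
move=> mk k0; have := @measurable_fun_fubini_tonelli_F _ _ _ _ _ lebC _ (mG mk).
by apply; exact: G0.
Qed.

Let intA (k : V -> R) : measurable_fun setT k -> (forall x, 0 <= k x)%R ->
  \int[lebC]_w (phi w * k w)%:E = \int[leb]_r A k r.
Proof.
move=> mk k0; rewrite (polar_integral m0)//.
  by apply/measurable_EFinP; exact: measurable_funM.
by move=> x; rewrite lee_fin mulr_ge0// expR_ge0.
Qed.

Let A_sphere (k : V -> R) r : measurable_fun setT k -> (forall x, 0 <= k x)%R ->
  (0 < r)%R -> A k r = (J r * expR (- (t * r ^+ 2)) / c)%:E *
    \int[sphere_measure m r]_(x in csphere r) (k x)%:E.
Proof.
move=> mk k0 r0; have mkE : measurable_fun setT (fun x => (k x)%:E) by exact/measurable_EFinP.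
rewrite (sphere_measureE m0 lebesgueC_cball1_neq0)//.
rewrite muleA -EFinM divfK ?gt_eqF//.
have mkp := measurableT_comp mk (@measurable_sphere_proj R m r).
rewrite -ge0_integralZl//; last 3 first.
- apply: emeasurable_funM; first exact/measurable_EFinP.
  exact/measurable_EFinP.
- by move=> w _; rewrite mule_ge0// lee_fin.
- by rewrite lee_fin mulr_ge0 ?radial_jacobian_ge0 ?expR_ge0.
rewrite /A; apply: ge0_ae_eq_integral => //.
- have := measurableT_comp (mG mk) (measurable_pair1 r); exact.
- apply: measurable_funeM; apply: emeasurable_funM; exact/measurable_EFinP.
- by move=> w _; have := G0 k0 (r, w).
- move=> w _; rewrite mule_ge0//.
    by rewrite lee_fin mulr_ge0 ?radial_jacobian_ge0 ?expR_ge0.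
  by rewrite mule_ge0// lee_fin.
exists [set 0%R]; split; [exact: measurable_row0|exact: lebesgueC_row0|].
move=> w /= H; apply: contrapT => /eqP w0; apply: H => _.
rewrite /phi sphere_proj_in// -!EFinM; congr (_%:E); ring.
Qed.

Let A_ge0 (k : V -> R) r : (forall x, 0 <= k x)%R -> 0 <= A k r.
Proof. by move=> k0; apply: integral_ge0 => w _; exact: (G0 k0 (r, w)). Qed.

Let A_le0 (k : V -> R) r : (r <= 0)%R -> A k r = 0.
Proof.
move=> r0; rewrite /A.
have -> : J r = 0%R.
  rewrite /radial_jacobian indicE memNset ?mulr0//= in_itv/= andbT.
  by rewrite ltNge r0.
by under eq_integral do rewrite mul0r mul0e; rewrite integral0.
Qed.

Let J_gt0 r : (0 < r)%R -> (0 < J r)%R.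
Proof.
move=> r0; rewrite /radial_jacobian indicE mem_set/= ?in_itv/= ?r0// mulr1.
by rewrite mulr_gt0 ?exprn_gt0// ltr0n muln_gt0.
Qed.

Let A_finite (k : V -> R) : measurable_fun setT k -> (forall x, 0 <= k x)%R ->
  lebC.-integrable setT (EFin \o (fun w => phi w * k w)%R) ->
  {ae leb, forall r, [set: measurableTypeR R] r -> A k r \is a fin_num}.
Proof.
move=> mk k0 ik; apply: integrable_ae => //; apply/integrableP; split.
  exact: mA.
under eq_integral do rewrite gee0_abs ?A_ge0//.
by rewrite -intA//; exact: integrable_lty.
Qed.

Let A_null (N : set V) : measurable N -> lebC N = 0 ->
  {ae leb, forall r, [set: measurableTypeR R] r -> A (\1_N) r = 0}.
Proof.
move=> mN N0.
have mi : measurable_fun setT (\1_N : V -> R) by exact: measurable_indic.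
have i0 x : (0 <= (\1_N x : R))%R by [].
apply/(ae_eq_integral_abs leb measurableT (mA mi i0)).
under eq_integral do rewrite gee0_abs ?A_ge0//.
rewrite -intA//.
rewrite (@ge0_negligible_integral _ _ _ _ setT N)//; last 2 first.
- by apply/measurable_EFinP; exact: measurable_funM.
- by move=> w _; rewrite lee_fin mulr_ge0// expR_ge0.
rewrite integral0_eq// => w [_ /= nN].
by rewrite indicE memNset// mulr0.
Qed.

(** The integral against a radial Gaussian is a superposition of spherical means.
    The hypothesis bears on [f], which need not be measurable, while [h] is the Borel
    function equal to it outside [N]. For almost every radius [N] is negligible on the
    sphere and both parts of [h] are integrable there; for these radii the integrals of
    the positive and negative parts agree. *)
Lemma radial_integral_eq0 (f h : V -> R) (N : set V) : measurable_fun setT h ->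
  measurable N -> lebC N = 0 -> (forall x, ~ N x -> f x = h x) ->
  lebC.-integrable setT (EFin \o (fun w => phi w * h w)%R) ->
  (forall r, (0 < r)%R ->
    (\int[sphere_measure m r]_(x in csphere r) f x)%R = 0%R) ->
  \int[lebC]_w (phi w * h w)%:E = 0.
Proof.
move=> mh mN N0 fh ih f0.
pose hp := (h^\+)%R; pose hn := (h^\-)%R.
have mhp : measurable_fun setT hp by exact: measurable_funrpos.
have mhn : measurable_fun setT hn by exact: measurable_funrneg.
have hp0 x : (0 <= hp x)%R by exact: funrpos_ge0.
have hn0 x : (0 <= hn x)%R by exact: funrneg_ge0.
have mi : measurable_fun setT (\1_N : V -> R) by exact: measurable_indic.
have i0 x : (0 <= (\1_N x : R))%R by [].
have hpn x : (hp x + hn x = `|h x|)%R by rewrite -[RHS]/((Num.norm \o h) x) -funrposDneg.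
have dom (k : V -> R) : measurable_fun setT k -> (forall x, 0 <= k x)%R ->
    (forall x, k x <= `|h x|)%R ->
    lebC.-integrable setT (EFin \o (fun w => phi w * k w)%R).
  move=> mk k0 kh.
  apply: (integrable_le_real (h2 := fun w => `|phi w * h w|%R)).
  - exact: measurable_funM.
  - move=> w; rewrite normrM [in leRHS]normrM ler_wpM2l// ger0_norm//.
  - exact: (integrable_norm ih).
have ip : lebC.-integrable setT (EFin \o (fun w => phi w * hp w)%R).
  by apply: dom => // x; rewrite -hpn lerDl.
have in_ : lebC.-integrable setT (EFin \o (fun w => phi w * hn w)%R).
  by apply: dom => // x; rewrite -hpn lerDr.
have AE : \int[leb]_r A hp r = \int[leb]_r A hn r.
  apply: ge0_ae_eq_integral => //; [exact: mA|exact: mA| | |].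
  - by move=> r _; exact: A_ge0.
  - by move=> r _; exact: A_ge0.
  have H1 := A_finite mhp hp0 ip; have H2 := A_finite mhn hn0 in_.
  have H3 := A_null mN N0.
  rewrite /ae_eq; move: H1 H2 H3; apply: filterS3.
  move=> r Fp Fn FN _; have [r0|r0] := leP r 0%R; first by rewrite !A_le0.
  have {Fp} := Fp I; have {Fn} := Fn I; have {FN} := FN I.
  rewrite !A_sphere//.
  set a := \int[_]_(x in _) (\1_N x)%:E.
  set ap := \int[_]_(x in _) (hp x)%:E.
  set an := \int[_]_(x in _) (hn x)%:E.
  set k := (_ / _)%R.
  have k0 : (0 < k)%R by rewrite divr_gt0// mulr_gt0 ?J_gt0 ?expR_gt0.
  have ap0 : 0 <= ap by apply: integral_ge0 => x _; rewrite lee_fin.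
  have an0 : 0 <= an by apply: integral_ge0 => x _; rewrite lee_fin.
  have finK (x : \bar R) : 0 <= x -> k%:E * x \is a fin_num -> x \is a fin_num.
    move=> x0; case: x x0 => [x|_|]//.
    by rewrite mulry gtr0_sg// mul1e.
  move=> /eqP a0 /(finK _ an0) fan /(finK _ ap0) fap; congr (_ * _).
  have mS : measurable (csphere r : set V).
    rewrite (_ : csphere r = (@cnorm R m) @^-1` [set r])//.
    by rewrite -[X in measurable X]setTI; exact: (@measurable_cnorm R m).
  have NS : sphere_measure m r (N `&` csphere r) = 0.
    move: a0; rewrite mule_eq0 eqe gt_eqF//= => /eqP.
    by rewrite /a integral_indic.
  have := f0 _ r0; rewrite /Rintegral.
  rewrite (@integral_null_modification _ _ _ _ _ (fun x => (h x)%:E) (N `&` csphere r)) //.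
  - rewrite integralE.
    have -> : (fun x : V => (h x)%:E)^\+ = (fun x => (hp x)%:E) by exact: funerpos.
    have -> : (fun x : V => (h x)%:E)^\- = (fun x => (hn x)%:E) by exact: funerneg.
    rewrite -/ap -/an fineB// => /eqP; rewrite subr_eq0 => /eqP e.
    by rewrite -(fineK fap) e fineK.
  - exact: measurableI.
  - by move=> x Sx Nx; rewrite fh// => Nx'; apply: Nx; split.
rewrite (eq_integral (fun w => (phi w * hp w)%:E - (phi w * hn w)%:E)).
  have E : \int[lebC]_w (phi w * hp w)%:E = \int[lebC]_w (phi w * hn w)%:E.
    exact: etrans (intA mhp hp0) (etrans AE (esym (intA mhn hn0))).
  transitivity (\int[lebC]_w (phi w * hp w)%:E - \int[lebC]_w (phi w * hn w)%:E).
    exact: (integralB measurableT ip in_).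
  by rewrite E; apply: subee; exact: (integrable_fin_num measurableT in_).
move=> w _; rewrite -EFinB -mulrBr; congr (_%:E); congr (_ * _)%R.
by rewrite -[LHS]/(h w) -[in LHS](funrposBneg h).
Qed.

End radial_integrals.

(** * Integrability against Gaussians *)

Section Lp_splitting.
Context {d} {T : measurableType d} {R : realType}.
Variable mu : {measure set T -> \bar R}.

(** Membership in [L^1 + L^oo], a space that contains all the [L^p]. *)
Definition L1_Linfty (h : T -> R[i]) : Prop :=
  exists (M : R) (k : T -> R), [/\ 0 <= M, forall x, 0 <= k x,
    mu.-integrable setT (EFin \o k) & forall x, normc (h x) <= M + k x].

(** For finite [p], [y <= 1 + y ^ p]. For [p = +oo] the function is cut off where it
    exceeds an essential bound. *)
Lemma mem_Lp_L1_Linfty (p : \bar R) (g : T -> R[i]) : (1 <= p)%E ->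
  mem_Lp mu p g -> exists h : T -> R[i], [/\ measurable_fun setT h,
    {ae mu, forall x, g x = h x} & L1_Linfty h].
Proof.
move=> p1 [h [mh gh Nh]].
have mn := measurable_fun_normc mh.
case: p p1 Nh => [p|_|]; last by rewrite leNgt ltNye.
  rewrite lee_fin => p1 Nh; exists h; split => //.
  have p0 : p != 0 by rewrite gt_eqF// (lt_le_trans ltr01).
  exists 1, (fun x => powR (normc (h x)) p); split => //.
  - by move=> x; exact: powR_ge0.
  - apply/integrableP; split.
      apply/measurable_EFinP.
      exact: (measurableT_comp (measurable_powR p) mn).
    have := poweR_lty p Nh; rewrite poweR_Lnorm//.
    apply: le_lt_trans; rewrite le_eqVlt; apply/orP; left; apply/eqP.
    apply: eq_integral => x _ /=.
    by rewrite ger0_norm ?powR_ge0// ger0_norm ?normc_ge0.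
  - move=> x; have [h1|h1] := leP 1 (normc (h x)).
      by rewrite (le_trans (le1r_powR h1 p1))// lerDr ler01.
    by rewrite (le_trans (ltW h1))// lerDl powR_ge0.
have [T0 _|T0 Nh] := eqVneq (mu setT) 0%E.
  exists (fun=> 0); split; first exact: measurable_funC_cst.
    by exists setT; split.
  exists 0, (fun=> 0); split => //; first exact: integrable0.
  by move=> x; rewrite Normc.normc0 addr0.
move: Nh; rewrite unlock lt0e T0 measure_ge0/= => Nh.
have [|M HM] := @ess_supr_bounded _ _ _ mu (fun x => normc (h x)).
  apply: le_lt_trans Nh; apply: le_ess_sup; apply: nearW => x /=.
  by rewrite lee_fin ler_norm.
pose b x : R := (normc (h x) <= M)%R%:R.
have mb : measurable_fun setT b.
  rewrite (_ : b = \1_[set x | normc (h x) <= M]).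
    apply: measurable_indic; rewrite -[X in measurable X]setTI.
    exact: measurable_fun_le.
  by apply/funext => x; rewrite /b indicE; congr (nat_of_bool _)%:R;
    apply/idP/idP; rewrite inE.
exists (fun x => (b x)%:C * h x); split.
- by apply: measurable_funC_mul => //; exact: measurable_funC_real.
- by move: gh HM; apply: filterS2 => x gx hM; rewrite gx /b hM mul1r.
exists `|M|, (fun=> 0); split => //; first exact: integrable0.
move=> x; rewrite addr0 /b; case: (boolP (normc (h x) <= M)%R) => [hM|_].
  by rewrite mul1r (le_trans hM)// ler_norm.
by rewrite mul0r Normc.normc0.
Qed.

End Lp_splitting.

Section gaussian_decay.
Context {R : realType}.
Variable m : nat.
Local Notation V := 'rV[R[i]]_m.
Local Notation lebC := (lebesgueC R m).
Implicit Types (h : V -> R[i]) (a : V -> R).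

Lemma integrable_gauss (c : R) : 0 < c ->
  lebC.-integrable setT (EFin \o (fun u => expR (- (c * cnorm u ^+ 2)))).
Proof.
move=> c0; have mg := @measurable_gauss_row R m (fun=> c).
have E u : expR (- (c * cnorm u ^+ 2)) =
    expR (- \sum_j c * normc (u 0 j) ^+ 2).
  by rewrite cnorm_sqr mulr_sumr.
rewrite (_ : _ \o _ = (fun u : V => (expR (- \sum_j c * normc (u 0 j) ^+ 2))%:E)).
  apply/integrableP; split => //.
  under eq_integral do rewrite gee0_abs ?lee_fin ?expR_ge0//.
  by rewrite gauss_row// ltry.
by apply/funext => u /=; rewrite E.
Qed.

Lemma L1_Linfty_gauss_integrable h a (A c : R) : 0 < c -> measurable_fun setT h ->
  measurable_fun setT a -> L1_Linfty lebC h ->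
  (forall u, a u <= A - c * cnorm u ^+ 2) ->
  lebC.-integrable setT (EFin \o (fun u => normc (h u) * expR (a u))).
Proof.
move=> c0 mh ma [M [k [M0 k0 ik hk]]] aA.
have mea : measurable_fun setT (fun u => expR (a u)).
  exact: (measurableT_comp (@measurable_expR R)).
apply: (integrable_le_real (h2 := fun u =>
  expR A * M * expR (- (c * cnorm u ^+ 2)) + expR A * k u)).
- by apply: measurable_funM => //; exact: measurable_fun_normc.
- move=> u; rewrite ger0_norm ?mulr_ge0 ?normc_ge0 ?expR_ge0//.
  have e1 : expR (a u) <= expR A * expR (- (c * cnorm u ^+ 2)).
    by rewrite -expRD ler_expR.
  have e2 : expR (a u) <= expR A.
    by rewrite ler_expR (le_trans (aA u))// gerBl mulr_ge0 ?sqr_ge0// ltW.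
  rewrite (le_trans (ler_wpM2r (expR_ge0 _) (hk u)))// mulrDl lerD//.
    by rewrite mulrAC [_ * M]mulrC ler_wpM2l.
  by rewrite mulrC ler_wpM2r.
- apply: (integrableD measurableT (f := EFin \o (fun u =>
    expR A * M * expR (- (c * cnorm u ^+ 2))))
    (g := EFin \o (fun u => expR A * k u))).
    by apply: integrable_scale_real; exact: integrable_gauss.
  exact: integrable_scale_real.
Qed.

End gaussian_decay.

(** * Gaussian kernels *)

Section hermitian_algebra.
Context {R : realType}.
Implicit Types (a b : R[i]).

Lemma normc_sqrB a b :
  normc (a - b) ^+ 2 = normc a ^+ 2 + normc b ^+ 2 - 2 * Re (a * b^*).
Proof. by rewrite !normc_sqr Re_mul Re_sub Im_sub Re_conjc Im_conjc; ring. Qed.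

Lemma cnorm_sqrB m (z u : 'rV[R[i]]_m) :
  cnorm (z - u) ^+ 2 = cnorm z ^+ 2 + cnorm u ^+ 2 - 2 * Re (cdot z u).
Proof.
rewrite !cnorm_sqr /cdot Re_sum mulr_sumr -sumrN -!big_split/=.
by apply: eq_bigr => j _; rewrite !mxE normc_sqrB.
Qed.

Lemma cdotBr m (z u w : 'rV[R[i]]_m) : cdot z (u - w) = cdot z u - cdot z w.
Proof.
rewrite /cdot -sumrN -big_split/=; apply: eq_bigr => j _.
by rewrite !mxE rmorphB/= mulrBr.
Qed.

Lemma cdotZl m (c : R[i]) (z u : 'rV[R[i]]_m) : cdot (c *: z) u = c * cdot z u.
Proof.
by rewrite /cdot mulr_sumr; apply: eq_bigr => j _; rewrite mxE mulrA.
Qed.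

Lemma Im_cdotzz m (z : 'rV[R[i]]_m) : Im (cdot z z) = 0.
Proof.
rewrite /cdot Im_sum big1// => j _.
by rewrite mulcJ.
Qed.

Lemma normc_cdot m (z u : 'rV[R[i]]_m) :
  normc (cdot z u) <= (\sum_j normc (z 0 j)) * cnorm u.
Proof.
rewrite /cdot mulr_suml.
elim/big_rec2 : _ => [|j x y _ IH]; first by rewrite Normc.normc0.
rewrite (le_trans (normcD _ _))// lerD// Normc.normcM normc_conjc.
by rewrite ler_wpM2l ?normc_ge0// normc_entry.
Qed.

Variable n : nat.
Implicit Types (z u : 'rV[R[i]]_(n + 1)).

Definition last_coord u : R[i] := u 0 (rshift n ord0).

Lemma cdot_split z u : cdot z u =
  cdot (lsubmx z) (lsubmx u) + last_coord z * (last_coord u)^*.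
Proof.
rewrite /cdot big_split_ord/= big_ord1; congr (_ + _).
by apply: eq_bigr => j _; rewrite !mxE.
Qed.

Lemma cnorm_split u :
  cnorm u ^+ 2 = cnorm (lsubmx u) ^+ 2 + normc (last_coord u) ^+ 2.
Proof.
rewrite !cnorm_sqr big_split_ord/= big_ord1; congr (_ + _).
by apply: eq_bigr => j _; rewrite !mxE.
Qed.

Lemma measurable_last_coord : measurable_fun setT last_coord.
Proof. exact: measurable_entry. Qed.

Lemma measurable_lsubmx :
  measurable_fun setT (fun u : 'rV[R[i]]_(n + 1) => lsubmx u).
Proof.
apply: measurable_to_row => j; under eq_fun do rewrite mxE.
exact: measurable_entry.
Qed.

Lemma measurable_cdot m (z : 'rV[R[i]]_m) :
  measurable_fun setT (fun u : 'rV[R[i]]_m => cdot z u).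
Proof.
apply: measurable_funC_sum => j; apply: measurable_funC_mul.
  exact: measurable_funC_cst.
by apply: measurable_funC_conj; exact: measurable_entry.
Qed.

End hermitian_algebra.

Section exponent.
Context {R : realType}.
Variable n : nat.
Local Notation V := 'rV[R[i]]_(n + 1).
Local Notation lebC := (lebesgueC R (n + 1)).
Local Notation vv := (@last_coord R n).
Implicit Types (u : V) (z : 'rV[R[i]]_n).

(** Exponents of the Gaussian kernels below: the variables are the first [n]
    coordinates, paired with [z], and the last one. *)
Definition kernel_exponent z (b c1 c2 tau s1 s2 : R[i]) u : R[i] :=
  - b * (cnorm (lsubmx u) ^+ 2)%:C + c1 * cdot z (lsubmx u) +
  c2 * (cdot z (lsubmx u))^* - tau * (normc (vv u) ^+ 2)%:C +
  s1 * (vv u)^* + s2 * vv u.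

Lemma measurable_kernel_exponent z b c1 c2 tau s1 s2 :
  measurable_fun setT (kernel_exponent z b c1 c2 tau s1 s2).
Proof.
have mc c : measurable_fun setT (fun _ : V => c : R[i]).
  exact: measurable_funC_cst.
have mv := @measurable_last_coord R n.
have mq : measurable_fun setT (fun u : V => cdot z (lsubmx u)).
  exact: (measurableT_comp (measurable_cdot z) (@measurable_lsubmx R n)).
repeat apply: measurable_funC_add; (try apply: measurable_funC_opp);
  apply: measurable_funC_mul => //; (try exact: measurable_funC_conj);
  apply: measurable_funC_real; apply: measurable_funX.
- exact: (measurableT_comp (@measurable_cnorm R n) (@measurable_lsubmx R n)).
- exact: measurable_fun_normc.
Qed.

Let quadratic_bound (be ga y : R) : 0 < ga ->
  be * y - ga * y ^+ 2 <= be ^+ 2 / (2 * ga) - ga / 2 * y ^+ 2.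
Proof.
move=> g0; rewrite -subr_ge0.
have -> : be ^+ 2 / (2 * ga) - ga / 2 * y ^+ 2 - (be * y - ga * y ^+ 2) =
    (be - ga * y) ^+ 2 / (2 * ga) by field; rewrite gt_eqF.
by rewrite divr_ge0 ?sqr_ge0// mulr_ge0// ltW.
Qed.

Lemma kernel_integrable (g : V -> R[i]) (a : V -> R) (C al ga al' ga' : R) :
  measurable_fun setT g -> L1_Linfty lebC g -> measurable_fun setT a ->
  0 < ga -> 0 < ga' ->
  (forall u, a u <= C + (al * cnorm (lsubmx u) - ga * cnorm (lsubmx u) ^+ 2) +
    (al' * normc (vv u) - ga' * normc (vv u) ^+ 2)) ->
  lebC.-integrable setT (EFin \o (fun u => normc (g u) * expR (a u))).
Proof.
move=> mg Lg ma g0 g0' H; pose c := Num.min ga ga' / 2.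
have m0 : 0 < Num.min ga ga' by rewrite lt_min g0 g0'.
apply: (L1_Linfty_gauss_integrable (c := c)
  (A := C + al ^+ 2 / (2 * ga) + al' ^+ 2 / (2 * ga'))) => //.
  by rewrite divr_gt0.
move=> u; rewrite (le_trans (H u))// cnorm_split.
have := quadratic_bound al (cnorm (lsubmx u)) g0.
have := quadratic_bound al' (normc (vv u)) g0'.
have l1 : c * cnorm (lsubmx u) ^+ 2 <= ga / 2 * cnorm (lsubmx u) ^+ 2.
  by rewrite ler_wpM2r ?sqr_ge0// ler_wpM2r// ge_min lexx.
have l2 : c * normc (vv u) ^+ 2 <= ga' / 2 * normc (vv u) ^+ 2.
  by rewrite ler_wpM2r ?sqr_ge0// ler_wpM2r// ge_min lexx orbT.
by move: l1 l2; lra.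
Qed.

Lemma Re_kernel_exponent_le z b c1 c2 tau s1 s2 u :
  Re (kernel_exponent z b c1 c2 tau s1 s2 u) <=
  ((normc c1 + normc c2) * (\sum_j normc (z 0 j)) * cnorm (lsubmx u) -
    Re b * cnorm (lsubmx u) ^+ 2) +
  ((normc s1 + normc s2) * normc (vv u) - Re tau * normc (vv u) ^+ 2).
Proof.
have le (x : R[i]) : Re x <= normc x.
  exact: le_trans (ler_norm _) (normc_Re _).
rewrite /kernel_exponent !Re_add Re_opp mulNr Re_opp.
rewrite !(mulrC _ _%:C) !Re_scale.
have h1 := le (c1 * cdot z (lsubmx u)).
have h2 := le (c2 * (cdot z (lsubmx u))^*).
have h3 := le (s1 * (vv u)^*).
have h4 := le (s2 * vv u).
rewrite !Normc.normcM ?normc_conjc in h1 h2 h3 h4.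
have hq := normc_cdot z (lsubmx u).
have h1' := ler_wpM2l (normc_ge0 c1) hq.
have h2' := ler_wpM2l (normc_ge0 c2) hq.
move: h1 h2 h3 h4 h1' h2'; lra.
Qed.

End exponent.

Section reflection.
Context {R : realType}.
Variable m : nat.
Local Notation V := 'rV[R[i]]_m.
Local Notation lebC := (lebesgueC R m).
Local Open Scope ereal_scope.

Lemma measurable_reflection (z : V) : measurable_fun setT (fun w : V => (z - w)%R).
Proof.
rewrite (_ : (fun _ => _) = affine_row z (-1)%R); first exact: measurable_affine_row.
by apply/funext => w; rewrite /affine_row rmorphN1 scaleN1r.
Qed.

Lemma integral_reflection (z : V) (F : V -> \bar R) : measurable_fun setT F ->
  \int[lebC]_w F (z - w)%R = \int[lebC]_u F u.
Proof.
have N1 : (-1 != 0 :> R)%R by rewrite oppr_eq0 oner_eq0.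
have [_ H] := @lebesgueC_affine R m z (-1)%R N1.
have E (G : V -> \bar R) : measurable_fun setT G -> (forall x, 0 <= G x) ->
    \int[lebC]_w G (z - w)%R = \int[lebC]_u G u.
  move=> mG G0; rewrite (H G mG G0) normrN1 expr1n mul1e.
  by apply: eq_integral => w _; rewrite /affine_row rmorphN1 scaleN1r.
move=> mF; rewrite integralE [RHS]integralE.
rewrite -(E F^\+)//; last exact: measurable_funepos.
rewrite -(E F^\-)//; last exact: measurable_funeneg.
by rewrite (_ : (fun w => F (z - w)%R)^\+ = (fun w => F^\+ (z - w)%R)) 1?(_ : (fun w => F (z - w)%R)^\- = (fun w => F^\- (z - w)%R))//;
  apply/funext => w; rewrite ?funeposE ?funenegE.
Qed.

Lemma integrable_reflection (z : V) (F : V -> \bar R) :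
  lebC.-integrable setT F -> lebC.-integrable setT (fun w => F (z - w)%R).
Proof.
move=> /integrableP[mF iF]; apply/integrableP; split.
  exact: (measurableT_comp mF (measurable_reflection z)).
have mabs : measurable_fun setT (fun u => `|F u|) by exact: measurableT_comp.
by rewrite (integral_reflection z mabs).
Qed.

Lemma null_reflection (z : V) (N : set V) : measurable N -> lebC N = 0 ->
  lebC ((fun w => (z - w)%R) @^-1` N) = 0.
Proof.
move=> mN N0.
have mi : measurable_fun setT (EFin \o (\1_N : V -> R)).
  exact/measurable_EFinP/measurable_indic.
pose rf (w : V) : V := (z - w)%R.
have mP : measurable (rf @^-1` N).
  by rewrite -[X in measurable X]setTI; exact: measurable_reflection.
have e1 : \int[lebC]_w (\1_(rf @^-1` N) w)%:E = lebC (rf @^-1` N).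
  by rewrite integral_indic// setIT.
have e2 : \int[lebC]_w (\1_N w)%:E = 0 by rewrite integral_indic// setIT.
rewrite -/rf -e1 -e2 -(integral_reflection z mi).
apply: eq_integral => w _; rewrite /= !indicE; congr ((nat_of_bool _)%:R%:E).
Qed.

End reflection.

Section gaussian_means.
Context {R : realType}.
Variable n : nat.
Local Notation V := 'rV[R[i]]_(n + 1).
Local Notation lebC := (lebesgueC R (n + 1)).
Local Notation vv := (@last_coord R n).

Variables (f g : V -> R[i]).
Hypothesis mg : measurable_fun setT g.
Hypothesis Lg : L1_Linfty lebC g.
Hypothesis fg : {ae lebC, forall u,
  (expR (cnorm (lsubmx u) ^+ 2 / 4))%:C * f u = g u}.

Let n0 : (0 < n + 1)%N. Proof. by rewrite addn1. Qed.

Let integralC_eq0 (F : V -> R[i]) :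
  (\int[lebC]_u (Re (F u))%:E = 0)%E -> (\int[lebC]_u (Im (F u))%:E = 0)%E ->
  integralC lebC setT F = 0.
Proof. by move=> rF iF; apply: complexP; rewrite /= /Rintegral ?rF ?iF. Qed.

(** Averaging the twisted spherical means over the radius against a Gaussian,
    and passing from [w] to [u = z - w]. *)
Lemma gaussian_mean_eq0 (z : V) (t : R) : 0 < t ->
  (forall r, 0 < r -> twisted_spherical_mean f r z = 0) ->
  integralC lebC setT (fun u => g u * cexp (kernel_exponent (lsubmx z)
    (t + 4^-1)%:C (t - 4^-1)%:C (t + 4^-1)%:C t%:C
    ((t - 4^-1)%:C * vv z) ((t + 4^-1)%:C * (vv z)^*) u)) = 0.
Proof.
move=> t0 fz.
pose E (u : V) := kernel_exponent (lsubmx z) (t + 4^-1)%:C (t - 4^-1)%:C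
  (t + 4^-1)%:C t%:C ((t - 4^-1)%:C * vv z) ((t + 4^-1)%:C * (vv z)^*) u.
pose ft (u : V) := (expR (- (cnorm (lsubmx u) ^+ 2 / 4)))%:C * g u.
pose tw (w : V) := expi (Im (cdot z w) / 2).
pose h (w : V) := ft (z - w) * tw w.
pose F (w : V) := f (z - w) * tw w.
pose phi (w : V) := expR (- (t * cnorm w ^+ 2)).
have EE w : (phi w)%:C * h w =
    (expR (- (t * cnorm z ^+ 2)))%:C * (g (z - w) * cexp (E (z - w))).
  pose u := z - w; have wE : w = z - u by rewrite /u opprB addrC subrK.
  rewrite -/u /h -/u /ft.
  have -> : (phi w)%:C * ((expR (- (cnorm (lsubmx u) ^+ 2 / 4)))%:C * g u * tw w) =
      g u * cexp ((- (t * cnorm w ^+ 2))%:C +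
        (- (cnorm (lsubmx u) ^+ 2 / 4))%:C + (0 +i* (Im (cdot z w) / 2))).
    by rewrite !cexpD !cexpR cexpNi /phi /tw; ring.
  have -> : (expR (- (t * cnorm z ^+ 2)))%:C * (g u * cexp (E u)) =
      g u * cexp ((- (t * cnorm z ^+ 2))%:C + E u).
    by rewrite cexpD cexpR; ring.
  congr (_ * cexp _); rewrite {}wE cdotBr cnorm_sqrB (cnorm_split u) (cdot_split z u).
  rewrite /E /kernel_exponent.
  set q := cdot (lsubmx z) (lsubmx u); set v := vv u; set s := vv z.
  have zz := Im_cdotzz z.
  apply: complexP.
    rewrite !(Re_add, Re_opp, Re_mul, Im_mul, Re_conjc, Im_conjc, Im_add, Im_opp)/=.
    by field.
  rewrite !(Re_add, Re_opp, Re_mul, Im_mul, Re_conjc, Im_conjc, Im_add, Im_opp)/=.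
  by rewrite zz; field.
have iE : lebC.-integrable setT
    (EFin \o (fun u => normc (g u) * expR (Re (E u)))).
  have mRe : measurable_fun setT (fun u => Re (E u)).
    by apply: measurable_fun_Re; exact: measurable_kernel_exponent.
  have t1 : 0 < t + 4^-1 by rewrite addr_gt0.
  apply: (kernel_integrable (C := 0) mg Lg mRe t1 t0) => u.
  by rewrite add0r; exact: Re_kernel_exponent_le.
have mE : measurable_fun setT (fun u => g u * cexp (E u)).
  apply: measurable_funC_mul => //; apply: measurable_funC_cexp.
  exact: measurable_kernel_exponent.
have icE : integrableC lebC (fun u => g u * cexp (E u)).
  by apply: integrableC_le iE => // u; rewrite Normc.normcM normc_cexp.
have mft : measurable_fun setT ft.
  apply: measurable_funC_mul => //; apply: measurable_funC_real.
  apply: measurableT_comp => //; apply: measurableT_comp => //.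
  apply: measurable_funM => //; apply: measurable_funX.
  exact: (measurableT_comp (@measurable_cnorm R n) (@measurable_lsubmx R n)).
have mtw : measurable_fun setT tw.
  have -> : tw = (fun w => cexp (0 +i* (Im (cdot z w) / 2))).
    by apply/funext => w; rewrite cexpNi.
  apply: measurable_funC_cexp; apply: measurable_toC => //.
    exact: measurable_cst.
  rewrite (_ : _ \o _ = (fun w => Im (cdot z w) / 2))//.
  apply: measurable_funM => //; apply: measurable_fun_Im; exact: measurable_cdot.
have mh : measurable_fun setT h.
  apply: measurable_funC_mul => //.
  exact: (measurableT_comp mft (measurable_reflection z)).
have icEz : integrableC lebC (fun w => g (z - w) * cexp (E (z - w))).
  split; first exact: (measurableT_comp mE (measurable_reflection z)).
  by have [_] := icE; move/(integrable_reflection z).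
have ih : integrableC lebC (fun w => (phi w)%:C * h w).
  by under eq_fun do rewrite EE; exact: integrableCZ.
have [N [mN N0 sN]] := fg.
pose N' := (fun w => z - w) @^-1` N.
have mN' : measurable N'.
  by rewrite -[X in measurable X]setTI; exact: measurable_reflection.
have N'0 : lebC N' = 0 by exact: null_reflection.
have Fh w : ~ N' w -> F w = h w.
  move=> Nw; rewrite /F /h; congr (_ * _).
  have e : (expR (cnorm (lsubmx (z - w)) ^+ 2 / 4))%:C * f (z - w) = g (z - w).
    by apply: contrapT => H; apply: Nw; exact: sN.
  by rewrite /ft -e mulrA -rmorphM/= -expRD addNr expR0 mul1r.
have F0 r : 0 < r -> integralC (sphere_measure (n + 1) r) (csphere r) F = 0.
  by move=> /fz.
have Rh : (\int[lebC]_w (phi w * Re (h w))%:E = 0)%E.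
  apply: (radial_integral_eq0 n0 (f := fun w => Re (F w)) _ mN' N'0).
  - exact: measurable_fun_Re.
  - by move=> w /Fh ->.
  - apply: eq_integrable (integrableC_Re ih) => // w _ /=.
    by rewrite Re_scale.
  - by move=> r r0; have := congr1 (fun x => Re x) (F0 r r0).
have Ih : (\int[lebC]_w (phi w * Im (h w))%:E = 0)%E.
  apply: (radial_integral_eq0 n0 (f := fun w => Im (F w)) _ mN' N'0).
  - exact: measurable_fun_Im.
  - by move=> w /Fh ->.
  - apply: eq_integrable (integrableC_Im ih) => // w _ /=.
    by rewrite Im_scale.
  - by move=> r r0; have := congr1 (fun x => Im x) (F0 r r0).
have : integralC lebC setT (fun w =>
    (expR (- (t * cnorm z ^+ 2)))%:C * (g (z - w) * cexp (E (z - w)))) = 0.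
  apply: integralC_eq0.
    by rewrite -[RHS]Rh; apply: eq_integral => w _; rewrite -EE Re_scale.
  by rewrite -[RHS]Ih; apply: eq_integral => w _; rewrite -EE Im_scale.
rewrite integralCZ// => /eqP; rewrite mulf_eq0 => /orP[/eqP[/eqP]|/eqP].
  by rewrite expR_eq0.
move=> <-; apply: complexP; rewrite /= /Rintegral.
  have mR : measurable_fun setT (fun u => (Re (g u * cexp (E u)))%:E).
    by apply/measurable_EFinP; exact: measurable_fun_Re.
  by rewrite -(integral_reflection z mR).
have mI : measurable_fun setT (fun u => (Im (g u * cexp (E u)))%:E).
  by apply/measurable_EFinP; exact: measurable_fun_Im.
by rewrite -(integral_reflection z mI).
Qed.

End gaussian_means.

(** * Propagation of zeros *)

Section kernel_lines.
Context {R : realType}.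
Variable n : nat.
Local Notation V := 'rV[R[i]]_(n + 1).
Local Notation lebC := (lebesgueC R (n + 1)).
Local Notation vv := (@last_coord R n).
Implicit Types (z : 'rV[R[i]]_n) (b c tau s x : R[i]).

Variable g : V -> R[i].
Hypothesis mg : measurable_fun setT g.
Hypothesis Lg : L1_Linfty lebC g.

Definition kernel_integral z b c1 c2 tau s1 s2 : R[i] :=
  integralC lebC setT (fun u => g u * cexp (kernel_exponent z b c1 c2 tau s1 s2 u)).

Local Notation K := kernel_integral.

Lemma kernel_exponent_line z b c1 c2 tau s1 s2 b' c1' c2' tau' s1' s2' x u :
  kernel_exponent z (b + x * b') (c1 + x * c1') (c2 + x * c2')
    (tau + x * tau') (s1 + x * s1') (s2 + x * s2') u =
  kernel_exponent z b c1 c2 tau s1 s2 u +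
  x * kernel_exponent z b' c1' c2' tau' s1' s2' u.
Proof. by rewrite /kernel_exponent; ring. Qed.

Lemma normc_kernel_exponent_le z b c1 c2 tau s1 s2 u :
  normc (kernel_exponent z b c1 c2 tau s1 s2 u) <=
  ((normc c1 + normc c2) * (\sum_j normc (z 0 j)) * cnorm (lsubmx u) +
    normc b * cnorm (lsubmx u) ^+ 2) +
  ((normc s1 + normc s2) * normc (vv u) + normc tau * normc (vv u) ^+ 2).
Proof.
have nR (y : R) : normc (y ^+ 2)%:C = y ^+ 2.
  by rewrite normcR ger0_norm// sqr_ge0.
rewrite /kernel_exponent.
have D := @normcD R; have hq := normc_cdot z (lsubmx u).
have h1' := ler_wpM2l (normc_ge0 c1) hq.
have h2' := ler_wpM2l (normc_ge0 c2) hq.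
rewrite (le_trans (D _ _))// Normc.normcM.
apply: le_trans (lerD (D _ _) (lexx _)) _; rewrite Normc.normcM normc_conjc.
apply: le_trans (lerD (lerD (D _ _) (lexx _)) (lexx _)) _.
rewrite normcN Normc.normcM nR.
apply: le_trans (lerD (lerD (lerD (D _ _) (lexx _)) (lexx _)) (lexx _)) _.
rewrite Normc.normcM normc_conjc.
apply: le_trans (lerD (lerD (lerD (lerD (D _ _) (lexx _)) (lexx _)) (lexx _)) (lexx _)) _.
rewrite !Normc.normcM normcN nR.
move: h1' h2'; lra.
Qed.

Lemma measurable_kernel_integrand z b c1 c2 tau s1 s2 : measurable_fun setT
  (fun u => g u * cexp (kernel_exponent z b c1 c2 tau s1 s2 u)).
Proof.
apply: measurable_funC_mul => //; apply: measurable_funC_cexp.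
exact: measurable_kernel_exponent.
Qed.

Let line_integrable z b c1 c2 tau s1 s2 b' c1' c2' tau' s1' s2' r : 0 <= r ->
  r * normc b' < Re b -> r * normc tau' < Re tau ->
  lebC.-integrable setT (EFin \o (fun u =>
    normc (g u * cexp (kernel_exponent z b c1 c2 tau s1 s2 u)) *
    expR (r * normc (kernel_exponent z b' c1' c2' tau' s1' s2' u)))).
Proof.
move=> r0 rb rt.
pose a u := Re (kernel_exponent z b c1 c2 tau s1 s2 u) +
  r * normc (kernel_exponent z b' c1' c2' tau' s1' s2' u).
rewrite (_ : _ \o _ = EFin \o (fun u => normc (g u) * expR (a u))); last first.
  apply/funext => u /=; rewrite Normc.normcM normc_cexp -mulrA -expRD//.
have ma : measurable_fun setT a.
  apply: measurable_funD.
    by apply: measurable_fun_Re; exact: measurable_kernel_exponent.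
  apply: measurable_funM => //; apply: measurable_fun_normc.
  exact: measurable_kernel_exponent.
have ga : 0 < Re b - r * normc b' by rewrite subr_gt0.
have ga' : 0 < Re tau - r * normc tau' by rewrite subr_gt0.
apply: (kernel_integrable (C := 0)
  (al := (normc c1 + normc c2 + r * (normc c1' + normc c2')) * (\sum_j normc (z 0 j)))
  (al' := normc s1 + normc s2 + r * (normc s1' + normc s2'))
  mg Lg ma ga ga') => u.
rewrite /a.
have h1 := Re_kernel_exponent_le z b c1 c2 tau s1 s2 u.
have h2 := ler_wpM2l r0 (normc_kernel_exponent_le z b' c1' c2' tau' s1' s2' u).
rewrite add0r (le_trans (lerD h1 h2))//.
by rewrite le_eqVlt; apply/orP; left; apply/eqP; ring.
Qed.

(** Zeros of the kernel integral propagate along complex lines of parameters. *)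
Lemma kernel_line_identity z b c1 c2 tau s1 s2 b' c1' c2' tau' s1' s2' r :
  0 < r -> r * normc b' < Re b -> r * normc tau' < Re tau ->
  (forall e : R, 0 < e -> exists2 x, 0 < normc x < e &
    K z (b + x * b') (c1 + x * c1') (c2 + x * c2')
      (tau + x * tau') (s1 + x * s1') (s2 + x * s2') = 0) ->
  forall x, normc x < r -> K z (b + x * b') (c1 + x * c1') (c2 + x * c2')
      (tau + x * tau') (s1 + x * s1') (s2 + x * s2') = 0.
Proof.
move=> r0 rb rt H x xr.
have E y : K z (b + y * b') (c1 + y * c1') (c2 + y * c2')
      (tau + y * tau') (s1 + y * s1') (s2 + y * s2') =
    integralC lebC setT (fun u =>
      g u * cexp (kernel_exponent z b c1 c2 tau s1 s2 u) *
      cexp (y * kernel_exponent z b' c1' c2' tau' s1' s2' u)).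
  by apply: eq_integralC => u; rewrite kernel_exponent_line cexpD mulrA.
rewrite E; apply: (phase_identity _ _ r0 _ _ xr).
- exact: measurable_kernel_integrand.
- exact: measurable_kernel_exponent.
- exact: line_integrable (ltW r0) rb rt.
- by move=> e /H[y ye Hy]; exists y => //; rewrite -E.
Qed.

Let mvv := @measurable_last_coord R n.

Let mixed_moments z b c1 c2 tau : 0 < Re b -> 0 < Re tau ->
  (forall s1 s2, K z b c1 c2 tau s1 s2 = 0) ->
  forall k l s1 s2, integralC lebC setT (fun u =>
    g u * cexp (kernel_exponent z b c1 c2 tau s1 s2 u) *
    (vv u)^* ^+ k * vv u ^+ l) = 0.
Proof.
move=> b0 t0 H k l s1 s2.
have bar s1' s2' j : integralC lebC setT (fun u =>
    g u * cexp (kernel_exponent z b c1 c2 tau s1' s2' u) * (vv u)^* ^+ j) = 0.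
  have XE u : (vv u)^* = kernel_exponent z 0 0 0 0 1 0 u.
    by rewrite /kernel_exponent; ring.
  apply: (@moments_eq0 _ _ _ lebC _ (fun u => (vv u)^*) 1).
  - exact: measurable_kernel_integrand.
  - exact: measurable_funC_conj.
  - exact: ltr01.
  - have := @line_integrable z b c1 c2 tau s1' s2' 0 0 0 0 1 0 1 ler01.
    rewrite Normc.normc0 mulr0 => /(_ b0 t0).
    by under [in X in _ -> X]eq_fun do rewrite XE.
  - move=> e e0; exists (e / 2)%:C.
      by rewrite normcR ger0_norm ?divr_gt0 ?ltr_pdivrMr ?ltr_pMr ?ltr1n// ltW// divr_gt0.
    rewrite -(H (s1' + (e / 2)%:C) s2'); apply: eq_integralC => u.
    rewrite -mulrA -cexpD; congr (_ * cexp _); rewrite /kernel_exponent; ring.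
apply: (@moments_eq0 _ _ _ lebC (fun u => g u *
  cexp (kernel_exponent z b c1 c2 tau s1 s2 u) * (vv u)^* ^+ k) vv 1).
- apply: measurable_funC_mul; first exact: measurable_kernel_integrand.
  by apply: measurable_funC_exp; exact: measurable_funC_conj.
- exact: mvv.
- exact: ltr01.
- have XE u : (1 + 1) * normc (vv u) =
      2 * normc (kernel_exponent z 0 0 0 0 1 0 u).
    by rewrite -(normc_conjc (vv u)); congr (_ * normc _); rewrite /kernel_exponent; ring.
  have := @line_integrable z b c1 c2 tau s1 s2 0 0 0 0 1 0 2 (ler0n _ 2).
  rewrite Normc.normc0 mulr0 => /(_ b0 t0) /(integrable_scale_real k`!%:R).
  apply: integrable_le_real.
    apply: measurable_funM.
      apply: measurable_fun_normc; apply: measurable_funC_mul.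
        exact: measurable_kernel_integrand.
      by apply: measurable_funC_exp; exact: measurable_funC_conj.
    apply: measurableT_comp => //; apply: measurable_funM => //.
    exact: measurable_fun_normc.
  move=> u; rewrite ger0_norm ?mulr_ge0 ?normc_ge0 ?expR_ge0// -XE.
  rewrite !Normc.normcM normcX normc_conjc mulrDl mul1r expRD.
  rewrite [leRHS]mulrCA -[leLHS]mulrA ler_wpM2l ?mulr_ge0 ?normc_ge0//.
  rewrite mulrA ler_wpM2r ?expR_ge0//.
  rewrite mulrC -ler_pdivrMr ?ltr0n ?fact_gt0//.
  case: k => [|k]; first by rewrite expr0 fact0 divr1 -expR0 ler_expR normc_ge0.
  by rewrite (le_trans _ (expR_ge1Dxn k (normc_ge0 _)))// lerDr ler01.
- move=> e e0; exists (e / 2)%:C.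
    by rewrite normcR ger0_norm ?divr_gt0 ?ltr_pdivrMr ?ltr_pMr ?ltr1n// ltW// divr_gt0.
  rewrite -(bar s1 (s2 + (e / 2)%:C) k); apply: eq_integralC => u.
  rewrite mulrAC -[g u * _ * cexp _]mulrA -cexpD; congr (_ * cexp _ * _).
  by rewrite /kernel_exponent; ring.
Qed.

(** Once the kernel integral vanishes for all linear terms in the last variable,
    so do its moments in that variable, and the width of the Gaussian in it can
    be changed. *)
Lemma kernel_change_tau z b c1 c2 (t t' : R) : 0 < Re b -> 0 < t ->
  `|t - t'| < t -> (forall s1 s2, K z b c1 c2 t%:C s1 s2 = 0) ->
  forall s1 s2, K z b c1 c2 t'%:C s1 s2 = 0.
Proof.
move=> b0 t0 tt' H s1 s2.
have tR : 0 < Re t%:C by [].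
pose X u : R[i] := (normc (vv u) ^+ 2)%:C.
have XE u : X u = kernel_exponent z 0 0 0 (-1) 0 0 u.
  by rewrite /kernel_exponent /X; ring.
pose r := (`|t - t'| + t) / 2.
have r0 : 0 < r by rewrite divr_gt0// ltr_wpDl.
have rt : r < t by rewrite /r; lra.
have tr : normc (t - t')%:C < r by rewrite normcR /r; lra.
have -> : K z b c1 c2 t'%:C s1 s2 = integralC lebC setT (fun u =>
    g u * cexp (kernel_exponent z b c1 c2 t%:C s1 s2 u) *
    cexp ((t - t')%:C * X u)).
  apply: eq_integralC => u; rewrite -mulrA -cexpD; congr (_ * cexp _).
  by rewrite /kernel_exponent /X rmorphB/=; ring.
apply: (phase_eq0_moments _ _ r0 _ _ tr).
- exact: measurable_kernel_integrand.
- by apply: measurable_funC_real; apply: measurable_funX; exact: measurable_fun_normc.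
- have := @line_integrable z b c1 c2 t%:C s1 s2 0 0 0 (-1) 0 0 r (ltW r0).
  rewrite Normc.normc0 mulr0 normcN Normc.normc1 mulr1 => /(_ b0 rt).
  by under [in X in _ -> X]eq_fun do rewrite XE.
- move=> k; rewrite -[RHS](mixed_moments b0 tR H k k s1 s2).
  apply: eq_integralC => u; rewrite -[RHS]mulrA; congr (_ * _).
  by rewrite -exprMn mulrC mulcJ.
Qed.

End kernel_lines.

Section analytic_continuation.
Context {R : realType}.
Variable n : nat.
Local Notation V := 'rV[R[i]]_(n + 1).
Local Notation lebC := (lebesgueC R (n + 1)).
Implicit Types (z : 'rV[R[i]]_n) (s x : R[i]) (t : R).

Variable g : V -> R[i].
Hypothesis mg : measurable_fun setT g.
Hypothesis Lg : L1_Linfty lebC g.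

Local Notation K := (kernel_integral g).

Variable rho : R.
Hypothesis K0 : forall t z s, 0 < t -> cnorm z = rho ->
  K z (t + 4^-1)%:C (t - 4^-1)%:C (t + 4^-1)%:C t%:C
    ((t - 4^-1)%:C * s) ((t + 4^-1)%:C * s^*) = 0.

Let half (e : R) : 0 < e -> 0 < normc (e / 2)%:C < e.
Proof.
move=> e0; rewrite normcR gtr0_norm ?divr_gt0//= ltr_pdivrMr//.
by rewrite ltr_pMr// ltr1n.
Qed.

(** The spherical means are known at the points [s] of the complex line, a
    totally real subspace of the pairs of independent linear terms. *)
Let step_last t z : 0 < t -> t != 4^-1 -> cnorm z = rho -> forall s1 s2,
  K z (t + 4^-1)%:C (t - 4^-1)%:C (t + 4^-1)%:C t%:C s1 s2 = 0.
Proof.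
move=> t0 t4 zr s1 s2.
pose a : R[i] := (t - 4^-1)%:C; pose b : R[i] := (t + 4^-1)%:C.
have a0 : a != 0 by rewrite /a fmorph_eq0 subr_eq0.
have b0 : b != 0 by rewrite /b fmorph_eq0 gt_eqF// addr_gt0.
have Rb : 0 < Re b by rewrite /b/= addr_gt0.
have Rt : 0 < Re t%:C by [].
have Kab s : K z b a b t%:C (a * s) (b * s^*) = 0 by exact: K0.
rewrite -/a -/b; clearbody a b.
(* Real [x] correspond to the real parts of [s], here [x + i y]. *)
have line1 (y : R) x : K z b a b t%:C (a * (0 +i* y) + x * a)
    (b * (0 +i* y)^* + x * b) = 0.
  have H := @kernel_line_identity R n g mg Lg z b a b t%:C (a * (0 +i* y))
    (b * (0 +i* y)^*) 0 0 0 0 a b (normc x + 1).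
  rewrite !Normc.normc0 !mulr0 in H.
  have H1 : forall e : R, 0 < e -> exists2 x0 : R[i],
      0 < normc x0 < e & K z (b + x0 * 0) (a + x0 * 0) (b + x0 * 0)
      (t%:C + x0 * 0) (a * (0 +i* y) + x0 * a) (b * (0 +i* y)^* + x0 * b) = 0.
    move=> e e0; exists (e / 2)%:C; first exact: half.
    rewrite !mulr0 !addr0.
    have -> : a * (0 +i* y) + (e / 2)%:C * a = a * ((e / 2) +i* y).
      by rewrite [_ * a]mulrC -mulrDr; congr (_ * _);
        apply: complexP; rewrite ?Re_add ?Im_add/= ?add0r ?addr0.
    have -> : b * (0 +i* y)^* + (e / 2)%:C * b = b * ((e / 2) +i* y)^*.
      by rewrite [_ * b]mulrC -mulrDr; congr (_ * _);
        apply: complexP; rewrite ?Re_add ?Im_add/= ?add0r ?addr0.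
    exact: Kab.
  have := H (ltr_wpDl (normc_ge0 x) ltr01) Rb Rt H1 x.
  by rewrite !mulr0 !addr0; apply; rewrite ltrDl ltr01.
(* Real [y] are the case covered by the previous line. *)
have line2 x y : K z b a b t%:C (a * x + y * (a * 'i)) (b * x + y * (- b * 'i)) = 0.
  have H := @kernel_line_identity R n g mg Lg z b a b t%:C (a * x)
    (b * x) 0 0 0 0 (a * 'i) (- b * 'i) (normc y + 1).
  rewrite !Normc.normc0 !mulr0 in H.
  have H1 : forall e : R, 0 < e -> exists2 x0 : R[i],
      0 < normc x0 < e & K z (b + x0 * 0) (a + x0 * 0) (b + x0 * 0)
      (t%:C + x0 * 0) (a * x + x0 * (a * 'i)) (b * x + x0 * (- b * 'i)) = 0.
    move=> e e0; exists (e / 2)%:C; first exact: half.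
    rewrite !mulr0 !addr0.
    have -> : a * x + (e / 2)%:C * (a * 'i) = a * (0 +i* (e / 2)) + x * a.
      rewrite addrC [x * a]mulrC; congr (_ + _).
      by apply: complexP; rewrite !(Re_mul, Im_mul)/=; ring.
    have -> : b * x + (e / 2)%:C * (- b * 'i) = b * (0 +i* (e / 2))^* + x * b.
      rewrite addrC [x * b]mulrC; congr (_ + _).
      by apply: complexP; rewrite !(Re_mul, Im_mul, Re_opp, Im_opp, Re_conjc, Im_conjc)/=; ring.
    exact: line1.
  have := H (ltr_wpDl (normc_ge0 y) ltr01) Rb Rt H1 y.
  by rewrite !mulr0 !addr0; apply; rewrite ltrDl ltr01.
have i2 : 'i * 'i = -1 :> R[i] by apply: complexP; rewrite ?Re_mul ?Im_mul ?Re_opp ?Im_opp/=; ring.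
have e1 (w : R[i]) : w * - 'i * (a * 'i) = w * a.
  by transitivity (- ('i * 'i) * (w * a)); [ring|rewrite i2; ring].
have e2 (w : R[i]) : w * - 'i * (- b * 'i) = - (w * b).
  by transitivity ('i * 'i * (w * b)); [ring|rewrite i2; ring].
(* These solve [a (x + y) = s1] and [b (x - y) = s2]. *)
pose x := (s1 / a + s2 / b) / 2%:R; pose y := (s1 / a - s2 / b) / 2%:R.
have E1 : a * x + y * - 'i * (a * 'i) = s1 by rewrite e1 /x /y; field; rewrite a0 b0.
have E2 : b * x + y * - 'i * (- b * 'i) = s2 by rewrite e2 /x /y; field; rewrite a0 b0.
by have := line2 x (y * - 'i); rewrite E1 E2.
Qed.

(** The coefficient of [|v|^2] must be decoupled from [b] before [b] can vary; the
    value [1/8] can be reached from all [t] in an interval. *)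
Let step_tau t z : 8^-1 < t < 4^-1 -> cnorm z = rho -> forall s1 s2,
  K z (t + 4^-1)%:C (t - 4^-1)%:C (t + 4^-1)%:C (8^-1)%:C s1 s2 = 0.
Proof.
move=> /andP[t8 t4] zr; have t0 : 0 < t by lra.
apply: (kernel_change_tau mg Lg (t := t)) => //=.
- by rewrite addr_gt0.
- by rewrite ger0_norm; lra.
- by apply: step_last => //; rewrite lt_eqF.
Qed.

(** The zeros in an interval extend to a disc on which the integrals converge
    absolutely and which contains all the values of [b] used below. *)
Let step_disc z b s1 s2 : cnorm z = rho -> normc (b - (7 / 16)%:C) < 7 / 16 ->
  K z b (b - (2^-1)%:C) b (8^-1)%:C s1 s2 = 0.
Proof.
move=> zr bd.
pose r := (normc (b - (7 / 16)%:C) + 7 / 16) / 2.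
have r0 : 0 < r by rewrite divr_gt0// ltr_wpDl ?normc_ge0.
have r7 : r < 7 / 16 by rewrite /r; lra.
have br : normc (b - (7 / 16)%:C) < r by rewrite /r; lra.
have H := @kernel_line_identity R n g mg Lg z (7 / 16)%:C (- 16^-1)%:C
  (7 / 16)%:C (8^-1)%:C s1 s2 1 1 1 0 0 0 r r0.
rewrite Normc.normc0 Normc.normc1 !mulr1 !mulr0 in H.
have H1 : forall e : R, 0 < e -> exists2 x : R[i], 0 < normc x < e &
    K z ((7 / 16)%:C + x * 1) ((- 16^-1)%:C + x * 1) ((7 / 16)%:C + x * 1)
    ((8^-1)%:C + x * 0) (s1 + x * 0) (s2 + x * 0) = 0.
  move=> e e0; pose y := Num.min e (16^-1) / 2.
  have m0 : 0 < Num.min e (16^-1) by rewrite lt_min e0/=; lra.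
  have me : Num.min e (16^-1) <= e by rewrite ge_min lexx.
  have m16 : Num.min e (16^-1) <= 16^-1 by rewrite ge_min lexx orbT.
  have y0 : 0 < y by rewrite /y; lra.
  have ye : y < e by rewrite /y; lra.
  have y16 : y < 16^-1 by rewrite /y; lra.
  exists y%:C; first by rewrite normcR gtr0_norm// y0.
  rewrite !mulr1 !mulr0 !addr0.
  have yb : 8^-1 < 3 / 16 + y < 4^-1 by apply/andP; split; lra.
  have -> : (7 / 16)%:C + y%:C = (3 / 16 + y + 4^-1)%:C :> R[i].
    by rewrite -rmorphD/=; congr (_%:C); lra.
  have -> : (- 16^-1)%:C + y%:C = (3 / 16 + y - 4^-1)%:C :> R[i].
    by rewrite -rmorphD/=; congr (_%:C); lra.
  exact: step_tau.
have := H r7 _ H1 _ br; rewrite !mulr1 !mulr0 !addr0 => /(_ _).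
have -> : (7 / 16)%:C + (b - (7 / 16)%:C) = b by ring.
have -> : (- 16^-1)%:C + (b - (7 / 16)%:C) = b - (2^-1)%:C.
  rewrite addrCA -rmorphN -rmorphD/= -rmorphN; congr (_ + _%:C); lra.
by apply; rewrite /= invr_gt0.
Qed.

Let step_rotate z b lam s1 s2 : cnorm z = rho -> normc lam = 1 ->
  normc (b - (7 / 16)%:C) < 7 / 16 ->
  K z b ((b - (2^-1)%:C) * lam) (b * lam^*) (8^-1)%:C s1 s2 = 0.
Proof.
move=> zr l1 bd.
have zr' : cnorm (lam *: z) = rho by rewrite cnormZ l1 mul1r.
rewrite -(step_disc s1 s2 zr' bd); apply: eq_integralC => u.
congr (_ * cexp _); rewrite /kernel_exponent cdotZl rmorphM/=; ring.
Qed.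

(** The quadric [c1 * c2 = b * (b - 1/2)] carries two families of lines. Rotations
    of [z] reach the lines [c1 = lam * (b - 1/2)] with [lam] of modulus one; each
    line of the other family crosses them along an arc of circle, hence the
    vanishing also holds at the points [(eps, - kap, kap)], where the kernel is
    bounded. *)
Lemma kernel_vanishing_on_sphere (eps : R) z s1 s2 : 0 < eps < 2^-1 ->
  cnorm z = rho ->
  K z eps%:C (- Num.sqrt (eps * (2^-1 - eps)))%:C
    (Num.sqrt (eps * (2^-1 - eps)))%:C (8^-1)%:C s1 s2 = 0.
Proof.
move=> /andP[e0 e2] zr; set kap := Num.sqrt _.
have d0 : 0 < 2^-1 - eps by rewrite subr_gt0.
have kap0 : 0 < kap by rewrite sqrtr_gt0 mulr_gt0.
have kap2 : kap ^+ 2 = eps * (2^-1 - eps) by rewrite sqr_sqrtr// mulr_ge0// ltW.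
(* The line of the second ruling through [(eps, - kap, kap)] is
   [c1 = - b / k], [c2 = (1/2 - b) k]. It meets the line of the first ruling with
   parameter [lam] at [b = k lam / (2 (1 + k lam))]; [b0] is the value for
   [lam = 1]. *)
pose k := kap / (2^-1 - eps).
have k0 : 0 < k by rewrite divr_gt0.
have k2 : k ^+ 2 = eps / (2^-1 - eps).
  by rewrite /k expr_div_n kap2; field; rewrite gt_eqF//; lra.
have q0 : 0 < 1 + k ^+ 2 by rewrite ltr_wpDr ?sqr_ge0.
have ek : eps = k ^+ 2 / 2 / (1 + k ^+ 2).
  apply: (mulIf (lt0r_neq0 q0)); rewrite divfK ?gt_eqF// k2; field.
  by rewrite gt_eqF//; lra.
have kk1 : kap = (2^-1 - eps) * k by rewrite /k mulrC divfK// gt_eqF.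
have kk2 : kap = eps / k.
  have E : eps = k ^+ 2 * (2^-1 - eps) by rewrite k2 divfK ?gt_eqF.
  by rewrite kk1 [in RHS]E; field; rewrite gt_eqF.
pose b0 := k / 2 / (1 + k).
have k1 : 0 < 1 + k by rewrite addr_gt0.
have b00 : 0 < b0 by rewrite divr_gt0// divr_gt0.
have b02 : b0 < 2^-1 by rewrite /b0 ltr_pdivrMr//; lra.
have eb0 : `|eps - b0| < b0.
  have : eps < 2 * b0.
    rewrite -subr_gt0 [X in _ - X]ek /b0 (_ : _ - _ = k / 2 *
      ((k - 2^-1) ^+ 2 + 7 / 4) / ((1 + k) * (1 + k ^+ 2))).
      by rewrite divr_gt0 ?mulr_gt0// ?ltr_wpDl ?sqr_ge0// ?invr_gt0//; lra.
    by field; rewrite !gt_eqF.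
  rewrite ltr_norml; lra.
pose r := (`|eps - b0| + b0) / 2.
have r0 : 0 < r by rewrite divr_gt0// ltr_wpDl.
have rb : r < b0 by rewrite /r; lra.
have er : `|eps - b0| < r by rewrite /r; lra.
have H := @kernel_line_identity R n g mg Lg z b0%:C (- (b0 / k))%:C
  ((2^-1 - b0) * k)%:C (8^-1)%:C s1 s2 1 (- k^-1)%:C (- k)%:C 0 0 0 r r0.
rewrite Normc.normc0 Normc.normc1 !mulr1 !mulr0 in H.
have H1 : forall e : R, 0 < e -> exists2 x : R[i], 0 < normc x < e &
    K z (b0%:C + x * 1) ((- (b0 / k))%:C + x * (- k^-1)%:C)
    (((2^-1 - b0) * k)%:C + x * (- k)%:C)
    ((8^-1)%:C + x * 0) (s1 + x * 0) (s2 + x * 0) = 0.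
  move=> e e0'; pose y := Num.min e (7 / 16 - `|b0 - 7 / 16|) / 2.
  have d7 : 0 < 7 / 16 - `|b0 - 7 / 16|.
    by rewrite subr_gt0 ltr_norml; apply/andP; split; lra.
  have m0 : 0 < Num.min e (7 / 16 - `|b0 - 7 / 16|) by rewrite lt_min e0' d7.
  have me : Num.min e (7 / 16 - `|b0 - 7 / 16|) <= e by rewrite ge_min lexx.
  have m7 : Num.min e (7 / 16 - `|b0 - 7 / 16|) <= 7 / 16 - `|b0 - 7 / 16|.
    by rewrite ge_min lexx orbT.
  have y0 : 0 < y by rewrite /y; lra.
  have ye : y < e by rewrite /y; lra.
  have y7 : y < 7 / 16 - `|b0 - 7 / 16| by rewrite /y; lra.
  clearbody y.
  (* The parameter [lam = (1 + i y) / (1 - i y)] tends to [1] with [y]. *)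
  pose W : R[i] := 1 +i* y; pose D : R[i] := W^* + k%:C * W.
  pose x : R[i] := k%:C * (0 +i* y) / ((1 + k)%:C * D).
  have W0 : W != 0 by rewrite eq_complex/= oner_eq0.
  have Wc0 : W^* != 0 by rewrite fmorph_eq0.
  have ReD : Re D = 1 + k.
    by rewrite /D Re_add Re_conjc Re_scale/= mulr1.
  have nD : 1 + k <= normc D.
    by rewrite -ReD (le_trans (ler_norm _))// normc_Re.
  have D0 : D != 0.
    by apply/eqP => H0; move: nD; rewrite H0 Normc.normc0 leNgt k1.
  have nx : normc x = k * y / ((1 + k) * normc D).
    have ni : normc (0 +i* y) = y.
      by rewrite /Normc.normc expr0n add0r sqrtr_sqr gtr0_norm.
    rewrite /x Normc.normcM Normc.normcV.
    by rewrite Normc.normcM ni Normc.normcM !normcR !gtr0_norm.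
  have q1 : 0 < (1 + k) * normc D by rewrite mulr_gt0// (lt_le_trans k1).
  have xy : 0 < normc x <= y.
    have q2 : (1 + k) * (1 + k) <= (1 + k) * normc D.
      by rewrite ler_wpM2l// ltW.
    apply/andP; split; first by rewrite nx !mulr_gt0// invr_gt0.
    by rewrite nx ler_pdivrMr// mulrC ler_wpM2l ?(ltW y0)//; have := sqr_ge0 k; lra.
  case/andP: xy => x0 xy.
  exists x; first by rewrite x0 (le_lt_trans xy).
  pose b := b0%:C + x; pose lam := W / W^*.
  have bE : b = k%:C * W / (2 * D).
    have C2 : 2%:C = 2 :> R[i].
      by apply: complexP; rewrite ?Re_add ?Im_add/= ?addr0.
    have k1C : (1 + k)%:C = 1 + k%:C :> R[i].
      by apply: complexP; rewrite ?Re_add ?Im_add/= ?addr0.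
    have b0C : b0%:C = k%:C / 2 / (1 + k%:C) :> R[i].
      by rewrite -C2 -k1C -!fmorph_div.
    have k1C0 : 1 + k%:C != 0 :> R[i] by rewrite -k1C fmorph_eq0 gt_eqF.
    have n2 : 2 != 0 :> R[i] by rewrite pnatr_eq0.
    have iy : (0 +i* y) = (W - W^*) / 2.
      by apply: (mulIf n2); rewrite divfK//;
        apply: complexP; rewrite /W; simpc => /=; ring.
    by rewrite /b /x b0C k1C iy /D; field; rewrite k1C0 -/D D0.
  have k0' : k%:C != 0 :> R[i] by rewrite fmorph_eq0 gt_eqF.
  have e1 : (- (b0 / k))%:C + x * (- k^-1)%:C = (b - (2^-1)%:C) * lam.
    transitivity (- b / k%:C).
      by rewrite /b rmorphN rmorphM/= !rmorphN/= !fmorphV/=; ring.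
    rewrite bE /lam fmorphV/= rmorph_nat; rewrite /D; field.
    by rewrite k0' Wc0/= -/D D0.
  have e2' : ((2^-1 - b0) * k)%:C + x * (- k)%:C = b * lam^*.
    transitivity ((2^-1 - b) * k%:C).
      rewrite /b rmorphM rmorphB rmorphN/= fmorphV/= rmorph_nat; ring.
    have lamc : lam^* = W^* / W.
      rewrite -[X in _ / X](conjcK W) /lam.
      exact: (fmorph_div (conjc : {rmorphism _ -> _})).
    rewrite bE; transitivity (k%:C * W / (2 * D) * (W^* / W)).
      by rewrite /D; field; rewrite W0/= -/D D0.
    by congr (_ * _); exact: esym lamc.
  rewrite !mulr1 !mulr0 !addr0 e1 e2'.
  apply: step_rotate => //.
    rewrite /lam Normc.normcM Normc.normcV normc_conjc divff// .
    by apply: contraNneq W0 => /normc_eq0 ->.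
  rewrite /b (_ : _ - _ = x + (b0 - 7 / 16)%:C); last by rewrite rmorphB/=; ring.
  by rewrite (le_lt_trans (normcD _ _))// normcR; lra.
have := H rb _ H1 (eps - b0)%:C; rewrite normcR => /(_ _ er).
rewrite !mulr1 !mulr0 !addr0 -!rmorphM -!rmorphD/=.
have -> : b0 + (eps - b0) = eps by ring.
have -> : - (b0 / k) + (eps - b0) * - k^-1 = - kap by rewrite kk2; ring.
have -> : (2^-1 - b0) * k + (eps - b0) * - k = kap by rewrite kk1; ring.
by apply; rewrite /= invr_gt0.
Qed.

End analytic_continuation.

(** * Oscillatory Gaussian integrals *)

Section taylor_sums.
Context {R : realType}.
Implicit Types (x : R[i]) (M : nat -> R[i]).

Lemma taylor_sum2 x M :
  \sum_(k < 2) x ^+ k * (k`!%:R)^-1%:C * M k = M 0 + x * M 1.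
Proof.
rewrite 2!big_ord_recr big_ord0/= (_ : 0`! = 1)%N// (_ : 1`! = 1)%N//.
by rewrite add0r expr0 expr1 !mul1r invr1 rmorph1 !mulr1 mul1r.
Qed.

Lemma taylor_sum3 x M :
  \sum_(k < 3) x ^+ k * (k`!%:R)^-1%:C * M k =
  M 0 + x * M 1 + x ^+ 2 * (2^-1)%:C * M 2.
Proof. by rewrite big_ord_recr taylor_sum2 /= (_ : 2`! = 2)%N. Qed.

End taylor_sums.

Lemma normc_cexp_sub1 {R : realType} (w : R[i]) (th b : R) :
  0 <= th <= 1 -> 0 <= b -> normc w <= th * b -> normc (cexp w - 1) <= th * expR b.
Proof.
move=> /andP[th0 th1] b0 wb; have [th00|thn] := eqVneq th 0.
  move: wb; rewrite th00 mul0r => w0.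
  have -> : w = 0 by apply: normc_eq0; apply/eqP; rewrite eq_le w0 normc_ge0.
  by rewrite cexp0 subrr Normc.normc0 mul0r.
have thp : 0 < th by rewrite lt_def thn.
have := @cexp_remainder R w (normc w / th) th 1.
rewrite th0 th1 big_ord1 expr0 fact0 invr1 rmorph1 mulr1 expr1 => /(_ isT).
rewrite mulrC divfK// divr_ge0 ?normc_ge0// => /(_ erefl isT) /le_trans; apply.
by rewrite ler_wpM2l// ler_expR ler_pdivrMr// mulrC.
Qed.

Section gaussian_transform.
Context {d} {T : measurableType d} {R : realType}.
Variable mu : {measure set T -> \bar R}.
Variables (h : T -> R[i]) (m : nat) (y : 'I_m -> T -> R).
Hypothesis mh : measurable_fun setT h.
Hypothesis my : forall k, measurable_fun setT (y k).
Implicit Types (e s a : R) (x : 'rV[R]_m) (c : R[i]).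

Definition sum_sqr (u : T) : R := \sum_k y k u ^+ 2.
Definition pairing x u : R := \sum_k x 0 k * y k u.

Hypothesis ih : forall e, 0 < e ->
  mu.-integrable setT (EFin \o (fun u => normc (h u) * expR (- (e * sum_sqr u)))).

Definition gauss_phase e x u : R[i] := (- (e * sum_sqr u)) +i* (- (2 * pairing x u)).

(** With [e] as time, this solves the heat equation [d/de = 1/4 Laplacian]. *)
Definition gauss_transform e x : R[i] :=
  integralC mu setT (fun u => h u * cexp (gauss_phase e x u)).

Lemma measurable_sum_sqr : measurable_fun setT sum_sqr.
Proof. by apply: measurable_sum => k; exact: measurable_funX. Qed.

Lemma measurable_pairing x : measurable_fun setT (pairing x).
Proof. by apply: measurable_sum => k; exact: measurable_funM. Qed.

Lemma measurable_gauss_phase e x : measurable_fun setT (gauss_phase e x).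
Proof.
have mN := measurable_sum_sqr; have mp := measurable_pairing x.
have m1 : measurable_fun setT (fun u => - (e * sum_sqr u)).
  by apply: measurableT_comp => //; exact: measurable_funM.
have m2 : measurable_fun setT (fun u => - (2 * pairing x u)).
  by apply: measurableT_comp => //; exact: measurable_funM.
by apply: measurable_toC; [exact: m1|exact: m2].
Qed.

Lemma measurable_gauss_integrand e x :
  measurable_fun setT (fun u => h u * cexp (gauss_phase e x u)).
Proof.
apply: measurable_funC_mul => //; apply: measurable_funC_cexp.
exact: measurable_gauss_phase.
Qed.

Lemma sum_sqr_ge0 u : 0 <= sum_sqr u.
Proof. by apply: sumr_ge0 => k _; exact: sqr_ge0. Qed.

Lemma normc_gauss_integrand e x u :
  normc (h u * cexp (gauss_phase e x u)) = normc (h u) * expR (- (e * sum_sqr u)).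
Proof. by rewrite Normc.normcM normc_cexp. Qed.

Let Y (u : T) : R := \sum_k `|y k u|.

Let mY : measurable_fun setT Y.
Proof. by apply: measurable_sum => k; exact: measurableT_comp. Qed.

(* Linear terms are absorbed by a small part of the quadratic one. *)
Let Y_le (g a : R) u : 0 < g ->
  a * Y u <= g * sum_sqr u + m%:R * (a ^+ 2 / (4 * g)).
Proof.
move=> g0; rewrite /Y /sum_sqr !mulr_sumr mulr_natl -[m in _ *+ m]card_ord.
rewrite -sumr_const -big_split/=; apply: ler_sum => k _.
rewrite -subr_ge0 -(real_normK (num_real (y k u))).
have -> : g * `|y k u| ^+ 2 + a ^+ 2 / (4 * g) - a * `|y k u| =
    (2 * g * `|y k u| - a) ^+ 2 / (4 * g) by field; rewrite gt_eqF.
by rewrite divr_ge0 ?sqr_ge0// mulr_ge0// ltW.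
Qed.

Lemma integrable_gauss_line e r a (b : T -> R) : 0 <= r < e -> 0 <= a ->
  measurable_fun setT b ->
  (forall u, `|b u| <= r * sum_sqr u + a * \sum_k `|y k u|) ->
  mu.-integrable setT (EFin \o (fun u =>
    normc (h u) * expR (- (e * sum_sqr u)) * expR (b u))).
Proof.
move=> /andP[r0 re] a0 mb hb.
pose g := (e - r) / 2.
have g0 : 0 < g by rewrite divr_gt0// subr_gt0.
have := integrable_scale_real (expR (m%:R * (a ^+ 2 / (4 * g)))) (ih g0).
apply: integrable_le_real.
  apply: measurable_funM; last exact: measurableT_comp.
  apply: measurable_funM; first exact: measurable_fun_normc.
  have m1 : measurable_fun setT (fun u => - (e * sum_sqr u)).
    have mN := measurable_sum_sqr.
    by apply: measurableT_comp => //; exact: measurable_funM.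
  exact: measurableT_comp m1.
move=> u; rewrite ger0_norm ?mulr_ge0 ?normc_ge0 ?expR_ge0//.
rewrite mulrCA -mulrA ler_wpM2l ?normc_ge0// -!expRD ler_expR.
have := le_trans (ler_norm _) (hb u); have := Y_le a u g0.
rewrite /g -/(Y u) => H1 H2; rewrite (le_trans (lerD (lexx _) H2))//.
by rewrite (le_trans (lerD (lexx _) (lerD (lexx _) H1)))// /g; lra.
Qed.

Lemma gauss_transform_bound e x : 0 < e ->
  normc (gauss_transform e x) <= \int[mu]_u (normc (h u) * expR (- (e * sum_sqr u))).
Proof.
move=> e0; apply: normc_integralC; last exact: ih.
- exact: measurable_gauss_integrand.
- by move=> u; rewrite normc_gauss_integrand.
Qed.

Definition gauss_moment e x (X : T -> R[i]) k : R[i] :=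
  integralC mu setT (fun u => h u * cexp (gauss_phase e x u) * X u ^+ k).

Let moment0 e x X : gauss_moment e x X 0 = gauss_transform e x.
Proof. by apply: eq_integralC => u; rewrite expr0 mulr1. Qed.

Lemma gauss_time_expansion e x : 0 < e -> exists C, forall s, `|s| <= e / 2 ->
  normc (gauss_transform (e + s) x - gauss_transform e x -
    s%:C * gauss_moment e x (fun u => (- sum_sqr u)%:C) 1) <= C * s ^+ 2.
Proof.
move=> e0; have r0 : 0 < e / 2 by rewrite divr_gt0.
pose X u : R[i] := (- sum_sqr u)%:C.
have mX : measurable_fun setT X.
  by apply: measurable_funC_real; apply: measurableT_comp => //; exact: measurable_sum_sqr.
have iX : mu.-integrable setT (EFin \o (fun u =>
    normc (h u * cexp (gauss_phase e x u)) * expR (e / 2 * normc (X u)))).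
  under [X in _ \o X]eq_fun do rewrite normc_gauss_integrand.
  apply: (@integrable_gauss_line e (e / 2) 0) => //.
  - by rewrite (ltW r0)/= ltr_pdivrMr// ltr_pMr// ltr1n.
  - by apply: measurable_funM => //; exact: measurable_fun_normc.
  - move=> u; rewrite mul0r addr0 /X normcR normrN normrM !ger0_norm ?sum_sqr_ge0//.
    exact: ltW.
have H := phase_expansion (measurable_gauss_integrand e x) mX r0 iX.
exists ((e / 2) ^- 2 * \int[mu]_u
  (normc (h u * cexp (gauss_phase e x u)) * expR (e / 2 * normc (X u)))) => s se.
have := H s%:C 2%N; rewrite normcR => /(_ se).
rewrite (taylor_sum2 _ (gauss_moment e x X)) moment0.
rewrite expr_div_n real_normK ?num_real// opprD addrA => H1.
rewrite (_ : gauss_transform (e + s) x = integralC mu setT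
  (fun u => h u * cexp (gauss_phase e x u) * cexp (s%:C * X u))).
  by rewrite (le_trans H1)// le_eqVlt; apply/orP; left; apply/eqP; ring.
apply: eq_integralC => u; rewrite -mulrA -cexpD; congr (_ * cexp _).
by apply: complexP; rewrite ?Re_add ?Im_add ?Re_scale ?Im_scale/=; ring.
Qed.

Lemma gauss_phase_add e x x' u :
  gauss_phase e (x + x') u = gauss_phase e x u + (0 +i* (- (2 * pairing x' u))).
Proof.
apply: complexP; rewrite ?Re_add ?Im_add/= ?addr0//.
rewrite /pairing -opprD -mulrDr -big_split/=; congr (- (_ * _)).
by apply: eq_bigr => k _; rewrite mxE mulrDl.
Qed.

Lemma pairing_delta k s u : pairing (s *: delta_mx 0 k) u = s * y k u.
Proof.
rewrite /pairing (bigD1 k)//= big1 ?addr0 => [|j jk].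
  by rewrite !mxE !eqxx/= mulr1.
by rewrite !mxE eqxx/= (negbTE jk) mulr0 mul0r.
Qed.

Definition coord_phase k u : R[i] := 0 +i* (- (2 * y k u)).

Let measurable_coord_phase k : measurable_fun setT (coord_phase k).
Proof.
have m1 : measurable_fun setT (fun u => - (2 * y k u)).
  by apply: measurableT_comp => //; exact: measurable_funM.
by apply: measurable_toC; [exact: measurable_cst|exact: m1].
Qed.

Let integrable_coord_phase e x k : 0 < e ->
  mu.-integrable setT (EFin \o (fun u =>
    normc (h u * cexp (gauss_phase e x u)) * expR (1 * normc (coord_phase k u)))).
Proof.
move=> e0; under [X in _ \o X]eq_fun do rewrite normc_gauss_integrand.
apply: (@integrable_gauss_line e 0 2) => //.
- by rewrite lexx.
- by apply: measurable_funM => //; exact: measurable_fun_normc.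
- move=> u; rewrite mul0r add0r mul1r.
  have -> : normc (coord_phase k u) = 2 * `|y k u|.
    by rewrite /Normc.normc/= expr0n add0r sqrtr_sqr normrN normrM ger0_norm.
  rewrite ger0_norm ?mulr_ge0// ler_wpM2l//.
  by rewrite (bigD1 k)//= lerDl sumr_ge0.
Qed.

Lemma gauss_space_expansion e x k : 0 < e -> exists C, forall s, `|s| <= 1 ->
  normc (gauss_transform e (x + s *: delta_mx 0 k) - (gauss_transform e x +
    s%:C * gauss_moment e x (coord_phase k) 1 +
    (s ^+ 2 / 2)%:C * gauss_moment e x (coord_phase k) 2)) <= C * `|s| ^+ 3.
Proof.
move=> e0; pose X := coord_phase k.
have mX : measurable_fun setT X by exact: measurable_coord_phase.
have iX := @integrable_coord_phase e x k e0.
have H := phase_expansion (measurable_gauss_integrand e x) mX ltr01 iX.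
exists (\int[mu]_u
  (normc (h u * cexp (gauss_phase e x u)) * expR (1 * normc (X u)))) => s se.
have := H s%:C 3%N; rewrite normcR => /(_ se).
rewrite (taylor_sum3 _ (gauss_moment e x X)) moment0 divr1.
rewrite (_ : gauss_transform e (x + s *: delta_mx 0 k) = integralC mu setT
  (fun u => h u * cexp (gauss_phase e x u) * cexp (s%:C * X u))).
  move=> H1; rewrite [leRHS]mulrC (le_trans _ H1)// le_eqVlt; apply/orP; left; apply/eqP.
  congr (normc (_ - _)); congr (_ + _ * _).
  by rewrite rmorphM rmorphXn.
apply: eq_integralC => u; rewrite -mulrA -cexpD gauss_phase_add pairing_delta.
congr (_ * cexp (_ + _)).
by apply: complexP; rewrite ?Re_scale ?Im_scale/=; ring.
Qed.

(** The phases satisfy [sum_k (2 i y_k)^2 = -4 |y|^2]. *)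
Lemma gauss_heat e x : 0 < e ->
  gauss_moment e x (fun u => (- sum_sqr u)%:C) 1 =
  (4^-1)%:C * \sum_k gauss_moment e x (coord_phase k) 2.
Proof.
move=> e0.
have i2 k : integrableC mu
    (fun u => h u * cexp (gauss_phase e x u) * coord_phase k u ^+ 2).
  apply: (integrableC_moment (measurable_gauss_integrand e x) _ ltr01).
  - exact: measurable_coord_phase.
  - exact: integrable_coord_phase.
rewrite /gauss_moment -integralC_sum// -integralCZ; last exact: integrableC_sum.
apply: eq_integralC => u; rewrite expr1 -mulr_sumr mulrCA; congr (_ * _).
have -> : \sum_k coord_phase k u ^+ 2 = \sum_k (- (4 * y k u ^+ 2))%:C.
  apply: eq_bigr => k _; rewrite expr2.
  by apply: complexP; rewrite ?Re_mul ?Im_mul/=; ring.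
rewrite -rmorph_sum -rmorphM; congr (_%:C).
by rewrite mulr_sumr -sumrN; apply: eq_bigr => k _; field.
Qed.

Let normc_imaginary (a : R) : normc (0 +i* a) = `|a|.
Proof. by rewrite /Normc.normc expr0n add0r sqrtr_sqr. Qed.

Let pairing_le x (a : R) u : (forall k, `|x 0 k| <= a) ->
  `|pairing x u| <= a * \sum_k `|y k u|.
Proof.
move=> xa; rewrite (le_trans (ler_norm_sum _ _ _))// mulr_sumr.
by apply: ler_sum => k _; rewrite normrM ler_wpM2r.
Qed.

(** The continuity of the transform, uniformly in the direction. *)
Lemma gauss_transform_lipschitz e x : 0 < e -> exists C, forall e' x' th,
  0 <= th <= 1 -> `|e' - e| <= th * (e / 2) ->
  (forall k, `|x' 0 k - x 0 k| <= th) ->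
  normc (gauss_transform e' x' - gauss_transform e x) <= C * th.
Proof.
move=> e0; have r0 : 0 < e / 2 by rewrite divr_gt0.
pose b u := e / 2 * sum_sqr u + 2 * \sum_k `|y k u|.
have mb : measurable_fun setT b.
  apply: measurable_funD; apply: measurable_funM => //.
  exact: measurable_sum_sqr.
have b0 u : 0 <= b u.
  by rewrite addr_ge0// mulr_ge0 ?sum_sqr_ge0 ?sumr_ge0// ltW.
have ib : mu.-integrable setT (EFin \o (fun u =>
    normc (h u) * expR (- (e * sum_sqr u)) * expR (b u))).
  apply: (@integrable_gauss_line e (e / 2) 2) => //; last by move=> u; rewrite ger0_norm.
  by rewrite (ltW r0)/= ltr_pdivrMr// ltr_pMr// ltr1n.
have ie e'' x'' : 0 < e'' -> integrableC mu (fun u => h u * cexp (gauss_phase e'' x'' u)).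
  move=> e0'; split; first exact: measurable_gauss_integrand.
  by under eq_fun do rewrite normc_gauss_integrand; exact: ih.
exists (\int[mu]_u (normc (h u) * expR (- (e * sum_sqr u)) * expR (b u))).
move=> e' x' th th01 ee xx.
have e0' : 0 < e'.
  have /andP[t0 t1] := th01.
  have : th * (e / 2) <= e / 2 by rewrite ler_piMl// ltW.
  by move: ee; rewrite ler_norml => /andP[]; lra.
rewrite mulrC -RintegralZl//.
have -> : gauss_transform e' x' - gauss_transform e x = integralC mu setT
    (fun u => h u * cexp (gauss_phase e' x' u) + -1 * (h u * cexp (gauss_phase e x u))).
  rewrite integralCD ?integralCZ ?mulN1r//; try exact: ie.
  by apply: integrableCZ; exact: ie.
apply: normc_integralC; last exact: integrable_scale_real.
  apply: measurable_funC_add; first exact: measurable_gauss_integrand.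
  apply: measurable_funC_mul; last exact: measurable_gauss_integrand.
  exact: measurable_cst.
move=> u; pose w : R[i] := (- ((e' - e) * sum_sqr u)) +i* (- (2 * pairing (x' - x) u)).
have -> : h u * cexp (gauss_phase e' x' u) + -1 * (h u * cexp (gauss_phase e x u)) =
    h u * cexp (gauss_phase e x u) * (cexp w - 1).
  rewrite mulN1r mulrBr mulr1 -mulrA -cexpD; congr (_ * cexp _ - _).
  rewrite -[in LHS](subrK x x') addrC gauss_phase_add.
  by apply: complexP; rewrite ?Re_add ?Im_add/=; ring.
rewrite Normc.normcM normc_gauss_integrand mulrCA ler_wpM2l//.
  by rewrite mulr_ge0 ?normc_ge0 ?expR_ge0.
apply: normc_cexp_sub1 => //; rewrite (le_trans (normc_le _))//= mulrDr lerD//.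
  rewrite normrN normrM (ger0_norm (sum_sqr_ge0 u)) mulrA ler_wpM2r//.
  exact: sum_sqr_ge0.
rewrite normrN normrM ger0_norm// mulrCA ler_wpM2l//.
by apply: pairing_le => k; rewrite !mxE.
Qed.

(** Along a ray the transform is a power series. *)
Lemma gauss_transform_ray e x : 0 < e ->
  (forall s, 0 < s <= 1 -> exists2 t, 0 < t < s & gauss_transform e (t *: x) = 0) ->
  gauss_transform e x = 0.
Proof.
move=> e0 H; pose X u : R[i] := 0 +i* (- (2 * pairing x u)).
have E t : gauss_transform e (t *: x) = integralC mu setT
    (fun u => h u * cexp (gauss_phase e 0 u) * cexp (t%:C * X u)).
  apply: eq_integralC => u; rewrite -mulrA -cexpD; congr (_ * cexp _).
  rewrite -[t *: x]add0r gauss_phase_add; congr (_ + _).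
  have -> : pairing (t *: x) u = t * pairing x u.
    by rewrite /pairing mulr_sumr; apply: eq_bigr => k _; rewrite mxE mulrA.
  by apply: complexP; rewrite ?Re_scale ?Im_scale/=; ring.
rewrite -[x]scale1r E.
have mX : measurable_fun setT X.
  have mp := measurable_pairing x.
  have m1 : measurable_fun setT (fun u => - (2 * pairing x u)).
    by apply: measurableT_comp => //; exact: measurable_funM.
  by apply: measurable_toC; [exact: measurable_cst|exact: m1].
apply: (@phase_identity _ _ _ mu _ X 2) => //.
- exact: measurable_gauss_integrand.
- under [X in _ \o X]eq_fun do rewrite normc_gauss_integrand.
  pose a := \sum_k `|x 0 k|.
  apply: (@integrable_gauss_line e 0 (4 * a)) => //.
  + by rewrite lexx.
  + by rewrite mulr_ge0// sumr_ge0.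
  + by apply: measurable_funM => //; exact: measurable_fun_normc.
  + move=> u; rewrite mul0r add0r ger0_norm ?mulr_ge0 ?normc_ge0//.
    rewrite normc_imaginary normrN normrM ger0_norm//.
    have : `|pairing x u| <= a * \sum_k `|y k u|.
      by apply: pairing_le => k; rewrite /a (bigD1 k)//= lerDl sumr_ge0.
    lra.
- move=> s s0; have [|t /andP[t0 ts] Ht] := H (Num.min s 1).
    by rewrite lt_min s0 ltr01 ge_min lexx orbT.
  exists t%:C; last by rewrite -E.
  rewrite normcR gtr0_norm// t0 (lt_le_trans ts)// ge_min lexx//.
- by rewrite rmorph1 Normc.normc1 ltr1n.
Qed.

End gaussian_transform.

(** * Real coordinates *)

Section row_coordinates.
Context {R : realType}.
Variable m : nat.
Implicit Types (u z : 'rV[R[i]]_m) (x : 'rV[R]_(m + m)).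

Definition row_coord (k : 'I_(m + m)) u : R :=
  match fintype.split k with inl j => Re (u 0 j) | inr j => Im (u 0 j) end.

(** Chosen so that the real pairing with the coordinates of [u] is [Im (cdot z u)]. *)
Definition row_dual z : 'rV[R]_(m + m) :=
  \row_k match fintype.split k with inl j => Im (z 0 j) | inr j => - Re (z 0 j) end.

Lemma row_coordl j u : row_coord (lshift m j) u = Re (u 0 j).
Proof. by rewrite /row_coord (unsplitK (inl j)). Qed.

Lemma row_coordr j u : row_coord (rshift m j) u = Im (u 0 j).
Proof. by rewrite /row_coord (unsplitK (inr j)). Qed.

Lemma row_duall j z : row_dual z 0 (lshift m j) = Im (z 0 j).
Proof. by rewrite mxE (unsplitK (inl j)). Qed.

Lemma row_dualr j z : row_dual z 0 (rshift m j) = - Re (z 0 j).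
Proof. by rewrite mxE (unsplitK (inr j)). Qed.

Lemma row_dual_surj x : exists z, x = row_dual z.
Proof.
exists (\row_j ((- x 0 (rshift m j)) +i* x 0 (lshift m j))).
apply/rowP => k; rewrite -(splitK k); case: (fintype.split k) => j /=.
  by rewrite row_duall mxE.
by rewrite row_dualr mxE opprK.
Qed.

Lemma sum_sqr_row_coord u : sum_sqr row_coord u = cnorm u ^+ 2.
Proof.
rewrite /sum_sqr big_split_ord/= cnorm_sqr -big_split/=; apply: eq_bigr => j _.
by rewrite row_coordl row_coordr normc_sqr.
Qed.

Lemma sum_sqr_row_dual z : \sum_k row_dual z 0 k ^+ 2 = cnorm z ^+ 2.
Proof.
rewrite big_split_ord/= cnorm_sqr -big_split/=; apply: eq_bigr => j _.
by rewrite row_duall row_dualr normc_sqr sqrrN addrC.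
Qed.

Lemma pairing_row_dual z u : pairing row_coord (row_dual z) u = Im (cdot z u).
Proof.
rewrite /pairing big_split_ord/= /cdot Im_sum -big_split/=.
apply: eq_bigr => j _; rewrite row_duall row_dualr row_coordl row_coordr.
by rewrite Im_mul Re_conjc Im_conjc; ring.
Qed.

Lemma measurable_row_coord k : measurable_fun setT (row_coord k).
Proof.
rewrite /row_coord; case: fintype.split => j.
- by apply: measurable_fun_Re; exact: measurable_entry.
- by apply: measurable_fun_Im; exact: measurable_entry.
Qed.

End row_coordinates.

(** * Uniqueness for the heat equation in a shrinking domain *)

Section limits.
Context {R : realType}.

Lemma le_of_linear_error (a b C r : R) : 0 < r ->
  (forall s, 0 < s < r -> a <= b + C * s) -> a <= b.
Proof.
move=> r0 H; apply/ler_addgt0Pr => e e0.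
pose s := Num.min (r / 2) (e / (`|C| + 1)).
have c0 : 0 < `|C| + 1 by rewrite ltr_wpDl.
have s0 : 0 < s by rewrite lt_min !divr_gt0.
have sr : s < r.
  by rewrite (le_lt_trans (y := r / 2)) ?ge_min ?lexx// ltr_pdivrMr// ltr_pMr// ltr1n.
have se : s <= e / (`|C| + 1) by rewrite ge_min lexx orbT.
rewrite (le_trans (H s _)) ?s0// lerD2l.
rewrite (le_trans (ler_wpM2r (ltW s0) (ler_norm C)))//.
rewrite ler_pdivlMr// in se; rewrite (le_trans _ se)// mulrC ler_wpM2l ?(ltW s0)//.
by rewrite lerDl.
Qed.

Lemma expR_le3 (y : R) : `|y| <= 1 ->
  expR y <= 1 + y + y ^+ 2 / 2 + expR 1 * `|y| ^+ 3.
Proof.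
move=> y1; have := @cexp_remainder R y%:C 1 `|y| 3.
rewrite normr_ge0 y1 normcR mulr1 => /(_ isT erefl ler01).
rewrite cexpR => H; have := le_trans (le_trans (ler_norm _) (normc_Re _)) H.
have := taylor_sum3 y%:C (fun=> 1); under eq_bigr do rewrite mulr1; move=> ->.
rewrite !mulr1 Re_sub !Re_add expr2 !Re_mul !Im_mul/=; lra.
Qed.

(** Here [v] is known by a Taylor expansion only, with [w] as derivative, and [v - f]
    has a maximum at [a] from the left. *)
Lemma left_max_derive (f v : R -> R) (a b w C r : R) : 0 < r ->
  is_derive a 1 f b ->
  (forall s, 0 < s < r -> `|v (a - s) - v a + s * w| <= C * s ^+ 2) ->
  (forall s, 0 < s < r -> v (a - s) - f (a - s) <= v a - f a) ->
  b <= w.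
Proof.
move=> r0 [df fb] H1 H2.
have fb' : h^-1 *: (f (h *: 1 + a) - f a) @[h --> 0^'] --> b.
  by rewrite -fb; exact: df.
apply/ler_addgt0Pr => e e0.
have e20 : 0 < e / 2 by rewrite divr_gt0.
have /cvgrPdist_le /(_ _ e20) := fb'.
move=> -[d /= d0 Hd].
pose r' := Num.min d r.
have r'0 : 0 < r' by rewrite lt_min d0 r0.
suff : b - e / 2 <= w by move: e0; lra.
apply: (@le_of_linear_error _ _ C r') => // s /andP[s0].
rewrite lt_min => /andP[sd sr].
have := Hd (- s); rewrite /ball/= sub0r opprK gtr0_norm// oppr_eq0 gt_eqF//.
move=> /(_ sd isT); rewrite /GRing.scale/= mulr1 [- s + a]addrC.
rewrite ler_norml => /andP[_ H3].
have := H1 s; rewrite s0 sr => /(_ isT); rewrite ler_norml => /andP[h1 _].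
have := H2 s; rewrite s0 sr => /(_ isT).
set f' := f (a - s) in H3 *; set v' := v (a - s) in h1 * => h2.
have h3 : b - e / 2 <= (f a - f') / s.
  by move: H3; rewrite invrN; lra.
rewrite (le_trans h3)// ler_pdivrMr//; move: h1 h2; lra.
Qed.

End limits.

Section barrier.
Context {R : realType}.
Variables (n : nat) (K : R).
Hypothesis n0 : (0 < n)%N.
Hypothesis K0 : 0 < K.
Implicit Types (S e s x : R).

(** [e ^ (- n)], written as an exponential to be differentiated with the
    logarithm. *)
Definition npow e : R := expR (- (n%:R * ln e)).
Definition gauss S e : R := expR (- (S / e)).
(** Here [S] stands for [|x|^2] and [e] for the time. The product [npow e * gauss S e]
    solves the heat equation, and [- npow e] has a positive time derivative, so that
    [npow e * (K * gauss S e - 1)] is a supersolution. The logarithm costs less than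
    that derivative, and makes the barrier grow faster than [npow e] when [e] tends
    to [0]. *)
Definition barrier S e : R := npow e * ((K - ln e / 2) * gauss S e - 1).

Definition barrier_time S e : R :=
  npow e * (- (n%:R / e) * ((K - ln e / 2) * gauss S e - 1)
    - gauss S e / (2 * e) + (K - ln e / 2) * gauss S e * (S / e ^+ 2)).

Lemma is_derive_barrier S e : 0 < e ->
  is_derive e 1 (barrier S) (barrier_time S e).
Proof.
move=> e0.
have dl : is_derive e 1 (@ln R) e^-1 by exact: is_derive1_ln.
have en0 : e != 0 by rewrite gt_eqF.
have dV : is_derive e 1 (fun x : R => x^-1) (- e ^- 2).
  by apply: (is_derive_eq (is_deriveV en0 (is_derive_id e 1))); rewrite /GRing.scale/= mulr1.
have dn : is_derive e 1 npow (npow e * (- (n%:R / e))).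
  have h := is_derive_scale (- n%:R) dl.
  have h' := @is_derive1_comp _ expR _ e _ _ (is_derive_expR _) h.
  rewrite (_ : npow = expR \o (fun t => - n%:R * ln t)).
    by apply: (is_derive_eq h'); rewrite /npow/= !mulNr.
  by apply/funext => t; rewrite /npow/= mulNr.
have dg : is_derive e 1 (gauss S) (gauss S e * (S / e ^+ 2)).
  have h := is_derive_scale (- S) dV.
  have h' := @is_derive1_comp _ expR _ e _ _ (is_derive_expR _) h.
  rewrite (_ : gauss S = expR \o (fun t => - S * t^-1)).
    by apply: (is_derive_eq h'); rewrite /gauss/= mulNr mulrNN.
  by apply/funext => t; rewrite /gauss/= mulNr.
have dL : is_derive e 1 (fun t => K + (- 2^-1) * ln t) ((- 2^-1) * e^-1).
  have h := is_deriveD (is_derive_cst K e 1) (is_derive_scale (- 2^-1) dl).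
  by apply: (is_derive_eq h); rewrite add0r.
have d1 := is_deriveD (is_derive_mul dL dg) (is_derive_cst (-1 : R) e 1).
have d2 := is_derive_mul dn d1.
rewrite (_ : barrier S = fun t => npow t * ((fun t => (K + - 2^-1 * ln t) * gauss S t) + cst (-1)) t).
  by apply: (is_derive_eq d2); rewrite /barrier_time !fctE/=; field.
by apply/funext => t; rewrite /barrier !fctE/=; congr (_ * (_ * _ - _)); field.
Qed.

Lemma gauss_second_difference S e x : 0 < e -> exists C r, 0 < r /\
  forall s, 0 < s < r ->
  gauss (S + 2 * x * s + s ^+ 2) e + gauss (S - 2 * x * s + s ^+ 2) e
    - 2 * gauss S e <=
  gauss S e * ((4 * x ^+ 2 / e ^+ 2 - 2 / e) * s ^+ 2 + C * s ^+ 3).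
Proof.
move=> e0; pose L := (2 * `|x| + 1) / e.
have L0 : 0 < L by rewrite divr_gt0// ltr_wpDl// mulr_ge0.
exists (e ^- 2 + 2 * expR 1 * L ^+ 3), (Num.min 1 L^-1); split.
  by rewrite lt_min ltr01 invr_gt0.
move=> s /andP[s0]; rewrite lt_min => /andP[s1 sL].
have split_gauss t : gauss (S + t) e = gauss S e * expR (- (t / e)).
  by rewrite /gauss -expRD mulrDl opprD.
have yL (t : R) : `|t| = `|x| -> `|- ((2 * t * s + s ^+ 2) / e)| <= s * L.
  move=> tx; rewrite normrN normrM (gtr0_norm (_ : 0 < e^-1)) ?invr_gt0//.
  rewrite /L mulrA ler_wpM2r ?invr_ge0 ?(ltW e0)//.
  rewrite (le_trans (ler_normD _ _))// !normrM tx (gtr0_norm s0).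
  rewrite (gtr0_norm (_ : 0 < 2))// mulrDr mulr1 lerD//.
    by rewrite mulrC.
  by rewrite ler_piMl ?ltW.
have sL1 : s * L <= 1 by rewrite -ler_pdivlMr// div1r ltW.
have B (t : R) : `|t| = `|x| -> expR (- ((2 * t * s + s ^+ 2) / e)) <=
    1 - (2 * t * s + s ^+ 2) / e + ((2 * t * s + s ^+ 2) / e) ^+ 2 / 2 +
    expR 1 * (s * L) ^+ 3.
  move=> tx; have h := yL t tx.
  rewrite (le_trans (expR_le3 (le_trans h sL1)))// sqrrN lerD2l.
  by rewrite ler_wpM2l ?expR_ge0// lerXn2r ?nnegrE// ltW// mulr_gt0.
have B1 := B x erefl; have B2 := B (- x) (normrN _).
rewrite -!addrA (_ : - (2 * x * s) + s ^+ 2 = 2 * - x * s + s ^+ 2); last by ring.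
rewrite !split_gauss [leLHS](_ : _ = gauss S e * (
  expR (- ((2 * x * s + s ^+ 2) / e)) + expR (- ((2 * - x * s + s ^+ 2) / e)) - 2));
  last by ring.
rewrite ler_wpM2l ?expR_ge0//.
have s4 : s ^+ 4 / e ^+ 2 <= s ^+ 3 / e ^+ 2.
  rewrite ler_wpM2r ?invr_ge0 ?sqr_ge0//.
  by rewrite exprS ler_piMl ?exprn_ge0 ?ltW.
rewrite (le_trans (y := 2 - 2 * s ^+ 2 / e + 4 * x ^+ 2 / e ^+ 2 * s ^+ 2 +
   s ^+ 4 / e ^+ 2 + 2 * expR 1 * (s * L) ^+ 3 - 2))//.
  rewrite lerD2r (le_trans (lerD B1 B2))// le_eqVlt; apply/orP; left.
  by apply/eqP; field; rewrite gt_eqF.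
rewrite exprMn; move: s4; lra.
Qed.

(** The left-hand side is a quarter of the Laplacian of the barrier in [2 n] variables.
    The difference is [npow e / e * (n - gauss S e / 2)]. *)
Lemma barrier_supersolution S e : 0 < e -> 0 <= S ->
  npow e * (K - ln e / 2) * gauss S e * (S / e ^+ 2 - n%:R / e) < barrier_time S e.
Proof.
move=> e0 S0; rewrite -subr_gt0 /barrier_time.
have -> : npow e * (- (n%:R / e) * ((K - ln e / 2) * gauss S e - 1)
    - gauss S e / (2 * e) + (K - ln e / 2) * gauss S e * (S / e ^+ 2)) -
  npow e * (K - ln e / 2) * gauss S e * (S / e ^+ 2 - n%:R / e) =
  npow e / e * (n%:R - gauss S e / 2) by field; rewrite gt_eqF.
rewrite mulr_gt0//; first by rewrite divr_gt0// expR_gt0.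
have g1 : gauss S e <= 1.
  by rewrite /gauss -expR0 ler_expR oppr_le0 divr_ge0// ltW.
have n1 : 1 <= n%:R :> R by rewrite ler1n.
move: g1 n1; lra.
Qed.

End barrier.

Lemma second_difference_bound {R : realType} (vp vm v s m1 m2 gp gm g0 P t c3 : R) :
  vp - (gp - P) <= v - (g0 - P) -> vm - (gm - P) <= v - (g0 - P) ->
  v + s * m1 + m2 - c3 <= vp -> v + - s * m1 + m2 - c3 <= vm ->
  gp + gm - 2 * g0 <= t -> 2 * m2 <= t + 2 * c3.
Proof. lra. Qed.

Section heat_uniqueness.
Context {d} {T : measurableType d} {R : realType}.
Variable mu : {measure set T -> \bar R}.
Variables (h : T -> R[i]) (n : nat) (y : 'I_(n + n) -> T -> R).
Hypothesis mh : measurable_fun setT h.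
Hypothesis my : forall k, measurable_fun setT (y k).
Hypothesis n0 : (0 < n)%N.
Implicit Types (e s a : R) (x : 'rV[R]_(n + n)) (c : R[i]).

Hypothesis ih : forall e, 0 < e ->
  mu.-integrable setT (EFin \o (fun u => normc (h u) * expR (- (e * sum_sqr y u)))).
Variable A : R.
Hypothesis hA : forall e, 0 < e <= 4^-1 ->
  \int[mu]_u (normc (h u) * expR (- (e * sum_sqr y u))) <= A * npow n e.

Variable rho : R.
Hypothesis rho0 : 0 < rho.

Let V := gauss_transform mu h y.
Let S x : R := \sum_k x 0 k ^+ 2.
Let G e : R := rho ^+ 2 * (e * (2^-1 - e)).

Hypothesis hV : forall e x, 0 < e < 2^-1 -> S x = G e -> V e x = 0.

(* This makes the barrier positive on the domain: there [gauss] is at least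
   [expR (- rho ^+ 2 / 2)]. *)
Let K : R := 2 * expR (rho ^+ 2 / 2).

Let K0 : 0 < K. Proof. by rewrite mulr_gt0// expR_gt0. Qed.

Let ln_neg e : 0 < e <= 4^-1 -> ln e <= 0.
Proof.
move=> /andP[e0 e4]; rewrite -ler_expR lnK ?posrE// expR0 (le_trans e4)//.
by rewrite invf_le1// ler1n.
Qed.

Let S_ge0 x : 0 <= S x. Proof. by apply: sumr_ge0 => k _; exact: sqr_ge0. Qed.

Let barrier_lower e x : 0 < e <= 4^-1 -> S x <= G e ->
  npow n e * (1 - ln e / 2 * expR (- (rho ^+ 2 / 2))) <= barrier n K (S x) e.
Proof.
move=> e04 SG; have /andP[e0 e4] := e04; rewrite /barrier ler_wpM2l ?expR_ge0//.
have l0 := ln_neg e04.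
have g : expR (- (rho ^+ 2 / 2)) <= gauss (S x) e.
  rewrite /gauss ler_expR lerN2 ler_pdivrMr// (le_trans SG)// /G.
  have : 0 <= rho ^+ 2 * (e * e) by rewrite mulr_ge0 ?sqr_ge0// mulr_ge0 ?ltW.
  lra.
have KE : K * expR (- (rho ^+ 2 / 2)) = 2.
  by rewrite /K -mulrA -expRD subrr expR0 mulr1.
have : (K - ln e / 2) * expR (- (rho ^+ 2 / 2)) <= (K - ln e / 2) * gauss (S x) e.
  by rewrite ler_wpM2l//; move: K0 l0; lra.
by rewrite mulrBl KE; lra.
Qed.

Let D e0 : set (R * 'rV[R]_(n + n)) :=
  [set p | e0 <= p.1 <= 4^-1 /\ S p.2 <= G p.1].

Let cont_coord k (p : R * 'rV[R]_(n + n)) :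
  {for p, continuous (fun p : R * 'rV[R]_(n + n) => p.2 0 k)}.
Proof.
have H := @coord_continuous R 1 (n + n) 0 k p.2.
exact: (continuous_comp (f := snd) (g := fun M : 'rV[R]_(n + n) => M 0 k) cvg_snd H).
Qed.

Let cont_S (p : R * 'rV[R]_(n + n)) :
  {for p, continuous (fun p : R * 'rV[R]_(n + n) => S p.2)}.
Proof.
suff H (r : seq 'I_(n + n)) : (fun p : R * 'rV[R]_(n + n) =>
    \sum_(k <- r) p.2 0 k ^+ 2) @ p --> \sum_(k <- r) p.2 0 k ^+ 2 by exact: H.
elim: r => [|k r IH].
  by under eq_fun do rewrite big_nil; rewrite big_nil; exact: cvg_cst.
under eq_fun do rewrite big_cons; rewrite big_cons.
have H := @cont_coord k p.
exact: (cvgD (cvgM H H) IH).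
Qed.

Let cont_G (p : R * 'rV[R]_(n + n)) :
  {for p, continuous (fun p : R * 'rV[R]_(n + n) => G p.1)}.
Proof.
have H : {for p, continuous (fun p : R * 'rV[R]_(n + n) => p.1)} by exact: cvg_fst.
exact: (cvgM (cvg_cst _) (cvgM H (cvgB (cvg_cst _) H))).
Qed.

Let compact_D e0 : 0 < e0 -> compact (D e0).
Proof.
move=> e00.
pose B := `[e0, 4^-1]%classic `*` [set x : 'rV[R]_(n + n) | forall k, `[- rho, rho]%classic (x 0 k)].
have cB : compact B.
  apply: compact_setX; first exact: segment_compact.
  by apply: (@rV_compact _ _ (fun=> `[- rho, rho]%classic)) => k; exact: segment_compact.
apply: (subclosed_compact _ cB).
  have -> : D e0 = fst @^-1` [set t | e0 <= t] `&` (fst @^-1` [set t | t <= 4^-1] `&`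
      (fun p : R * 'rV[R]_(n + n) => S p.2 - G p.1) @^-1` [set t | t <= 0]).
    apply/seteqP; split => p /=; rewrite subr_le0.
      by move=> [/andP[e1 e2] SG].
    by move=> [e1 [e2 SG]]; split => //; apply/andP.
  apply: closedI; first by apply: preimage_closed => // p _; exact: cvg_fst.
  apply: closedI; first by apply: preimage_closed => // p _; exact: cvg_fst.
  apply: preimage_closed => // p _.
  exact: (cvgB (@cont_S p) (@cont_G p)).
move=> p [/andP[e1 e2] SG]; split; first by rewrite /= in_itv/= e1 e2.
move=> k; rewrite /= in_itv/= -ler_norml.
rewrite -(@ler_pXn2r _ 2)// ?nnegrE//; last exact: ltW.
rewrite real_normK ?num_real//.
have Sk : p.2 0 k ^+ 2 <= S p.2.
  by rewrite /S (bigD1 k)//= lerDl; apply: sumr_ge0 => j _; exact: sqr_ge0.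
rewrite (le_trans Sk)// (le_trans SG)// /G ler_piMr ?sqr_ge0//.
have p0 : 0 < p.1 := lt_le_trans e00 e1.
have : 0 <= p.1 * p.1 by rewrite mulr_ge0 ?ltW.
by move: e2 p0; lra.
Qed.

Let cont_V e x : 0 < e -> forall c, normc c <= 1 ->
  {for (e, x), continuous (fun p : R * 'rV[R]_(n + n) => Re (c * V p.1 p.2))}.
Proof.
move=> e0 c c1; have [C HC] := gauss_transform_lipschitz mh my ih x e0.
apply/cvgrPdist_le => /= eps eps0.
pose th := Num.min 1 (eps / (`|C| + 1)).
have C1 : 0 < `|C| + 1 by rewrite ltr_wpDl.
have th0 : 0 < th by rewrite lt_min ltr01 divr_gt0.
have th1 : th <= 1 by rewrite ge_min lexx.
have the : th <= eps / (`|C| + 1) by rewrite ge_min lexx orbT.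
have r0 : 0 < th * Num.min 1 (e / 2).
  by rewrite mulr_gt0// lt_min ltr01 divr_gt0.
exists (ball e (th * Num.min 1 (e / 2)), ball x (th * Num.min 1 (e / 2))).
  by split; exact: nbhsx_ballx.
move=> [e' x'] /= [be [_ bx]].
have cth : `|C| * th <= eps.
  rewrite ler_pdivlMr// in the; rewrite (le_trans _ the)// mulrC ler_wpM2l ?(ltW th0)//.
  by rewrite lerDl.
have h1 : `|e' - e| <= th * (e / 2).
  rewrite distrC (le_trans (ltW be))// ler_wpM2l ?(ltW th0)//.
  by rewrite ge_min lexx orbT.
have h2 k : `|x' 0 k - x 0 k| <= th.
  rewrite distrC (le_trans (ltW (bx 0 k)))// ler_piMr ?(ltW th0)//.
  by rewrite ge_min lexx.
have h3 := HC e' x' th _ h1 h2.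
rewrite -Re_sub -mulrBr (le_trans (normc_Re _))// Normc.normcM.
rewrite (le_trans (ler_wpM2r (normc_ge0 _) c1))// mul1r -normcN opprB.
by rewrite (le_trans (h3 _)) ?(ltW th0)// (le_trans _ cth)// ler_wpM2r ?ler_norm// ltW.
Qed.

Let cont_barrier e x : 0 < e ->
  {for (e, x), continuous (fun p : R * 'rV[R]_(n + n) => barrier n K (S p.2) p.1)}.
Proof.
move=> e0.
have c1 : {for (e, x), continuous (fun p : R * 'rV[R]_(n + n) => p.1)} by exact: cvg_fst.
have cV : {for (e, x), continuous (fun p : R * 'rV[R]_(n + n) => p.1^-1)}.
  by apply: cvgV => //=; rewrite gt_eqF.
have cl : {for (e, x), continuous (fun p : R * 'rV[R]_(n + n) => ln p.1)}.
  exact: (continuous_comp (f := fst) (g := @ln R) c1 (continuous_ln e0)).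
have ce (f : R * 'rV[R]_(n + n) -> R) : {for (e, x), continuous f} ->
    {for (e, x), continuous (fun p => expR (f p))}.
  by move=> cf; exact: (continuous_comp (g := @expR R) cf (@continuous_expR R _)).
have cn : {for (e, x), continuous (fun p : R * 'rV[R]_(n + n) => npow n p.1)}.
  by apply: (ce (fun p => - (n%:R * ln p.1))); exact: (cvgN (cvgM (cvg_cst _) cl)).
have cg : {for (e, x), continuous (fun p : R * 'rV[R]_(n + n) => gauss (S p.2) p.1)}.
  by apply: (ce (fun p => - (S p.2 / p.1))); exact: (cvgN (cvgM (@cont_S _) cV)).
exact: (cvgM cn (cvgB (cvgM (cvgB (cvg_cst _) (cvgM cl (cvg_cst _))) cg) (cvg_cst _))).
Qed.

Let Re_contraction c (z : R[i]) : normc c <= 1 -> `|Re (c * z)| <= normc z.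
Proof.
move=> c1; rewrite (le_trans (normc_Re _))// Normc.normcM ler_piMl//.
exact: normc_ge0.
Qed.

Let S_delta x k s : S (x + s *: delta_mx 0 k) = S x + 2 * x 0 k * s + s ^+ 2.
Proof.
rewrite /S (bigD1 k)//= [in RHS](bigD1 k)//= !mxE !eqxx/= mulr1.
rewrite (eq_bigr (fun j => x 0 j ^+ 2)); first by ring.
by move=> j jk; rewrite !mxE eqxx/= (negbTE jk) mulr0 addr0.
Qed.

(** At a maximum the second differences in each coordinate are nonpositive. *)
Let second_order e0 e x k c del : 0 < e0 <= e -> e <= 4^-1 -> S x < G e ->
  normc c <= 1 -> 0 < del ->
  (forall p, D e0 p -> Re (c * V p.1 p.2) - del * barrier n K (S p.2) p.1 <=
    Re (c * V e x) - del * barrier n K (S x) e) ->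
  Re (c * gauss_moment mu h y e x (coord_phase y k) 2) <=
  del * (npow n e * (K - ln e / 2) * gauss (S x) e *
    (4 * x 0 k ^+ 2 / e ^+ 2 - 2 / e)).
Proof.
move=> /andP[e00 ee0] e4 SG c1 del0 maxF.
have e_gt0 : 0 < e := lt_le_trans e00 ee0.
have e04 : 0 < e <= 4^-1 by rewrite e_gt0.
have [C HC] := gauss_space_expansion mh my ih x k e_gt0.
have [C' [r' [r'0 HC']]] := gauss_second_difference (S x) (x 0 k) e_gt0.
pose gap := G e - S x; have gap0 : 0 < gap by rewrite subr_gt0.
pose q := 2 * `|x 0 k| + 1; have q0 : 0 < q by rewrite ltr_wpDl// mulr_ge0.
pose coef := del * (npow n e * (K - ln e / 2)).
have coef0 : 0 < coef.
  rewrite mulr_gt0// mulr_gt0 ?expR_gt0//.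
  by have := ln_neg e04; move: K0; lra.
pose r := Num.min (Num.min 1 r') (gap / q).
have r0 : 0 < r by rewrite !lt_min ltr01 r'0 divr_gt0.
apply: (@le_of_linear_error _ _ _ (2 * C + coef * gauss (S x) e * C') r r0).
move=> s /andP[s0]; rewrite !lt_min => /andP[/andP[s1 sr'] sgap].
have s20 : 0 < s ^+ 2 by rewrite exprn_gt0.
rewrite ltr_pdivlMr// in sgap.
have inD t : `|t| = s -> D e0 (e, x + t *: delta_mx 0 k).
  move=> ts; split => /=; first by rewrite ee0.
  rewrite S_delta -lerBrDr.
  have h1 : 2 * x 0 k * t <= 2 * `|x 0 k| * s.
    by rewrite (le_trans (ler_norm _))// !normrM ts gtr0_norm.
  have h2 : t ^+ 2 <= s.
    by rewrite -(real_normK (num_real t)) ts expr2 ler_piMl ?ltW.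
  have : 2 * `|x 0 k| * s + s <= gap by move: sgap; rewrite /q; lra.
  by rewrite /gap; move: h1 h2; lra.
have step t : `|t| = s -> Re (c * V e x) +
    t * Re (c * gauss_moment mu h y e x (coord_phase y k) 1) +
    s ^+ 2 / 2 * Re (c * gauss_moment mu h y e x (coord_phase y k) 2) - C * s ^+ 3 <=
    Re (c * V e (x + t *: delta_mx 0 k)).
  move=> ts; have := HC t; rewrite ts => /(_ (ltW s1)) H.
  have := le_trans (Re_contraction _ c1) H.
  rewrite -(real_normK (num_real t)) ts ler_norml => /andP[+ _].
  rewrite mulrBr !mulrDr Re_sub !Re_add ![c * (_%:C * _)]mulrCA !Re_scale.
  by rewrite -lerBrDl addrC.
have B1 := maxF _ (inD s (gtr0_norm s0)).
have B2 := maxF _ (inD (- s) (etrans (normrN s) (gtr0_norm s0))).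
have S1 := step s (gtr0_norm s0).
have S2 := step (- s) (etrans (normrN s) (gtr0_norm s0)).
rewrite /= !S_delta in B1 B2.
have := HC' s; rewrite s0 sr' => /(_ isT) G1.
rewrite mulrN sqrrN in B2.
have G2 := ler_wpM2l (ltW coef0) G1.
have bE S' : del * barrier n K S' e = coef * gauss S' e - del * npow n e.
  by rewrite /barrier /coef; ring.
rewrite !bE in B1 B2.
rewrite -(ler_pM2l s20).
have -> : s ^+ 2 * (del * (npow n e * (K - ln e / 2) * gauss (S x) e *
      (4 * x 0 k ^+ 2 / e ^+ 2 - 2 / e)) +
    (2 * C + coef * gauss (S x) e * C') * s) =
  coef * (gauss (S x) e * ((4 * x 0 k ^+ 2 / e ^+ 2 - 2 / e) * s ^+ 2 +
    C' * s ^+ 3)) + 2 * C * s ^+ 3.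
  by rewrite /coef; ring.
rewrite mulrBr mulrDr mulrCA in G2.
have H := second_difference_bound B1 B2 S1 S2 G2.
rewrite -[2 * C * _]mulrA; apply: le_trans H.
by rewrite le_eqVlt; apply/orP; left; apply/eqP; field.
Qed.

(** At a maximum the difference quotients backwards in time are nonnegative. The
    domain is open towards the past at interior points, and the final time is
    included. *)
Let first_order e0 e x c del : 0 < e0 < e -> e <= 4^-1 -> S x < G e ->
  normc c <= 1 -> 0 < del ->
  (forall p, D e0 p -> Re (c * V p.1 p.2) - del * barrier n K (S p.2) p.1 <=
    Re (c * V e x) - del * barrier n K (S x) e) ->
  del * barrier_time n K (S x) e <=
  Re (c * gauss_moment mu h y e x (fun u => (- sum_sqr y u)%:C) 1).
Proof.
move=> /andP[e00 ee0] e4 SG c1 del0 maxF.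
have e_gt0 : 0 < e := lt_trans e00 ee0.
have [C HC] := gauss_time_expansion mh my ih x e_gt0.
pose gap := G e - S x; have gap0 : 0 < gap by rewrite subr_gt0.
have rho20 : 0 < rho ^+ 2 by rewrite exprn_gt0.
pose r := Num.min (Num.min (e / 2) (e - e0)) (Num.min 2^-1 (gap / rho ^+ 2)).
have r0 : 0 < r by rewrite !lt_min !divr_gt0// subr_gt0 ee0 invr_gt0 ltr0n.
apply: (@left_max_derive _ (fun t => del * barrier n K (S x) t)
  (fun t => Re (c * V t x)) e (del * barrier_time n K (S x) e)
  (Re (c * gauss_moment mu h y e x (fun u => (- sum_sqr y u)%:C) 1)) C r r0).
- exact/is_derive_scale/is_derive_barrier.
- move=> s /andP[s0]; rewrite !lt_min => /andP[/andP[se _] _].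
  have := HC (- s); rewrite normrN gtr0_norm// sqrrN => /(_ (ltW se)) H.
  rewrite -Re_scale -Re_sub -Re_add mulrCA -mulrBr -mulrDr.
  rewrite (le_trans (Re_contraction _ c1))// (le_trans _ H)// rmorphN.
  by rewrite mulNr opprK.
- move=> s /andP[s0]; rewrite !lt_min => /andP[/andP[_ se] /andP[s2 sg]].
  apply: (maxF (e - s, x)); split => /=; first by lra.
  rewrite ltr_pdivlMr// in sg.
  have : rho ^+ 2 * s <= gap by rewrite mulrC ltW.
  have : 0 <= rho ^+ 2 * (s * (2^-1 + 2 * e - s)).
    rewrite mulr_ge0 ?(ltW rho20)// mulr_ge0 ?(ltW s0)//; lra.
  rewrite /gap /G; lra.
Qed.

(** If the difference with a small multiple of the barrier were positive somewhere,
    it would have a positive maximum. This is not at the initial time [e0], where the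
    barrier dominates the bound on [V], nor on the lateral boundary, where [V]
    vanishes; elsewhere it contradicts the supersolution property. *)
Let estimate c del x0 : normc c <= 1 -> 0 < del -> S x0 <= G 4^-1 ->
  Re (c * V 4^-1 x0) <= del * barrier n K (S x0) 4^-1.
Proof.
move=> c1 del0 Sx0; rewrite leNgt; apply/negP => pos.
pose q := expR (- (rho ^+ 2 / 2)); have q0 : 0 < q by exact: expR_gt0.
pose M := 2 * `|A| / (del * q).
pose e0 := Num.min 4^-1 (expR (- M)).
have e00 : 0 < e0 by rewrite lt_min expR_gt0 andbT invr_gt0.
have e04 : e0 <= 4^-1 by rewrite ge_min lexx.
have le0 : ln e0 <= - M.
  by rewrite -ler_expR lnK ?posrE// ge_min lexx orbT.
have big : A < del * (1 - ln e0 / 2 * q).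
  have : del * q * M = 2 * `|A| by rewrite /M mulrC divfK// gt_eqF// mulr_gt0.
  have : 0 <= del * q * (- M - ln e0) by rewrite !mulr_ge0 ?(ltW del0) ?(ltW q0)// subr_ge0.
  have := ler_norm A; lra.
pose F (p : R * 'rV[R]_(n + n)) := Re (c * V p.1 p.2) - del * barrier n K (S p.2) p.1.
have D0 : D e0 (4^-1, x0) by split => //=; rewrite e04 lexx.
have cF : {within D e0, continuous F}.
  apply: continuous_in_subspaceT => -[e x]; rewrite inE => -[/= /andP[e1 _] _].
  have e_gt0 := lt_le_trans e00 e1.
  exact: (cvgB (@cont_V e x e_gt0 c c1) (cvgM (cvg_cst _) (@cont_barrier e x e_gt0))).
have [[e x] + maxF] := compact_EVT_max (ex_intro _ _ D0) (compact_D e00) cF.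
rewrite inE => -[/= /andP[e1 e2] SG].
have e_gt0 := lt_le_trans e00 e1.
have e14 : 0 < e <= 4^-1 by rewrite e_gt0.
have Fpos : 0 < Re (c * V e x) - del * barrier n K (S x) e.
  apply: lt_le_trans (maxF (4^-1, x0) _); last by rewrite inE.
  by rewrite /F/= subr_gt0.
have low := barrier_lower e14 SG; rewrite -/q in low.
have ln0 := ln_neg e14.
have bar0 : 0 < barrier n K (S x) e.
  rewrite (lt_le_trans _ low)// mulr_gt0 ?expR_gt0//.
  by have : 0 <= - ln e * q; [rewrite mulr_ge0 ?(ltW q0)// oppr_ge0|lra].
have SG' : S x < G e.
  rewrite lt_def SG andbT; apply/eqP => E.
  have V0 : V e x = 0 by apply: hV => //; rewrite e_gt0/=; lra.
  move: Fpos; rewrite V0 mulr0/= sub0r oppr_gt0 => /lt_geF.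
  by rewrite mulr_ge0// ltW.
have e01 : e0 < e.
  rewrite lt_def e1 andbT; apply/eqP => E; rewrite -E in big.
  have h1 := le_trans (le_trans (ler_norm _) (Re_contraction (V e x) c1))
    (le_trans (gauss_transform_bound mh my ih x e_gt0) (hA e14)).
  have h2 : A * npow n e <= npow n e * (del * (1 - ln e / 2 * q)).
    by rewrite mulrC ler_wpM2l ?expR_ge0// ltW.
  have h3 := ler_wpM2l (ltW del0) low.
  have h4 := le_trans h1 h2; rewrite mulrCA in h4.
  by move: Fpos; rewrite subr_gt0 ltNge (le_trans h4 h3).
have H1 : del * barrier_time n K (S x) e <=
    Re (c * gauss_moment mu h y e x (fun u => (- sum_sqr y u)%:C) 1).
  apply: (first_order (e0 := e0)) => //; first by rewrite e00.
  by move=> p Dp; apply: maxF; rewrite inE.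
have H2 k : Re (c * gauss_moment mu h y e x (coord_phase y k) 2) <=
    del * (npow n e * (K - ln e / 2) * gauss (S x) e *
    (4 * x 0 k ^+ 2 / e ^+ 2 - 2 / e)).
  apply: (second_order (e0 := e0)) => //; first by rewrite e00.
  by move=> p Dp; apply: maxF; rewrite inE.
have := barrier_supersolution K n0 e_gt0 (S_ge0 x).
rewrite -(ltr_pM2l del0) ltNge => /negP; apply; apply: le_trans H1 _.
rewrite (gauss_heat mh my ih)// mulrCA Re_scale mulr_sumr Re_sum.
have e4 : 0 <= 4^-1 :> R by rewrite invr_ge0.
have H3 := ler_wpM2l e4 (ler_sum (index_enum 'I_(n + n)) (P := xpredT) (fun k _ => H2 k)).
apply: le_trans H3 _.
rewrite -mulr_sumr -mulr_sumr sumrB -mulr_suml -mulr_sumr sumr_const card_ord.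
rewrite -/(S x) -[_ *+ (n + n)]mulr_natr natrD.
by rewrite le_eqVlt; apply/orP; left; apply/eqP; field; rewrite gt_eqF.
Qed.

(** Letting the multiple of the barrier tend to zero gives the vanishing in the
    ball of radius [rho / 4] at time [1/4]; along rays it spreads everywhere. *)
Lemma heat_uniqueness x : V 4^-1 x = 0.
Proof.
have e4 : 0 < 4^-1 :> R by rewrite invr_gt0.
have inner x0 : S x0 <= G 4^-1 -> V 4^-1 x0 = 0.
  move=> Sx0; apply: normc_eq0; apply/eqP; rewrite eq_le normc_ge0 andbT.
  apply: normc_le_Re => c c1; apply/ler_addgt0Pr => e e0; rewrite add0r.
  pose B := barrier n K (S x0) 4^-1.
  have B0 : 0 < `|B| + 1 by rewrite ltr_wpDl.
  rewrite (le_trans (estimate c1 (divr_gt0 e0 B0) Sx0))// -mulrA ler_piMr ?(ltW e0)//.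
  by rewrite mulrC ler_pdivrMr// mul1r (le_trans (ler_norm _))// lerDl.
have G0 : 0 < G 4^-1.
  rewrite /G mulr_gt0 ?exprn_gt0// mulr_gt0//; lra.
apply: (gauss_transform_ray mh my ih e4) => s /andP[s0 s1].
pose t := Num.min (s / 2) (G 4^-1 / (S x + 1)).
have Sx1 : 0 < S x + 1 by rewrite ltr_wpDl.
have t0 : 0 < t by rewrite lt_min !divr_gt0.
have ts : t < s.
  by rewrite (le_lt_trans (y := s / 2)) ?ge_min ?lexx// ltr_pdivrMr// ltr_pMr// ltr1n.
have tG : t <= G 4^-1 / (S x + 1) by rewrite ge_min lexx orbT.
exists t; first by rewrite t0.
apply: inner; have -> : S (t *: x) = t ^+ 2 * S x.
  by rewrite /S mulr_sumr; apply: eq_bigr => k _; rewrite mxE exprMn.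
rewrite ler_pdivlMr// in tG; apply: le_trans tG; rewrite expr2 -mulrA.
have t1 : t <= 1 by rewrite (le_trans (ltW ts)).
rewrite ler_wpM2l ?(ltW t0)// (le_trans (y := S x)) ?lerDl//.
by rewrite ler_piMl.
Qed.

End heat_uniqueness.

(** * Vanishing of the Fourier coefficients *)

Section characters.
Context {R : realType}.
Variable n : nat.
Local Notation V := 'rV[R[i]]_(n + 1).
Local Notation lebC := (lebesgueC R (n + 1)).
Local Notation vv := (@last_coord R n).

Lemma gauss_split_integral (e c : R) : 0 < e -> 0 < c ->
  lebC.-integrable setT (EFin \o (fun u : V =>
    expR (- (e * cnorm (lsubmx u) ^+ 2 + c * normc (vv u) ^+ 2)))) /\
  \int[lebC]_u expR (- (e * cnorm (lsubmx u) ^+ 2 + c * normc (vv u) ^+ 2)) =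
  (pi / e) ^+ n * (pi / c).
Proof.
move=> e0 c0; pose w (j : 'I_(n + 1)) := if fintype.split j is inl _ then e else c.
have wl j : w (lshift 1 j) = e by rewrite /w (unsplitK (inl j)).
have wr j : w (rshift n j) = c by rewrite /w (unsplitK (inr j)).
have w0 j : 0 < w j by rewrite /w; case: fintype.split.
have E (u : V) : e * cnorm (lsubmx u) ^+ 2 + c * normc (vv u) ^+ 2 =
    \sum_j w j * normc (u 0 j) ^+ 2.
  rewrite big_split_ord/= big_ord1 wr; congr (_ + _).
  rewrite cnorm_sqr mulr_sumr; apply: eq_bigr => j _.
  by rewrite wl mxE.
have P : \prod_j (pi / w j) = (pi / e) ^+ n * (pi / c) :> R.
  rewrite big_split_ord/= big_ord1 wr; congr (_ * _).
  by under eq_bigr do rewrite wl; rewrite prodr_const card_ord.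
have G := gauss_row w0.
have mG := measurable_gauss_row w.
under eq_fun do rewrite E; split.
  apply/integrableP; split; first exact: mG.
  under eq_integral => u _ do rewrite /= ger0_norm ?expR_ge0//.
  by rewrite G ltry.
by rewrite /Rintegral G/= P.
Qed.

Lemma kernel_exponent_pair z w (b c1 c2 c1' c2' tau s1 s2 : R[i]) (u : V) :
  c1 * cdot z (lsubmx u) = c1' * cdot w (lsubmx u) ->
  c2 * (cdot z (lsubmx u))^* = c2' * (cdot w (lsubmx u))^* ->
  kernel_exponent w b c1' c2' tau s1 s2 u = kernel_exponent z b c1 c2 tau s1 s2 u.
Proof. by rewrite /kernel_exponent => -> ->. Qed.

Variable g : V -> R[i].
Hypothesis mg : measurable_fun setT g.
Hypothesis Lg : L1_Linfty lebC g.

Local Notation K := (kernel_integral g).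

Let real_coord (k : 'I_(n + n)) (u : V) : R := row_coord k (lsubmx u).

Let measurable_real_coord k : measurable_fun setT (real_coord k).
Proof.
exact: (measurableT_comp (measurable_row_coord k) (@measurable_lsubmx R n)).
Qed.

Let sum_sqr_real_coord u : sum_sqr real_coord u = cnorm (lsubmx u) ^+ 2.
Proof. exact: sum_sqr_row_coord. Qed.

Let h s1 s2 u := g u * cexp (kernel_exponent 0 0 0 0 (8^-1)%:C s1 s2 u).

Let gauss_transform_kernel s1 s2 e z :
  gauss_transform lebC (h s1 s2) real_coord e (row_dual z) =
  K z e%:C (-1) 1 (8^-1)%:C s1 s2.
Proof.
apply: eq_integralC => u; rewrite -mulrA -cexpD; congr (_ * cexp _).
have -> : gauss_phase real_coord e (row_dual z) u =
    - e%:C * (cnorm (lsubmx u) ^+ 2)%:C - cdot z (lsubmx u) + (cdot z (lsubmx u))^*.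
  have P : pairing real_coord (row_dual z) u = Im (cdot z (lsubmx u)).
    exact: pairing_row_dual.
  rewrite /gauss_phase sum_sqr_real_coord P; apply: complexP.
  - by rewrite Re_add Re_sub Re_conjc Re_mul Re_opp Im_opp/=; ring.
  - by rewrite Im_add Im_sub Im_conjc Im_mul Re_opp Im_opp/=; ring.
by rewrite /kernel_exponent; ring.
Qed.

Let mh s1 s2 : measurable_fun setT (h s1 s2).
Proof. exact: measurable_kernel_integrand. Qed.

Let norm_h s1 s2 e u : normc (h s1 s2 u) * expR (- (e * sum_sqr real_coord u)) =
  normc (g u) * expR (Re (kernel_exponent 0 e%:C 0 0 (8^-1)%:C s1 s2 u)).
Proof.
rewrite /h Normc.normcM normc_cexp -mulrA -expRD; congr (_ * expR _).
have -> : kernel_exponent 0 e%:C 0 0 (8^-1)%:C s1 s2 u =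
    kernel_exponent 0 0 0 0 (8^-1)%:C s1 s2 u + - e%:C * (cnorm (lsubmx u) ^+ 2)%:C.
  by rewrite /kernel_exponent; ring.
rewrite [RHS]Re_add; congr (_ + _); rewrite sum_sqr_real_coord Re_mul Re_opp/=; ring.
Qed.

Let Re_exponent_le e s1 s2 u :
  Re (kernel_exponent 0 e%:C 0 0 (8^-1)%:C s1 s2 u) <=
  4 * (normc s1 + normc s2) ^+ 2 -
  (e * cnorm (lsubmx u) ^+ 2 + 16^-1 * normc (vv u) ^+ 2).
Proof.
have := Re_kernel_exponent_le 0 e%:C 0 0 (8^-1)%:C s1 s2 u.
rewrite Normc.normc0 addr0 !mul0r sub0r/= => /le_trans; apply.
have := sqr_ge0 (2 * (normc s1 + normc s2) - normc (vv u) / 4).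
lra.
Qed.

Let ih s1 s2 e : 0 < e -> lebC.-integrable setT (EFin \o (fun u =>
  normc (h s1 s2 u) * expR (- (e * sum_sqr real_coord u)))).
Proof.
move=> e0; under eq_fun do rewrite norm_h.
apply: (kernel_integrable (C := 4 * (normc s1 + normc s2) ^+ 2) (al := 0) (ga := e)
  (al' := 0) (ga' := 16^-1) mg Lg _ e0).
- by apply: measurable_fun_Re; exact: measurable_kernel_exponent.
- by rewrite invr_gt0.
- by move=> u; rewrite (le_trans (Re_exponent_le _ _ _ _))//; lra.
Qed.

Let npow_ge1 (e : R) : 0 < e <= 4^-1 -> 1 <= npow n e.
Proof.
move=> /andP[e0 e4]; rewrite /npow -expR0 ler_expR oppr_ge0 mulr_ge0_le0//.
rewrite -ler_expR lnK ?posrE// expR0 (le_trans e4)//.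
by rewrite invf_le1// ler1n.
Qed.

Let npowE (e : R) : 0 < e -> npow n e = (e ^-1) ^+ n.
Proof.
move=> e0; rewrite /npow -mulrN mulrC expRM_natr expRN lnK//.
Qed.

(** Both parts of [g] contribute at most a multiple of [e ^- n]. *)
Let growth s1 s2 : exists A, forall e, 0 < e <= 4^-1 ->
  \int[lebC]_u (normc (h s1 s2 u) * expR (- (e * sum_sqr real_coord u))) <=
  A * npow n e.
Proof.
have [M [k [M0 k0 ik gk]]] := Lg.
pose B := expR (4 * (normc s1 + normc s2) ^+ 2).
exists (B * (M * (pi ^+ n * (pi / 16^-1)) + \int[lebC]_u k u)) => e e04.
have /andP[e0 e4] := e04; have [iG EG] := gauss_split_integral e0 (c := 16^-1) ltac:(by rewrite invr_gt0).
set G := fun u => _ in iG EG.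
have iMG : lebC.-integrable setT (EFin \o (fun u => M * G u)).
  exact: integrable_scale_real.
have iB : lebC.-integrable setT (EFin \o (fun u => B * (M * G u + k u))).
  by apply: integrable_scale_real; exact: (integrableD measurableT iMG ik).
apply: (@le_trans _ _ (\int[lebC]_u (B * (M * G u + k u)))).
  apply: le_Rintegral => //; first exact: ih.
  move=> u _; rewrite norm_h.
  have h1 : expR (Re (kernel_exponent 0 e%:C 0 0 (8^-1)%:C s1 s2 u)) <= B * G u.
    by rewrite /B /G -expRD ler_expR Re_exponent_le.
  have G1 : G u <= 1.
    rewrite /G -expR0 ler_expR oppr_le0.
    by apply: addr_ge0; apply: mulr_ge0; rewrite ?sqr_ge0 ?invr_ge0// ltW.
  apply: le_trans (ler_wpM2l (normc_ge0 _) h1) _; rewrite mulrCA ler_wpM2l ?expR_ge0//.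
  rewrite (le_trans (ler_wpM2r (expR_ge0 _) (gk u)))// mulrDl lerD2l.
  by rewrite ler_piMr.
rewrite RintegralZl//; last exact: (integrableD measurableT iMG ik).
rewrite RintegralD// RintegralZl// EG -[leRHS]mulrA ler_wpM2l ?expR_ge0//.
rewrite [leRHS]mulrDl lerD//.
  rewrite npowE// expr_div_n -!mulrA ler_wpM2l// exprVn.
  by rewrite le_eqVlt; apply/orP; left; apply/eqP; ring.
by rewrite ler_peMr ?npow_ge1//; apply: Rintegral_ge0 => u _.
Qed.

Variable rho : R.
Hypothesis n0 : (0 < n)%N.
Hypothesis rho0 : 0 < rho.
Hypothesis K0 : forall t z s, 0 < t -> cnorm z = rho ->
  K z (t + 4^-1)%:C (t - 4^-1)%:C (t + 4^-1)%:C t%:C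
    ((t - 4^-1)%:C * s) ((t + 4^-1)%:C * s^*) = 0.

Lemma kernel_characters_eq0 z s1 s2 : K z (4^-1)%:C (-1) 1 (8^-1)%:C s1 s2 = 0.
Proof.
rewrite -gauss_transform_kernel; have [A hA] := growth s1 s2.
apply: (heat_uniqueness (@mh s1 s2) measurable_real_coord n0 (@ih s1 s2) hA rho0).
move=> e x /andP[e0 e2]; have [w ->] := row_dual_surj x.
rewrite sum_sqr_row_dual gauss_transform_kernel => Hw.
pose kap := Num.sqrt (e * (2^-1 - e)).
have kap2 : 0 < e * (2^-1 - e) by rewrite mulr_gt0// subr_gt0.
have kap0 : 0 < kap by rewrite sqrtr_gt0.
have e02 : 0 < e < 2^-1 by rewrite e0.
have wr : cnorm (kap^-1%:C *: w) = rho.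
  apply/eqP; rewrite -(@eqrXn2 _ 2) ?cnorm_ge0 ?(ltW rho0)//.
  rewrite cnormZr exprMn Hw real_normK ?num_real// exprVn sqr_sqrtr ?(ltW kap2)//.
  by rewrite mulrCA mulVf ?mulr1// gt_eqF.
rewrite -[RHS](kernel_vanishing_on_sphere mg Lg K0 s1 s2 e02 wr) -/kap.
apply: eq_integralC => u; congr (_ * cexp _).
have c1 : kap%:C * kap^-1%:C = 1 :> R[i].
  by rewrite -rmorphM/= divff ?gt_eqF.
apply: kernel_exponent_pair.
- by rewrite cdotZl mulrA rmorphN mulNr c1.
- apply: complexP; rewrite cdotZl.
    by rewrite Re_scale Re_mul/= !Re_conjc Re_scale mulrA divff ?gt_eqF//; ring.
  by rewrite Im_scale Im_mul/= !Im_conjc Im_scale -mulrN mulrA divff ?gt_eqF//; ring.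
Qed.

End characters.

(** * Uniqueness of the Fourier transform *)

Section fourier.
Context {d} {T : measurableType d} {R : realType}.
Variable mu : {measure set T -> \bar R}.
Variables (m : nat) (y : 'I_m -> T -> R).
Hypothesis my : forall k, measurable_fun setT (y k).
Implicit Types (f g : T -> R[i]) (x : 'rV[R]_m) (F : T -> R) (c : R[i]).

Definition character x (u : T) : R[i] := cexp (0 +i* pairing y x u).

(** These functions form a space stable under multiplication by bounded functions of
    the coordinates; this is shown for larger and larger classes of such functions, up
    to indicator functions. *)
Definition fourier_null f :=
  integrableC mu f /\ forall x, integralC mu setT (fun u => f u * character x u) = 0.

Let normc_character x u : normc (character x u) = 1.
Proof. by rewrite normc_cexp expR0. Qed.

Let measurable_character x : measurable_fun setT (character x).
Proof.
apply: measurable_funC_cexp; apply: measurable_toC; first exact: measurable_cst.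
exact: measurable_pairing.
Qed.

Lemma integrableC_bounded f g : integrableC mu f -> measurable_fun setT g ->
  (forall u, normc (g u) <= 1) -> integrableC mu (fun u => f u * g u).
Proof.
move=> [mf nf] mg g1.
apply: (integrableC_le (h := fun u => normc (f u))) => //.
  exact: measurable_funC_mul.
by move=> u; rewrite Normc.normcM ler_piMr// normc_ge0.
Qed.

Let int_char f x : integrableC mu f -> integrableC mu (fun u => f u * character x u).
Proof. by move=> fi; apply: integrableC_bounded => // u; rewrite normc_character. Qed.

Lemma fourier_nullD f g : fourier_null f -> fourier_null g ->
  fourier_null (fun u => f u + g u).
Proof.
move=> [fi f0] [gi g0]; split=> [|x]; first exact: integrableCD.
under eq_integralC do rewrite mulrDl.
by rewrite integralCD ?f0 ?g0 ?addr0//; exact: int_char.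
Qed.

Lemma fourier_nullZ c f : fourier_null f -> fourier_null (fun u => c * f u).
Proof.
move=> [fi f0]; split=> [|x]; first exact: integrableCZ.
under eq_integralC do rewrite -mulrA.
by rewrite integralCZ ?f0 ?mulr0//; exact: int_char.
Qed.

Lemma fourier_nullB f g : fourier_null f -> fourier_null g ->
  fourier_null (fun u => f u - g u).
Proof.
move=> nf ng; under eq_fun do rewrite -mulN1r.
by apply: fourier_nullD => //; exact: fourier_nullZ.
Qed.

Lemma fourier_null_character f x : fourier_null f ->
  fourier_null (fun u => f u * character x u).
Proof.
move=> [fi f0]; split=> [|x']; first exact: int_char.
rewrite -[RHS](f0 (x + x')); apply: eq_integralC => u.
rewrite -mulrA -cexpD; congr (_ * cexp _).
apply: complexP; rewrite ?Re_add ?Im_add/= ?addr0// /pairing -big_split/=.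
by apply: eq_bigr => k _; rewrite mxE mulrDl.
Qed.

(** Exponentials of a bounded function are power series in it. *)
Lemma fourier_null_exp f F (C a : R) : measurable_fun setT F ->
  (forall u, `|F u| <= C) ->
  (forall j, fourier_null (fun u => f u * (F u)%:C ^+ j)) ->
  fourier_null (fun u => f u * (expR (a * F u))%:C).
Proof.
move=> mF FC nF.
have fi : integrableC mu f.
  by have [] := nF 0; under eq_fun do rewrite expr0 mulr1.
have a0 : 0 < `|a| + 1 by rewrite ltr_wpDl.
have mfc x : measurable_fun setT (fun u => f u * character x u).
  by have [] := int_char x fi.
have mFC : measurable_fun setT (fun u => (F u)%:C) by exact: measurable_funC_real.
have ie x : mu.-integrable setT (EFin \o (fun u =>
    normc (f u * character x u) * expR ((`|a| + 1) * normc (F u)%:C))).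
  have [mf nf] := fi.
  have := integrable_scale_real (expR ((`|a| + 1) * C)) nf.
  apply: integrable_le_real.
    apply: measurable_funM; first exact: measurable_fun_normc.
    apply: measurableT_comp => //; apply: measurable_funM => //.
    exact: measurable_fun_normc.
  move=> u; rewrite ger0_norm ?mulr_ge0 ?normc_ge0 ?expR_ge0// mulrC.
  rewrite Normc.normcM normc_character mulr1 ler_wpM2r ?normc_ge0// ler_expR.
  by rewrite ler_wpM2l ?(ltW a0)// normcR.
have E x u : f u * character x u * cexp (a%:C * (F u)%:C) =
    f u * (expR (a * F u))%:C * character x u.
  by rewrite -rmorphM/= cexpR mulrAC.
have ar : normc a%:C <= `|a| + 1 by rewrite normcR lerDl.
have ar' : normc a%:C < `|a| + 1 by rewrite normcR ltrDl.
split=> [|x].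
  have := integrableC_phase (mfc 0) mFC (ie 0) ar.
  have -> : (fun u => f u * character 0 u * cexp (a%:C * (F u)%:C)) =
      fun u => f u * (expR (a * F u))%:C.
    apply/funext => u; rewrite E /character /pairing big1 ?cexp0 ?mulr1//.
    by move=> k _; rewrite mxE mul0r.
  by [].
under eq_integralC do rewrite -E.
apply: (phase_eq0_moments (mfc x) mFC a0 (ie x) _ ar') => k.
have [_ /(_ x) <-] := nF k; apply: eq_integralC => u; exact: mulrAC.
Qed.

Let Rintegral_limit (p : T -> R) (Fn : (T -> R)^nat) F :
  mu.-integrable setT (EFin \o p) ->
  (forall j, measurable_fun setT (Fn j)) -> measurable_fun setT F ->
  (forall j u, `|Fn j u| <= 1) -> (forall u, Fn ^~ u @ \oo --> F u) ->
  (forall j, \int[mu]_u (p u * Fn j u) = 0) -> \int[mu]_u (p u * F u) = 0.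
Proof.
move=> ip mFn mF Fn1 FnF i0.
have mp : measurable_fun setT p by exact/measurable_EFinP/measurable_int/ip.
have ipn j : mu.-integrable setT (EFin \o (fun u => p u * Fn j u)).
  apply: (integrable_le_real (h2 := fun u => `|p u|)).
  - exact: measurable_funM.
  - by move=> u; rewrite normrM ler_piMr.
  - exact: integrable_abse ip.
have [] := @dominated_convergence _ _ _ mu setT measurableT
  (fun j u => (p u * Fn j u)%:E) (fun u => (p u * F u)%:E) (fun u => `|p u|%:E).
- by move=> j; apply/measurable_EFinP; exact: measurable_funM.
- by apply/measurable_EFinP; exact: measurable_funM.
- apply: aeW => u _; apply: cvg_EFin; first exact: nearW.
  exact: (cvgM (cvg_cst _) (FnF u)).
- exact: integrable_abse ip.
- by apply: aeW => u j _; rewrite abse_EFin lee_fin normrM ler_piMr.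
move=> iF _ cF.
have Z : (fun j => \int[mu]_u (p u * Fn j u)%:E)%E = cst 0%E.
  apply/funext => j; have := i0 j; rewrite /Rintegral => Hj.
  rewrite -[LHS]fineK ?Hj//; exact: integrable_fin_num (ipn j).
rewrite Z in cF.
have := cvg_unique _ cF (cvg_cst 0%E).
by rewrite /Rintegral => ->.
Qed.

Lemma fourier_null_cvg f (Fn : (T -> R)^nat) F : integrableC mu f ->
  (forall j, measurable_fun setT (Fn j)) -> measurable_fun setT F ->
  (forall j u, `|Fn j u| <= 1) -> (forall u, Fn ^~ u @ \oo --> F u) ->
  (forall j, fourier_null (fun u => f u * (Fn j u)%:C)) ->
  fourier_null (fun u => f u * (F u)%:C).
Proof.
move=> fi mFn mF Fn1 FnF nFn.
have F1 u : `|F u| <= 1.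
  have cn : `|Fn j u| @[j --> \oo] --> `|F u| by apply: cvg_norm; exact: FnF.
  by apply: (ler_cvg_to cn (cvg_cst (1 : R))); apply: nearW => j; exact: Fn1.
split=> [|x].
  apply: integrableC_bounded => //; first exact: measurable_funC_real.
  by move=> u; rewrite normcR.
have gi := int_char x fi.
have E (H : T -> R) u : f u * (H u)%:C * character x u =
    (H u)%:C * (f u * character x u) by rewrite mulrAC mulrC.
have N0 j : integralC mu setT (fun u => (Fn j u)%:C * (f u * character x u)) = 0.
  by have [_ /(_ x) <-] := nFn j; apply: eq_integralC => u; rewrite E.
under eq_integralC do rewrite E.
apply: complexP; rewrite ?Re_integralC ?Im_integralC.
- under eq_Rintegral => u _ do rewrite Re_scale mulrC.
  apply: (Rintegral_limit (integrableC_Re gi) mFn mF Fn1 FnF) => j.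
  apply: etrans (congr1 (fun z => Re z) (N0 j)); rewrite Re_integralC.
  by apply: eq_Rintegral => u _; rewrite Re_scale mulrC.
- under eq_Rintegral => u _ do rewrite Im_scale mulrC.
  apply: (Rintegral_limit (integrableC_Im gi) mFn mF Fn1 FnF) => j.
  apply: etrans (congr1 (fun z => Im z) (N0 j)); rewrite Im_integralC.
  by apply: eq_Rintegral => u _; rewrite Im_scale mulrC.
Qed.

Lemma fourier_null_sin f k (a c : R) : fourier_null f ->
  fourier_null (fun u => f u * (sin (a * y k u + c))%:C).
Proof.
move=> nf; pose e := a *: delta_mx 0 k : 'rV[R]_m.
have pe u : pairing y e u = a * y k u by rewrite pairing_delta.
have pN u : pairing y (- e) u = - (a * y k u).
  by rewrite -pe /pairing -sumrN; apply: eq_bigr => j _; rewrite mxE mulNr.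
have -> : (fun u => f u * (sin (a * y k u + c))%:C) = fun u =>
    ((sin c / 2) +i* (- (cos c / 2))) * (f u * character e u) +
    ((sin c / 2) +i* (cos c / 2)) * (f u * character (- e) u).
  apply/funext => u.
  transitivity (f u * (((sin c / 2) +i* (- (cos c / 2))) * character e u +
    ((sin c / 2) +i* (cos c / 2)) * character (- e) u)); last by ring.
  congr (_ * _); rewrite /character pe pN.
  by apply: complexP; rewrite ?Re_add ?Im_add ?Re_mul ?Im_mul ?Re_cexp ?Im_cexp/=
    expR0 !mul1r cosN sinN ?sinD; field.
exact: (fourier_nullD (fourier_nullZ _ (fourier_null_character e nf))
  (fourier_nullZ _ (fourier_null_character (- e) nf))).
Qed.

(** These tend to the indicator of [0 < X] and are obtained from trigonometric
    polynomials by two exponentials of bounded functions. *)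
Let step (X : R) (j : nat) : R :=
  expR (- j%:R * expR (- (j%:R ^+ 2) * sin (X / j%:R))).

Lemma fourier_null_step f k (c : R) j : fourier_null f ->
  fourier_null (fun u => f u * (step (y k u - c) j)%:C).
Proof.
move=> nf.
pose s u := sin (j%:R^-1 * y k u + - (c / j%:R)).
have ms : measurable_fun setT s.
  apply: (measurableT_comp (continuous_measurable_fun (@continuous_sin R))).
  by apply: measurable_funD => //; exact: measurable_funM.
have s1 u : `|s u| <= 1 by rewrite ler_norml sin_geN1 sin_le1.
have ns i f' : fourier_null f' -> fourier_null (fun u => f' u * (s u)%:C ^+ i).
  elim: i f' => [|i IH] f' nf'; first by under eq_fun do rewrite expr0 mulr1.
  under eq_fun do rewrite exprS mulrA.
  by apply: IH; exact: fourier_null_sin.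
have ne a : fourier_null (fun u => f u * (expR (a * s u))%:C).
  by apply: (fourier_null_exp _ ms s1) => i; exact: ns.
pose t u := expR (- (j%:R ^+ 2) * s u).
have mt : measurable_fun setT t.
  by apply: measurableT_comp => //; exact: measurable_funM.
have t1 u : `|t u| <= expR (j%:R ^+ 2).
  rewrite ger0_norm ?expR_ge0// ler_expR (le_trans (ler_norm _))//.
  by rewrite normrM normrN (ger0_norm (sqr_ge0 _)) ler_piMr ?sqr_ge0.
have nt a : fourier_null (fun u => f u * (expR (a * t u))%:C).
  apply: (fourier_null_exp _ mt t1) => i.
  under eq_fun => u do rewrite -rmorphXn/= /t -expRM_natl mulrA.
  exact: ne.
have := nt (- j%:R); congr fourier_null; apply/funext => u.
by rewrite /step /t /s mulrBl [_^-1 * _]mulrC.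
Qed.

Let step_le0 (X : R) (j : nat) : X <= 0 -> - X <= j%:R -> (0 < j)%N ->
  step X j <= j%:R^-1.
Proof.
move=> X0 Xj j0; have j0' : 0 < j%:R :> R by rewrite ltr0n.
have s0 : sin (X / j%:R) <= 0.
  rewrite -oppr_ge0 -sinN sin_ge0_pi// -mulNr divr_ge0 ?oppr_ge0//=.
  rewrite (le_trans (y := 1)) ?ler_pdivrMr ?mul1r//.
  by rewrite (le_trans _ (pi_ge2 R))// ler1n.
have e1 : 1 <= expR (- j%:R ^+ 2 * sin (X / j%:R)).
  by rewrite -[leLHS]expR0 ler_expR mulNr oppr_ge0 mulr_ge0_le0 ?sqr_ge0.
apply: (@le_trans _ _ (expR (- j%:R))).
  by rewrite ler_expR mulNr lerN2 ler_peMr// ltW.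
rewrite expRN lef_pV2 ?posrE ?expR_gt0//.
by rewrite (le_trans _ (expR_ge1Dx _))// lerDr.
Qed.

Let step_gt0 (X : R) (j : nat) : 0 < X -> 2 * expR 1 * X <= j%:R -> (0 < j)%N ->
  1 - 8 / X ^+ 2 / j%:R <= step X j.
Proof.
move=> X0 Xj j0; have j0' : 0 < j%:R :> R by rewrite ltr0n.
pose t := X / j%:R; have t0 : 0 < t by rewrite divr_gt0.
have E0 : 0 < 2 * expR 1 :> R by rewrite mulr_gt0 ?expR_gt0.
have t6 : t <= (2 * expR 1)^-1.
  by rewrite ler_pdivrMr// ler_pdivlMl.
have E1 : (2 * expR 1)^-1 <= 1 :> R.
  by rewrite invf_le1//; have := expR_ge1Dx (1 : R); lra.
have st : t / 2 <= sin t.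
  have := @cexp_remainder R (0 +i* t) 1 t 2.
  rewrite (ltW t0) (le_trans t6)// mulr1 => /(_ isT).
  have -> : normc (0 +i* t) = t.
    by rewrite /Normc.normc expr0n add0r sqrtr_sqr gtr0_norm.
  move=> /(_ erefl ler01) H.
  have := le_trans (normc_Im _) H.
  have := taylor_sum2 (0 +i* t) (fun=> 1); under eq_bigr do rewrite mulr1; move=> ->.
  rewrite Im_sub Im_add Im_cexp/= mulr1 expR0 mul1r add0r ler_norml => /andP[+ _].
  have : t ^+ 2 * expR 1 <= t / 2.
    rewrite expr2 -mulrA ler_wpM2l ?(ltW t0)//.
    rewrite (le_trans (ler_wpM2r (expR_ge0 _) t6))//.
    by rewrite invfM -mulrA mulVf ?mulr1// gt_eqF ?expR_gt0.
  lra.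
have h1 : j%:R * X / 2 <= j%:R ^+ 2 * sin t.
  rewrite (_ : _ / 2 = j%:R ^+ 2 * (t / 2)); last first.
    by rewrite /t; field; rewrite gt_eqF.
  by rewrite ler_wpM2l ?sqr_ge0.
pose z := j%:R * X / 2; have z0 : 0 < z by rewrite divr_gt0// mulr_gt0.
have h2 : j%:R * expR (- j%:R ^+ 2 * sin t) <= 8 / X ^+ 2 / j%:R.
  apply: (@le_trans _ _ (j%:R * expR (- z))).
    by rewrite ler_wpM2l ?(ltW j0')// ler_expR mulNr lerN2.
  have h3 : z ^+ 2 / 2 <= expR z.
    by have := expR_ge1Dxn 1 (ltW z0); rewrite (_ : 2`! = 2)%N//; lra.
  rewrite expRN ler_pdivrMr ?expR_gt0//.
  apply: (@le_trans _ _ (8 / X ^+ 2 / j%:R * (z ^+ 2 / 2))).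
    by rewrite le_eqVlt; apply/orP; left; apply/eqP; rewrite /z; field; rewrite !gt_eqF.
  by rewrite ler_wpM2l// !divr_ge0 ?sqr_ge0.
rewrite (le_trans _ (expR_ge1Dx _))// lerD2l mulNr lerN2.
exact: h2.
Qed.

Let step_cvg (X : R) : step X @ \oo --> ((0 < X)%R%:R : R).
Proof.
apply/cvgrPdist_le => /= e e0; have [X0|X0] := ltP 0 X.
  pose N := Num.bound (2 * expR 1 * X + 8 / X ^+ 2 / e).
  have q0 : 0 < 8 / X ^+ 2 by rewrite divr_gt0// exprn_gt0.
  have qe : 0 < 8 / X ^+ 2 / e by rewrite divr_gt0.
  exists N.+1 => // j /= Nj.
  have NX : 2 * expR 1 * X + 8 / X ^+ 2 / e < j%:R.
    rewrite (lt_le_trans (archi_boundP _))//; last by rewrite ler_nat ltnW.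
    by rewrite addr_ge0 ?(ltW qe)// !mulr_ge0 ?expR_ge0// ltW.
  have j0 : (0 < j)%N by exact: leq_trans Nj.
  have h := step_gt0 X0 (_ : 2 * expR 1 * X <= j%:R) j0.
  have {}h := h (ltac:(by rewrite (le_trans _ (ltW NX))// lerDl ltW)).
  have h1 : 8 / X ^+ 2 / j%:R <= e.
    rewrite ler_pdivrMr ?ltr0n// -ler_pdivrMl// [leLHS]mulrC.
    by rewrite (le_trans _ (ltW NX))// lerDr !mulr_ge0 ?expR_ge0// ltW.
  have h2 : step X j <= 1.
    by rewrite /step -[leRHS]expR0 ler_expR mulNr oppr_le0 mulr_ge0 ?expR_ge0.
  by rewrite ger0_norm ?subr_ge0//; lra.
exists (Num.bound (- X + e^-1)).+1 => // j /= Nj.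
have e1 : 0 < e^-1 by rewrite invr_gt0.
have NX : - X + e^-1 < j%:R.
  rewrite (lt_le_trans (archi_boundP _))//; last by rewrite ler_nat ltnW.
  by rewrite addr_ge0 ?oppr_ge0// ltW.
have j0 : (0 < j)%N by exact: leq_trans Nj.
rewrite sub0r normrN ger0_norm ?expR_ge0//.
have Xj : - X <= j%:R by rewrite (le_trans _ (ltW NX))// lerDl ltW.
rewrite (le_trans (step_le0 X0 Xj j0))// invf_ple ?posrE ?ltr0n//.
by rewrite (le_trans _ (ltW NX))// lerDr oppr_ge0.
Qed.

Let measurable_superlevel F (c : R) : measurable_fun setT F ->
  measurable [set u | c < F u].
Proof.
move=> mF; rewrite [X in measurable X](_ : _ = setT `&` F @^-1` `]c, +oo[).
  exact: mF.
by apply/seteqP; split => u /=; rewrite in_itv/= andbT; [|move=> []].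
Qed.

Lemma fourier_null_gt f k (c : R) : fourier_null f ->
  fourier_null (fun u => f u * (\1_[set u | c < y k u] u)%:C).
Proof.
move=> nf; have [fi _] := nf.
have mB : measurable [set u | c < y k u].
  exact: measurable_superlevel.
apply: (fourier_null_cvg (Fn := fun j u => step (y k u - c) j) fi).
- move=> j; apply: measurableT_comp => //; apply: measurable_funM => //.
  apply: measurableT_comp => //; apply: measurable_funM => //.
  apply: (measurableT_comp (continuous_measurable_fun (@continuous_sin R))).
  by apply: measurable_funM => //; apply: measurable_funB.
- exact: measurable_indic.
- move=> j u; rewrite ger0_norm ?expR_ge0// /step -[leRHS]expR0 ler_expR.
  by rewrite mulNr oppr_le0 mulr_ge0 ?expR_ge0.
- move=> u; have := @step_cvg (y k u - c).
  suff -> : \1_[set u | c < y k u] u = (0 < y k u - c)%R%:R :> R by [].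
  by rewrite indicE subr_gt0; congr (_%:R); congr nat_of_bool; apply/idP/idP => /[!inE].
- by move=> j; exact: fourier_null_step.
Qed.

Definition fourier_null_sets : set (set T) :=
  [set B | measurable B /\ forall f, fourier_null f ->
    fourier_null (fun u => f u * (\1_B u)%:C)].

Lemma sigma_algebra_fourier_null : sigma_algebra setT fourier_null_sets.
Proof.
apply/sigma_algebraP => //; split.
- split=> // f nf; under eq_fun do rewrite indicT mulr1; exact: nf.
- move=> A B BA [mA nA] [mB nB]; split=> [|f nf]; first exact: measurableD.
  have := fourier_nullB (nA f nf) (nB f nf); congr fourier_null; apply/funext => u.
  rewrite -mulrBr -rmorphB/=; congr (_ * _%:C).
  rewrite !indicE in_setD; case: (boolP (u \in B)) => [uB|_]; last by rewrite andbT subr0.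
  have -> : u \in A by apply: mem_set; apply: BA; exact: set_mem.
  by rewrite subrr.
- move=> F ndF SF.
  have mU : measurable (\bigcup_j F j).
    by apply: bigcupT_measurable => j; have [] := SF j.
  split=> // f nf; have [fi _] := nf.
  apply: (fourier_null_cvg (Fn := fun j => \1_(F j)) fi).
  + by move=> j; apply: measurable_indic; have [] := SF j.
  + exact: measurable_indic.
  + by move=> j u; rewrite indicE; case: (_ \in _); rewrite ?normr1 ?normr0.
  + move=> u; rewrite indicE; case: (boolP (_ \in _)) => [|nU].
      rewrite inE => -[j _ Fj]; apply: cvg_near_cst; exists j => // i /= ji.
      rewrite indicE mem_set//; apply: (_ : F j `<=` F i) => //.
      by apply/subsetPset; exact: ndF.
    apply: cvg_near_cst; apply: nearW => j; rewrite indicE memNset// => Fj.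
    by move: nU => /negP; apply; rewrite inE; exists j.
  + by move=> j; have [_] := SF j; exact.
- move=> A B [mA nA] [mB nB]; split=> [|f nf]; first exact: measurableI.
  have := nB _ (nA f nf); congr fourier_null; apply/funext => u.
  by rewrite -mulrA -rmorphM/= indicI.
Qed.

Hypothesis generating : forall B, measurable B ->
  <<s [set A : set T | exists k (c : R), A = [set u | c < y k u]] >> B.

Lemma fourier_null_indicator B f : measurable B -> fourier_null f ->
  fourier_null (fun u => f u * (\1_B u)%:C).
Proof.
move=> /generating mB; have [_] : fourier_null_sets B; last by exact.
have := smallest_sub sigma_algebra_fourier_null; move=> /(_ _ _ _ mB); apply.
move=> A [k [c ->]]; split.
  exact: measurable_superlevel.
by move=> g; exact: fourier_null_gt.
Qed.

Let Re_le0 f : fourier_null f -> {ae mu, forall u, Re (f u) <= 0}.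
Proof.
move=> nf; have [fi _] := nf; have [mf _] := fi.
pose B := [set u | 0 < Re (f u)].
have mB : measurable B.
  by apply: measurable_superlevel; exact: measurable_fun_Re.
have [gi /(_ 0) g0] := fourier_null_indicator mB nf.
have E u : Re (f u * (\1_B u)%:C * character 0 u) = Re (f u) * \1_B u.
  have -> : character 0 u = 1.
    by rewrite /character /pairing big1 ?cexp0// => k _; rewrite mxE mul0r.
  by rewrite mulr1 mulrC Re_scale mulrC.
have p0 u : 0 <= Re (f u) * \1_B u.
  rewrite indicE; case: (boolP (u \in B)); rewrite ?mulr0// inE => /ltW.
  by rewrite mulr1.
have ip : mu.-integrable setT (EFin \o (fun u => Re (f u) * \1_B u)).
  have := integrableC_Re gi; apply: eq_integrable => // u _ /=.
  by congr EFin; rewrite [in LHS]mulrC Re_scale mulrC.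
have i0 : (\int[mu]_u `|(Re (f u) * \1_B u)%:E| = 0)%E.
  have := congr1 (fun z => Re z) g0; rewrite Re_integralC.
  under eq_Rintegral do rewrite E.
  rewrite /Rintegral => i0.
  under eq_integral => u _ do rewrite abse_EFin ger0_norm//.
  rewrite -[LHS]fineK ?i0//; exact: integrable_fin_num ip.
have /integrableP[mp _] := ip.
have := (ae_eq_integral_abs mu measurableT mp).1 i0.
apply: filterS => u /(_ I)/= [] H; rewrite leNgt; apply/negP => f0.
have uB : u \in B by rewrite inE.
by move: H; rewrite indicE uB mulr1 => H; rewrite H ltxx in f0.
Qed.

(** The real part of [c * f] is almost everywhere nonpositive for [c] among the
    fourth roots of unity. *)
Theorem fourier_null_eq0 f : fourier_null f -> {ae mu, forall u, f u = 0}.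
Proof.
move=> nf.
have h1 := Re_le0 nf.
have h2 := Re_le0 (fourier_nullZ (-1) nf).
have h3 := Re_le0 (fourier_nullZ (0 +i* 1) nf).
have h4 := Re_le0 (fourier_nullZ (0 +i* (-1)) nf).
have h12 : {ae mu, forall u, Re (f u) = 0}.
  move: h1 h2; apply: filterS2 => u h1 h2; apply/eqP; rewrite eq_le h1/=.
  by move: h2; rewrite mulN1r Re_opp oppr_le0.
have h34 : {ae mu, forall u, Im (f u) = 0}.
  move: h3 h4; apply: filterS2 => u; rewrite !Re_mul/= => h3 h4.
  by apply/eqP; rewrite eq_le; apply/andP; split; lra.
by move: h12 h34; apply: filterS2 => u a1 a2; apply: complexP.
Qed.

End fourier.

Section fourier_uniqueness.
Context {R : realType}.
Variable m : nat.
Local Notation row_coord := (@row_coord R m).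

(** The identity is measurable from the sigma-algebra generated by the half-spaces,
    since its coordinates are. *)
Lemma row_coord_generating (B : set 'rV[R[i]]_m) : measurable B ->
  <<s [set A | exists k (c : R), A = [set u | c < row_coord k u]] >> B.
Proof.
move=> mB; pose G : set (set 'rV[R[i]]_m) :=
  [set A | exists k (c : R), A = [set u | c < row_coord k u]].
have mk k : measurable_fun (setT : set (g_sigma_algebraType G)) (row_coord k).
  apply: (measurability _ (RGenOInfty.measurableE R)) => _ [_ [c ->] <-].
  rewrite setTI; apply: sub_sigma_algebra; exists k, c.
  by apply/seteqP; split => u /=; rewrite in_itv/= andbT.
have mid : measurable_fun (setT : set (g_sigma_algebraType G))
    (fun u => u : 'rV[R[i]]_m).
  apply: measurable_to_row => j; apply: measurable_toC.
  - rewrite (_ : _ \o _ = row_coord (lshift m j)); first exact: mk.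
    by apply/funext => u; rewrite row_coordl.
  - rewrite (_ : _ \o _ = row_coord (rshift m j)); first exact: mk.
    by apply/funext => u; rewrite row_coordr.
have := mid measurableT B mB; rewrite setTI; exact.
Qed.

(** The characters of the real coordinates are those of the Hermitian product. *)
Theorem fourier_uniqueness (h : 'rV[R[i]]_m -> R[i]) :
  integrableC (lebesgueC R m) h ->
  (forall z, integralC (lebesgueC R m) setT
    (fun u => h u * cexp (0 +i* Im (cdot z u))) = 0) ->
  {ae lebesgueC R m, forall u, h u = 0}.
Proof.
move=> ih h0; apply: (fourier_null_eq0 (@measurable_row_coord R m) row_coord_generating).
split=> // x; have [z ->] := row_dual_surj x.
by rewrite -[RHS](h0 z); apply: eq_integralC => u; rewrite /character pairing_row_dual.
Qed.

End fourier_uniqueness.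

(** * Injectivity of the twisted spherical means *)

Theorem theorem3p5 (R : realType) (n : nat) (rho : R) (p : \bar R)
    (f : 'rV[R[i]]_(n + 1) -> R[i]) :
  (1 <= n)%N -> 0 < rho -> (1 <= p)%E ->
  mem_Lp (lebesgueC R (n + 1)) p
    (fun z => (expR (cnorm (lsubmx z) ^+ 2 / 4))%:C * f z) ->
  (forall (r : R) (z : 'rV[R[i]]_(n + 1)),
    0 < r -> csphere rho (lsubmx z) -> twisted_spherical_mean f r z = 0) ->
  {ae lebesgueC R (n + 1), forall z, f z = 0}.
Proof.
move=> n1 rho0 p1 fLp f0.
have [g [mg fg Lg]] := mem_Lp_L1_Linfty p1 fLp.
have K0 t z s : 0 < t -> cnorm z = rho ->
    kernel_integral g z (t + 4^-1)%:C (t - 4^-1)%:C (t + 4^-1)%:C t%:C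
      ((t - 4^-1)%:C * s) ((t + 4^-1)%:C * s^*) = 0.
  move=> t0 zr; pose z' : 'rV[R[i]]_(n + 1) := row_mx z s%:M.
  have lz : lsubmx z' = z by rewrite row_mxKl.
  have vz : last_coord z' = s.
    by rewrite /last_coord row_mxEr mxE eqxx mulr1n.
  have := @gaussian_mean_eq0 R n f g mg Lg fg z' t t0.
  rewrite lz vz; apply => r r0; apply: f0 => //.
  by rewrite /csphere/= lz.
have K1 := kernel_characters_eq0 mg Lg n1 rho0 K0.
pose h u := g u * cexp (kernel_exponent 0 (4^-1)%:C 0 0 (8^-1)%:C 0 0 u).
have ih : integrableC (lebesgueC R (n + 1)) h.
  split; first exact: measurable_kernel_integrand.
  under eq_fun do rewrite /h Normc.normcM normc_cexp.
  apply: (kernel_integrable (C := 0) (al := 0) (ga := 4^-1) (al' := 0)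
    (ga' := 8^-1) mg Lg); rewrite ?invr_gt0//.
    by apply: measurable_fun_Re; exact: measurable_kernel_exponent.
  move=> u; have := Re_kernel_exponent_le 0 (4^-1)%:C 0 0 (8^-1)%:C 0 0 u.
  by rewrite Normc.normc0 addr0 !mul0r/= => /le_trans; apply; lra.
have h0 : {ae lebesgueC R (n + 1), forall u, h u = 0}.
  apply: fourier_uniqueness => // z.
  rewrite -[RHS](K1 ((- 2^-1)%:C *: lsubmx z) (2^-1%:C * last_coord z)
    ((- 2^-1)%:C * (last_coord z)^*)).
  apply: eq_integralC => u; rewrite /h -mulrA -cexpD; congr (_ * cexp _).
  rewrite cdot_split /kernel_exponent cdotZl !mul0r.
  move: (cdot _ _) (last_coord z) (last_coord u) => q a b.
  by apply: complexP; rewrite !(Re_add, Im_add, Re_mul, Im_mul, Re_opp, Im_opp,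
    Re_conjc, Im_conjc)/=; field.
move: fg h0; apply: filterS2 => u fgu /eqP.
rewrite mulf_eq0 (negbTE (cexp_neq0 _)) orbF => /eqP gu.
move: fgu; rewrite gu => /eqP; rewrite mulf_eq0 => /orP[|/eqP//].
by rewrite fmorph_eq0 gt_eqF ?expR_gt0.
Qed.
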